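(* Let $(G,X,x_0)$ be an ambit with $X$ a compact Polish (i.e.\ compact metrisable) space, and let $E$ be a weakly uniformly properly group-like equivalence relation on $X$. Then there are a compact Polish group $K$ and a subgroup $H\le K$ such that $X/E$ (with the quotient topology) is homeomorphic to $K/H$. Moreover, exactly one of the following holds: (1) $E$ is clopen (as a subset of $X^2$) and has finitely many classes; (2) $E$ is closed and has exactly $2^{\aleph_0}$ classes; (3) $E$ is not closed and not smooth, and in this case, if $E$ is analytic, then $E$ has exactly $2^{\aleph_0}$ classes. In particular, $E$ is smooth if and only if $E$ is closed.
   Context: An ambit $(G,X,x_0)$ consists of an abstract group $G$ acting by homeomorphisms on a compact Hausdorff space $X$ and a point $x_0\in X$ whose $G$-orbit is dense in $X$. A morphism of $G$-ambits $(Z,z_0)\to(X,x_0)$ is a continuous $G$-equivariant map sending $z_0$ to $x_0$. An equivalence relation $E$ on a Polish space $X$ is smooth if there is a Borel map $f:X\to 2^{\mathbb N}$ with $x_1Ex_2\iff f(x_1)=f(x_2)$. A subset of a topological space is analytic if it is of the form $\bigcup_{s\in\omega^\omega}\bigcap_n P_{s\restriction n}$ for closed sets $P_t$, $t\in\omega^{<\omega}$. $E$ is group-like if it is $G$-invariant and there is a group operation on $X/E$ making $X/E$ (quotient topology) a topological group with $[gx_0]_E\cdot[x]_E=[gx]_E$ for all $g\in G,x\in X$. A group-like $E$ is properly group-like if there are a group $\tilde G$ and a surjection $\pi:\tilde G\to X$ such that: (i) $\tilde g\mapsto[\pi(\tilde g)]_E$ is a group homomorphism; (ii) whenever $(g_i)$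 is a net in $G$ and $(p_i)$ a net in $X$ with $g_ix_0\to x_1$, $p_i\to x_2$, $g_ip_i\to x_3$, there are $\tilde g_1,\tilde g_2$ with $\pi(\tilde g_1)=x_1$, $\pi(\tilde g_2)=x_2$, $\pi(\tilde g_1\tilde g_2)=x_3$; (iii) $\{\pi(\tilde g_1^{-1}\tilde g_2):\pi(\tilde g_1)=\pi(\tilde g_2)\}$ is closed in $X$. $E$ is uniformly properly group-like if it is properly group-like, witnessed by some $\tilde G,\pi$, and $E=\bigcup\mathcal E$ for a family $\mathcal E$ of closed symmetric subsets of $X^2$ containing the diagonal such that for every $D\in\mathcal E$ there is $D'\in\mathcal E$ with $D\circ D\subseteq D'$ and such that $(x_0,\pi(\tilde g))\in D$ implies $(\pi(\tilde g'),\pi(\tilde g\tilde g'))\in D'$ for all $\tilde g'$. A group-like $F$ on a $G$-ambit $(Z,z_0)$ dominates $E$ on $(X,x_0)$ if there is an ambit morphism $\varphi:Z\to X$ such that $z_1Fz_2\Rightarrow \varphi(z_1)E\varphi(z_2)$ and the induced map $Z/F\to X/E$ is equivariant for some left action of the group $Z/F$ on $X/E$. $E$ is weakly uniformly properly group-like if it is dominated by some uniformly properly group-like relation. *)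

(* Defs.v *)
From HB Require Import structures.
From mathcomp Require Import all_boot all_order all_algebra.
From mathcomp Require Import all_classical all_reals all_analysis.

Set Implicit Arguments.
Unset Strict Implicit.
Unset Printing Implicit Defensive.

Local Open Scope classical_set_scope.
Local Open Scope quotient_scope.

Definition homeomorphic (S T : topologicalType) : Prop :=
  exists (f : S -> T) (g : T -> S),
    [/\ cancel f g, cancel g f, continuous f & continuous g].

Definition polish (R : realType) (T : topologicalType) : Prop :=
  exists M : metricType R,
    [/\ homeomorphic T M,
        forall F : set_system M, ProperFilter F -> cauchy F ->
          exists x : M, F --> x
      & exists2 D : set M, countable D & dense D].

Definition graph (T : Type) (E : equiv_rel T) : set (T * T) :=
  [set p | E p.1 p.2].

Definition quot (T : topologicalType) (E : equiv_rel T) : topologicalType :=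
  quotient_topology {eq_quot E}.

Definition class_of (T : topologicalType) (E : equiv_rel T) (x : T) : quot E :=
  \pi_(quotient_topology {eq_quot E}) x.

Definition borel_map (S T : topologicalType) (f : S -> T) : Prop :=
  forall U : set T, open U -> <<s @open S >> (f @^-1` U).

Definition smooth (T : topologicalType) (E : equiv_rel T) : Prop :=
  exists2 f : T -> cantor_space,
    borel_map f & forall x y, E x y <-> f x = f y.

(* The finite sequence s|n is mkseq s n. *)
Definition analytic (T : topologicalType) (A : set T) : Prop :=
  exists2 P : seq nat -> set T,
    (forall t, closed (P t)) &
    A = \bigcup_(s in [set: nat -> nat]) \bigcap_(n in [set: nat])
          P (mkseq s n).

Definition has_continuum_classes (T : topologicalType) (E : equiv_rel T) : Prop :=
  ([set: quot E] #= [set: nat -> bool])%card.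

(* A group structure on the type T, as data: the library's groupType axioms,   *)
(* kept unbundled because X/E already carries a topology.                      *)
Definition group_law (T : choiceType) : Type :=
  monoid.isGroup.axioms_ T (Choice.class T) (Choice.class T).

Definition law_group (T : choiceType) (L : group_law T) : groupType :=
  HB.pack (Choice.sort T) (L : monoid.isGroup.axioms_ _ _ _).

Definition gmul (T : choiceType) (L : group_law T) (x y : T) : T :=
  ((x : law_group L) * y)%g.

Definition ginv (T : choiceType) (L : group_law T) (x : T) : T :=
  ((x : law_group L)^-1)%g.

Definition left_action (K : groupType) (S : Type) (a : K -> S -> S) : Prop :=
  (forall s, a 1%g s = s) /\ (forall x y s, a (x * y)%g s = a x (a y s)).

Section Coset.
Variables (K : groupType) (H : groupClosed K).
Local Open Scope group_scope.

(* x and y lie in the same left coset of H. *)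
Definition coset_rel : rel K := fun x y => x^-1 * y \in H.

Lemma coset_rel_class : equiv_class_of coset_rel.
Proof.
split=> [x|x y|y x z]; rewrite /coset_rel.
- by rewrite mulVg gpred1.
- by rewrite -gpredV invgM invgK.
- by move=> xy yz; have := gpredM _ _ xy yz; rewrite -mulgA mulVKg.
Qed.

Definition coset_equiv : equiv_rel K := EquivRelPack coset_rel_class.

End Coset.

(* Not assumed Hausdorff: X/E is not Hausdorff when E is not closed. *)
Definition topological_group (T : topologicalType) (L : group_law T) : Prop :=
  continuous (fun p : T * T => gmul L p.1 p.2) /\ continuous (ginv L).

Record ambit (G : groupType) : Type := Ambit {
  space :> topologicalType;
  act : G -> space -> space;
  base : space;
  act1 : forall x, act 1%g x = x;
  actM : forall g h x, act (g * h)%g x = act g (act h x);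
  act_continuous : forall g, continuous (act g);
  ambit_compact : compact [set: space];
  ambit_hausdorff : hausdorff_space space;
  orbit_dense : dense [set act g base | g in [set: G]] }.

Arguments act {G} X g x : rename.
Arguments base {G} X : rename.

Definition ambit_morphism (G : groupType) (Z X : ambit G) (phi : Z -> X) :
    Prop :=
  [/\ continuous phi, forall g z, phi (act Z g z) = act X g (phi z)
    & phi (base Z) = base X].

(* Nets: I is directed by le, and f : I -> T converges to x along le when     *)
(* f @ tails le --> x.                                                        *)
Definition directed (I : Type) (le : I -> I -> Prop) : Prop :=
  [/\ inhabited I, forall i, le i i,
      forall i j k, le i j -> le j k -> le i k
    & forall i j, exists2 k, le i k & le j k].

Definition tails (I : Type) (le : I -> I -> Prop) : set_system I :=
  [set A | exists i, forall j, le i j -> A j].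

(* The group law L on X/E is an argument of the three notions below, so that  *)
(* all clauses (and later the domination) refer to one and the same law.      *)
Section GroupLike.
Variables (G : groupType) (X : ambit G) (E : equiv_rel X).

Definition group_like_with (L : group_law (quot E)) : Prop :=
  [/\ forall g x y, E x y -> E (act X g x) (act X g y),
      topological_group L
    & forall g x, gmul L (class_of E (act X g (base X))) (class_of E x) =
                  class_of E (act X g x)].

Definition properly_group_like_with (L : group_law (quot E))
    (Gt : groupType) (pi : Gt -> X) : Prop :=
  [/\ group_like_with L,
      forall x, exists a, pi a = x,
      forall a b, class_of E (pi (a * b)%g) =
                  gmul L (class_of E (pi a)) (class_of E (pi b)),
      forall (I : Type) (le : I -> I -> Prop) (g : I -> G) (p : I -> X)
             (x1 x2 x3 : X),
        directed le ->
        (fun i => act X (g i) (base X)) @ tails le --> x1 ->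
        p @ tails le --> x2 ->
        (fun i => act X (g i) (p i)) @ tails le --> x3 ->
        exists a b, [/\ pi a = x1, pi b = x2 & pi (a * b)%g = x3]
    & closed [set x | exists a b, pi a = pi b /\ x = pi (a^-1 * b)%g] ].

Definition uniformly_properly_group_like_with (L : group_law (quot E)) : Prop :=
  exists (Gt : groupType) (pi : Gt -> X) (EE : set (set (X * X))),
  [/\ properly_group_like_with L pi,
      graph E = \bigcup_(D in EE) D,
      forall D, EE D -> [/\ closed D, forall x y, D (x, y) -> D (y, x)
                          & forall x, D (x, x)]
    & forall D, EE D -> exists D', [/\ EE D',
        (D \; D)%relation `<=` D'
      & forall a, D (base X, pi a) -> forall b, D' (pi b, pi (a * b)%g)]].

End GroupLike.

Definition dominates (G : groupType) (Z : ambit G) (F : equiv_rel Z)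
    (L : group_law (quot F)) (X : ambit G) (E : equiv_rel X) : Prop :=
  exists phi : Z -> X,
  [/\ ambit_morphism phi,
      forall z1 z2, F z1 z2 -> E (phi z1) (phi z2)
    & exists2 phib : quot F -> quot E,
        forall z, phib (class_of F z) = class_of E (phi z)
      & exists2 a : quot F -> quot E -> quot E,
          @left_action (law_group L) _ a
        & forall q r, phib (gmul L q r) = a q (phib r)].

Definition weakly_uniformly_properly_group_like (G : groupType) (X : ambit G)
    (E : equiv_rel X) : Prop :=
  exists (Z : ambit G) (F : equiv_rel Z) (L : group_law (quot F)),
    uniformly_properly_group_like_with L /\ dominates L E.

Definition exactly_one_of3 (P Q S : Prop) : Prop :=
  (P \/ Q \/ S) /\ [/\ ~ (P /\ Q), ~ (P /\ S) & ~ (Q /\ S)].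

(* Main.v *)
(* Let a properly group-like F on Z dominate E. By condition (ii), the class of the
   value at the base point is multiplicative on the Ellis semigroup of Z; dividing a group u M
   of a minimal ideal M by the relation "not tau-separated" yields a compact
   Hausdorff group K with a quotient homomorphism onto Z/F. As Z/F acts on X/E,
   this presents X/E as a coset space K/S, where a compact space mapping onto K
   transports closed and analytic sets from X to K.
   The trichotomy is Baire category in K: E is closed iff S is, an analytic S is
   meager or open (Nikodym, Pettis), a meager S has continuum many cosets
   (Mycielski), and if E is smooth then S separates its cosets by countably many
   analytic-coanalytic sets, so by the topological 0-1 law S is closed.
   For the Polish group, let C be the closure of S. Then K/C is a compact
   metrizable coset space of K1 = K / core(C), while the fibre C/S is
   indiscrete with at most continuum many points. So X/E is also the coset space
   of K1 * T by C/core(C) * D, with D a dense subgroup of index |C/S| in a compact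
   metrizable group T. *)

Require Import Defs.
From HB Require Import structures.
From mathcomp Require Import all_boot all_order all_algebra.
From mathcomp Require Import all_classical all_reals all_analysis.

Set Implicit Arguments.
Unset Strict Implicit.
Unset Printing Implicit Defensive.

Import Order.TTheory GRing.Theory Num.Theory numFieldNormedType.Exports.

Local Open Scope classical_set_scope.
Local Open Scope quotient_scope.

(** * Compact spaces *)

(** Composition in the Ellis semigroup is continuous in its left factor, but in its right factor
    only if the left one is continuous, as for elements of [G]. Products are therefore replaced by
    closed relations generated by [G] ([circ], [Tr], [mulgraph]), and limit arguments carry a closed
    condition from generators to their closure by [closure_subr]. The ambit [Z], and with it [K],
    carries no countability assumption: category is done in compact Hausdorff groups, and
    countability enters only through [X]. Hence the Polish group cannot simply be [K]. A
    homeomorphism only has to match closed sets, and those of K/S are unions of fibres over K/C, so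
    the fibre C/S contributes nothing but its cardinality. As this need not be known to be finite,
    countable or the continuum, a dense subgroup of arbitrary prescribed index is built; for an
    infinite index this rests on the fact that an infinite set has the cardinality of its square. *)

Lemma closure_subr (S T : topologicalType) (f : S -> T) (A : set S)
    (C : set T) :
  continuous f -> closed C -> (forall x, A x -> C (f x)) ->
  forall x, closure A x -> C (f x).
Proof.
move=> fc Ccl AC x clx; apply: Ccl => B /fc fB.
by have [y [Ay By]] := clx _ fB; exists (f y); split=> //; exact: AC.
Qed.

(** The tube lemma: it removes an existential quantifier over a compact set from a closed
    condition. *)
Lemma closed_proj (U V : topologicalType) (K : set V) (C : set (U * V)) :
  compact K -> closed C -> closed [set u | exists2 v, K v & C (u, v)].
Proof.
move=> Kc Ccl u clu; apply: contrapT => nu.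
have H v : K v -> \forall v' \near v & u' \near nbhs u, ~ C (u', v').
  move=> Kv; have nC : ~ C (u, v) by move=> Cuv; apply: nu; exists v.
  have : nbhs (u, v) (~` C) by apply: open_nbhs_nbhs; split=> //; exact: closed_openC.
  move=> [[P Q] [/= Pu Qv] PQ]; exists (Q, P) => //= -[a b] [/= Qa Pb].
  by apply: (PQ (b, a)).
move/compact_near_coveringP: Kc => /(_ _ (nbhs u) (fun u' v' => ~ C (u', v'))).
by move=> /(_ _ H) N; have [u' [[v Kv Cuv] /(_ v Kv)]] := clu _ N.
Qed.

Lemma closed_preim (S T : topologicalType) (f : S -> T) (C : set T) :
  continuous f -> closed C -> closed (f @^-1` C).
Proof. by move=> fc; apply: preimage_closed => // x _; exact: fc. Qed.

Lemma continuous_pair (S T U : topologicalType) (f : S -> T) (g : S -> U) :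
  continuous f -> continuous g -> continuous (fun x => (f x, g x)).
Proof. by move=> fc gc x; apply: cvg_pair; [exact: fc|exact: gc]. Qed.

Lemma continuous_fst (S T : topologicalType) : continuous (@fst S T).
Proof. by move=> x; exact: cvg_fst. Qed.

Lemma continuous_snd (S T : topologicalType) : continuous (@snd S T).
Proof. by move=> x; exact: cvg_snd. Qed.

Lemma continuousC (S T U : topologicalType) (g : T -> U) (f : S -> T) :
  continuous f -> continuous g -> continuous (fun x => g (f x)).
Proof. by move=> fc gc x; apply: continuous_comp; [exact: fc|exact: gc]. Qed.

Lemma continuous_id (S : topologicalType) : continuous (fun x : S => x).
Proof. by move=> x; exact: cvg_id. Qed.

Lemma continuous_const (S T : topologicalType) (c : T) :
  continuous (fun _ : S => c).
Proof. by move=> x; exact: cvg_cst. Qed.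

Lemma compact_img (S T : topologicalType) (f : S -> T) (A : set S) :
  continuous f -> compact A -> compact (f @` A).
Proof. by move=> fc; apply: continuous_compact; exact: continuous_subspaceT. Qed.

Lemma closed_img (S T : topologicalType) (f : S -> T) (A : set S) :
  continuous f -> compact [set: S] -> hausdorff_space T -> closed A ->
  closed (f @` A).
Proof.
move=> fc Sc Th Acl; apply: compact_closed => //; apply: compact_img => //.
exact: subclosed_compact Sc _.
Qed.

(** The preimage of a closed set is the projection of a closed part of the graph along the compact
    [K]. *)
Lemma closed_graph (S K : topologicalType) (f : S -> K) :
  compact [set: K] -> closed [set p : S * K | p.2 = f p.1] -> continuous f.
Proof.
move=> Kc gr; apply/continuous_closedP => C Ccl.
have := closed_proj Kc (closedI gr (closed_preim (@continuous_snd S K) Ccl)).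
rewrite (_ : [set u | _] = f @^-1` C) //.
apply/seteqP; split=> [x [v _ [/= -> ]]//|x Cx]; exists (f x) => //.
Qed.

Lemma closed_diag (T : topologicalType) :
  hausdorff_space T -> closed [set p : T * T | p.1 = p.2].
Proof.
move=> Th p clp; apply: Th => A B /= A1 B2.
have [|[a b] [/= ab [Aa Bb]]] := clp (A `*` B); first by exists (A, B).
by exists a; split=> //; rewrite ab.
Qed.

Section Ptws.
Variables (I : choiceType) (V : topologicalType).

Lemma ptws_eval (i : I) : continuous (fun f : {ptws I -> V} => f i).
Proof. exact: (@proj_continuous I (fun=> V) i). Qed.

Lemma ptws_continuous (S : topologicalType) (f : S -> {ptws I -> V}) :
  (forall i, continuous (fun s => f s i)) -> continuous f.
Proof.
move=> fc s; apply/cvg_sup => i U [W [[N oN <-] /= Nfs NW]].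
exact: (filterS NW (fc i s N (open_nbhs_nbhs (conj oN Nfs)))).
Qed.

Lemma ptws_compact : compact [set: V] -> compact [set: {ptws I -> V}].
Proof.
move=> Vc; have := @tychonoff I (fun=> V) (fun=> setT) (fun=> Vc).
by rewrite (_ : [set f | _] = setT) //; apply/seteqP.
Qed.

Lemma ptws_hausdorff : hausdorff_space V -> hausdorff_space {ptws I -> V}.
Proof. by move=> Vh; exact: (@hausdorff_product I (fun=> V) (fun=> Vh)). Qed.

End Ptws.

(** Zorn's lemma for closed sets: by compactness a chain of nonempty closed sets has a common point.
    [P] is a stability property, being a subsemigroup or being invariant in the uses below. *)
Lemma minimal_closed (T : topologicalType) (P : set T -> Prop) (A0 : set T) :
  compact [set: T] -> closed A0 -> A0 !=set0 -> P A0 ->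
  (forall F : set (set T), F !=set0 -> (forall A, F A -> P A) ->
     P (\bigcap_(A in F) A)) ->
  exists A, [/\ closed A, A !=set0, P A, A `<=` A0 &
    forall B, closed B -> B !=set0 -> P B -> B `<=` A -> B = A].
Proof.
move=> Tc cA0 nA0 PA0 Pcap.
pose good (A : set T) := [/\ closed A, A !=set0, P A & A `<=` A0].
have chain F : (forall C, F C -> C = set0 \/ good (~` C)) ->
    total_on F subset -> \bigcup_(X in F) X = set0 \/ good (~` (\bigcup_(X in F) X)).
  move=> FP Ftot.
  have [[C0 [FC0 nC0]]|nF] := pselect (exists C, F C /\ C != set0); last first.
    left; apply/seteqP; split=> // x [C FC Cx]; apply: nF.
    by exists C; split=> //; apply/set0P; exists x.
  right; pose F' := [set ~` C | C in F `&` [set C | C != set0]].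
  have gF' A : F' A -> good A.
    by move=> [C [FC nC]] <-; have [C0'|//] := FP _ FC; move: nC => /=; rewrite C0' eqxx.
  have -> : ~` (\bigcup_(X in F) X) = \bigcap_(A in F') A.
    apply/seteqP; split=> x /=.
      by move=> nx _ [C [FC _] <-] Cx; apply: nx; exists C.
    move=> capx [C FC Cx]; apply: (capx (~` C)) => //; exists C => //; split=> //.
    by apply/set0P; exists x.
  have F'0 : F' (~` C0) by exists C0.
  split.
  - by apply: closed_bigI => A /gF' [].
  - have pF : ProperFilter (filter_from F' id).
      apply: filter_from_proper; last by move=> A /gF' [].
      apply: filter_from_filter; first by exists (~` C0).
      move=> _ _ [C [FC nC] <-] [D [FD nD] <-].
      have [CD|DC] := Ftot _ _ FC FD.
        by exists (~` D); [exists D|move=> x nDx; split=> // /CD].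
      by exists (~` C); [exists C|move=> x nCx; split=> // /DC].
    have [x [_ clx]] := Tc _ pF filterT.
    exists x => A FA; have [cA _ _ _] := gF' _ FA; apply: cA => B nB.
    by apply: clx => //; exists A.
  - by apply: Pcap; [exists (~` C0)|move=> A /gF' []].
  - by move=> x /(_ _ F'0); have [_ _ _] := gF' _ F'0; exact.
have [C [gC maxC]] := Zorn_bigcup chain.
have gA : good (~` C).
  case: gC => // C0; have [A0T|nA0T] := pselect (A0 = setT).
    by rewrite C0 setC0 -A0T; split.
  exfalso; apply: (maxC (~` A0)); last by right; rewrite setCK; split.
  rewrite C0; split=> [x []|sub]; apply: nA0T; apply/seteqP; split=> // x _.
  by apply: contrapT => /sub.
exists (~` C); case: (gA) => cC nC PC CA0; split=> // B cB nB PB BC.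
apply: contrapT => nBC; apply: (maxC (~` B)); last first.
  by right; rewrite setCK; split=> //; apply: subset_trans CA0.
split; first by move=> x Cx /BC.
move=> BC'; apply: nBC; apply/seteqP; split=> // x nCx.
by apply: contrapT => /BC'.
Qed.

Lemma cluster_continuous (S T : topologicalType) (f : S -> T) (p q : S) :
  continuous f -> cluster (nbhs p) q -> cluster (nbhs (f p)) (f q).
Proof.
move=> fc pq A B /fc nA /fc nB; have [x [Ax Bx]] := pq _ _ nA nB.
by exists (f x).
Qed.

Lemma hausdorff_inj (S T : topologicalType) (f : S -> T) :
  continuous f -> injective f -> hausdorff_space T -> hausdorff_space S.
Proof. by move=> fc fi Th p q /(cluster_continuous fc) /Th /fi. Qed.

Lemma hausdorff_prod (S T : topologicalType) :
  hausdorff_space S -> hausdorff_space T -> hausdorff_space (S * T)%type.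
Proof.
move=> Sh Th [a b] [c d] pq; congr (_, _).
  exact/Sh/(cluster_continuous (@continuous_fst S T) pq).
exact/Th/(cluster_continuous (@continuous_snd S T) pq).
Qed.

Section Subtype.
Variables (T : topologicalType) (A : set T).

Lemma subtype_val_continuous : continuous (fun y : (A : Type) => val y : T).
Proof. exact: initial_continuous. Qed.

Lemma subtype_hausdorff : hausdorff_space T -> hausdorff_space (A : Type).
Proof. exact: hausdorff_inj subtype_val_continuous val_inj. Qed.

Lemma subtype_compact : compact A -> compact [set: (A : Type)].
Proof.
move=> Ac F PF _; pose v (y : (A : Type)) : T := val y.
have FA : (v @ F) A.
  have FT : F setT by exact: filterT.
  by apply: (@filterS _ F _ setT) => // -[y Ay] _; exact: set_mem Ay.
have [x [Ax clx]] := Ac _ (fmap_proper_filter v PF) FA.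
exists (exist _ x (mem_set Ax)); split=> // P N FP.
move=> [W [[V oV <-] /= Vx VW]].
have [||t [[y Py <-] Vy]] := clx (v @` P) V.
- by apply: (@filterS _ F _ P) => // y Py; exists y.
- exact: open_nbhs_nbhs.
- by exists y; split=> //; exact: VW.
Qed.

End Subtype.

(** * Group laws *)

Section Law.
Variables (T : choiceType) (one : T) (inv : T -> T) (mul : T -> T -> T).
Hypotheses (mulA : associative mul) (mul1 : left_id one mul)
  (mulV : left_inverse one inv mul).

Lemma law_invr : right_inverse one inv mul.
Proof.
by move=> x; rewrite -[LHS]mul1 -{1}(mulV (inv x)) -mulA (mulA (inv x)) mulV mul1 mulV.
Qed.

Lemma law_idr : right_id one mul.
Proof. by move=> x; rewrite -(mulV x) mulA law_invr mul1. Qed.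

Definition mk_law : group_law T :=
  @monoid.isGroup.Axioms_ T _ _ one inv mul mulA mul1 law_idr mulV law_invr.

End Law.

Definition gone (T : choiceType) (L : group_law T) : T := (1 : law_group L)%g.

Section LawTheory.
Variables (T : choiceType) (L : group_law T).
Implicit Types x y z : T.

Lemma gmulA x y z : gmul L x (gmul L y z) = gmul L (gmul L x y) z.
Proof. exact: (@mulgA (law_group L)). Qed.

Lemma gmul1l x : gmul L (gone L) x = x.
Proof. exact: (@mul1g (law_group L)). Qed.

Lemma gmul1r x : gmul L x (gone L) = x.
Proof. exact: (@mulg1 (law_group L)). Qed.

Lemma gmulVl x : gmul L (ginv L x) x = gone L.
Proof. exact: (@mulVg (law_group L)). Qed.

Lemma gmulVr x : gmul L x (ginv L x) = gone L.
Proof. exact: (@mulgV (law_group L)). Qed.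

Lemma ginvM x y : ginv L (gmul L x y) = gmul L (ginv L y) (ginv L x).
Proof. exact: (@invgM (law_group L)). Qed.

Lemma ginvK x : ginv L (ginv L x) = x.
Proof. exact: (@invgK (law_group L)). Qed.

Lemma ginv1 : ginv L (gone L) = gone L.
Proof. exact: (@invg1 (law_group L)). Qed.

Lemma gmulKV x y : gmul L (ginv L x) (gmul L x y) = y.
Proof. by rewrite gmulA gmulVl gmul1l. Qed.

Lemma gmulVK x y : gmul L x (gmul L (ginv L x) y) = y.
Proof. by rewrite gmulA gmulVr gmul1l. Qed.

Lemma gidem x : gmul L x x = x -> x = gone L.
Proof. by move=> xx; rewrite -(gmulKV x x) xx gmulVl. Qed.

End LawTheory.

Section Quot.
Variables (T : topologicalType) (E : equiv_rel T).

Lemma classP x y : class_of E x = class_of E y <-> E x y.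
Proof.
split=> [|Exy].
  by move/(@eqquotP T E {eq_quot E}).
by apply/(@eqquotP T E {eq_quot E}).
Qed.

Lemma class_surj (q : quot E) : exists x, class_of E x = q.
Proof. by exists (repr q); exact: reprK. Qed.

Lemma class_continuous : continuous (class_of E).
Proof. exact: pi_continuous. Qed.

Lemma quot_openP (A : set (quot E)) : open A <-> open (class_of E @^-1` A).
Proof. by []. Qed.

Lemma quot_closedP (A : set (quot E)) : closed A <-> closed (class_of E @^-1` A).
Proof.
split=> [cA|cA].
  by apply: preimage_closed => // x _; exact: class_continuous.
by rewrite -[A]setCK; apply: open_closedC; apply/quot_openP; exact: closed_openC.
Qed.

Lemma quot_compact : compact [set: T] -> compact [set: quot E].
Proof.
move=> Tc; rewrite (_ : [set: quot E] = class_of E @` setT).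
  apply: continuous_compact => //; apply: continuous_subspaceT.
  exact: class_continuous.
by apply/seteqP; split=> // q _; have [x <-] := class_surj q; exists x.
Qed.

End Quot.

(** * The Ellis semigroup *)

Section ProperlyGroupLike.
Variables (G : groupType) (Z : ambit G) (F : equiv_rel Z)
  (L : group_law (quot F)) (Gt : groupType) (pi : Gt -> Z).
Hypothesis prop : properly_group_like_with L pi.

(** Condition (ii) with a closure in place of nets, the form in which it combines with closed
    relations. *)
Lemma class_mul_limit (x1 x2 x3 : Z) :
  closure [set t | exists g p, t = (act Z g (base Z), (p, act Z g p))]
    (x1, (x2, x3)) ->
  class_of F x3 = gmul L (class_of F x1) (class_of F x2).
Proof.
move=> cl; case: prop => _ _ hom lim _.
(* The canonical net of a point in a closure: a neighbourhood together with a generator lying in it,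
   ordered by reverse inclusion of the neighbourhoods. *)
pose I := {t : set (Z * (Z * Z)) * (G * Z) | nbhs (x1, (x2, x3)) t.1 /\
  t.1 (act Z t.2.1 (base Z), (t.2.2, act Z t.2.1 t.2.2))}.
pose le (i j : I) := (sval j).1 `<=` (sval i).1.
have ex N : nbhs (x1, (x2, x3)) N -> exists i : I, (sval i).1 = N.
  move=> nN; have [t [[g [p ->]] Nt]] := cl _ nN.
  by have H : nbhs (x1, (x2, x3)) (N, (g, p)).1 /\ N (act Z g (base Z), (p, act Z g p)) ;
    [split|exists (exist _ (N, (g, p)) H)].
have dir : directed le.
  split.
  - by have [i _] := ex _ filterT; constructor.
  - by move=> i.
  - by move=> i j k ij jk; apply: subset_trans jk ij.
  - move=> i j; have [k kE] := ex _ (filterI (svalP i).1 (svalP j).1).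
    by exists k; rewrite /le kE; [move=> t []|move=> t []].
have tl N : nbhs (x1, (x2, x3)) N -> \forall i \near tails le,
    N (act Z (sval i).2.1 (base Z), ((sval i).2.2, act Z (sval i).2.1 (sval i).2.2)).
  move=> nN; have [i iE] := ex _ nN; exists i => j ij; rewrite -iE.
  by apply: ij; have [] := svalP j.
have [|||a [b [<- <- <-]]] := lim I le (fun i => (sval i).2.1)
    (fun i => (sval i).2.2) x1 x2 x3 dir; last by rewrite hom.
- move=> N nN; apply: (tl (fst @^-1` N)).
  exact: (@continuous_fst _ _ (x1, (x2, x3)) N nN).
- move=> N nN; apply: (tl ((fun t => t.2.1) @^-1` N)).
  have c1 := continuousC (@continuous_snd Z (Z * Z)%type) (@continuous_fst Z Z).
  exact: (c1 (x1, (x2, x3)) N nN).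
- move=> N nN; apply: (tl ((fun t => t.2.2) @^-1` N)).
  have c2 := continuousC (@continuous_snd Z (Z * Z)%type) (@continuous_snd Z Z).
  exact: (c2 (x1, (x2, x3)) N nN).
Qed.

End ProperlyGroupLike.

Section Ellis.
Variables (G : groupType) (Z : ambit G).

Definition maps : topologicalType := {ptws Z -> Z}.

Implicit Types (f h p q : maps) (A B : set maps).

Definition mcomp f h : maps := fun z => f (h z).

Definition gmap (g : G) : maps := act Z g.

Lemma mcompA f h k : mcomp f (mcomp h k) = mcomp (mcomp f h) k.
Proof. by []. Qed.

Lemma mcomp_contl h : continuous (fun f => mcomp f h).
Proof. by apply: ptws_continuous => z; exact: ptws_eval. Qed.

Lemma mcomp_contr g : continuous (fun f => mcomp (gmap g) f).
Proof.
apply: ptws_continuous => z.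
have c1 : continuous (fun f : maps => f z) := @ptws_eval Z Z z.
exact: (continuousC c1 (@act_continuous _ Z g)).
Qed.

Lemma gmapM g g' : gmap (g * g')%g = mcomp (gmap g) (gmap g').
Proof. by apply/funext => z; exact: actM. Qed.

Lemma maps_compact : compact [set: maps].
Proof. by apply: ptws_compact; exact: ambit_compact. Qed.

Lemma maps_hausdorff : hausdorff_space maps.
Proof. by apply: ptws_hausdorff; exact: ambit_hausdorff. Qed.

Definition ellis : set maps := closure (range gmap).

Lemma closed_ellis : closed ellis. Proof. exact: closed_closure. Qed.

Lemma gmap_ellis g : ellis (gmap g).
Proof. by apply: subset_closure; exists g. Qed.

Lemma ellis_ind (S : topologicalType) (c : maps -> S) (C : set S) :
  continuous c -> closed C -> (forall g, C (c (gmap g))) ->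
  forall p, ellis p -> C (c p).
Proof. by move=> cc Cc CG p; apply: (closure_subr cc Cc) => _ [g _ <-]. Qed.

(** Two limits in turn: the right factor moves while the left one is in [G], then the left factor
    moves. *)
Lemma ellisM f h : ellis f -> ellis h -> ellis (mcomp f h).
Proof.
move=> ef eh; apply: (ellis_ind (c := fun f => mcomp f h)) ef.
- exact: mcomp_contl.
- exact: closed_ellis.
- move=> g; apply: (closure_subr (@mcomp_contr g) closed_ellis) eh.
  by move=> _ [g' _ <-]; rewrite -gmapM; exact: gmap_ellis.
Qed.

(** Evaluation at the base point maps the compact Ellis semigroup onto a closed set containing the
    dense orbit. *)
Lemma ellis_base z : exists2 p, ellis p & p (base Z) = z.
Proof.
have cl : closed ((fun f : maps => f (base Z)) @` ellis).
  apply: closed_img; first exact: ptws_eval.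
  - exact: maps_compact.
  - exact: ambit_hausdorff.
  - exact: closed_ellis.
suff : ((fun f : maps => f (base Z)) @` ellis) z by move=> [p ep <-]; exists p.
apply: cl => B /nbhs_interior nB.
have [] := @orbit_dense _ Z (interior B).
- by exists z; exact: nbhs_singleton.
- exact: open_interior.
- move=> y [/interior_subset By [g _ yE]]; exists y; split=> //.
  by exists (gmap g) => //; exact: gmap_ellis.
Qed.

(** The Ellis-Numakura lemma. For [u] in a minimal closed subsemigroup [B], the products [f ** u]
    with [f] in [B], and then the [f] in [B] with [f ** u = u], form closed subsemigroups; both are
    therefore all of [B]. *)
Lemma ellis_idempotent A : closed A -> A !=set0 ->
  (forall f h, A f -> A h -> A (mcomp f h)) ->
  exists2 u, A u & mcomp u u = u.
Proof.
move=> cA nA AM.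
have [B [cB [u Bu] BM BA minB]] := @minimal_closed _
  (fun B => forall f h, B f -> B h -> B (mcomp f h)) A maps_compact cA nA AM
  (fun F _ FP => fun f h fF hF C FC => FP C FC f h (fF C FC) (hF C FC)).
have E1 : (fun f => mcomp f u) @` B = B.
  apply: minB.
  - apply: closed_img => //; [exact: mcomp_contl|exact: maps_compact|exact: maps_hausdorff].
  - by exists (mcomp u u); exists u.
  - move=> _ _ [f Bf <-] [h Bh <-]; exists (mcomp (mcomp f u) h) => //.
    by apply: (BM); first exact: BM.
  - by move=> _ [f Bf <-]; exact: BM.
have E2 : B `&` [set f | mcomp f u = u] = B.
  apply: minB.
  - apply: closedI => //.
    exact: (closed_preim (@mcomp_contl u)
      (compact_closed maps_hausdorff (@compact_set1 _ u))).
  - have : ((fun f => mcomp f u) @` B) u by rewrite E1.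
    by move=> [f Bf fu]; exists f.
  - move=> f h [Bf fu] [Bh hu]; split; first exact: BM.
    by rewrite /= -mcompA hu.
  - by move=> f [].
exists u; first exact: BA.
have : (B `&` [set f | mcomp f u = u]) u by rewrite E2.
by case.
Qed.

End Ellis.

Arguments gmap {G} Z g.
Arguments ellis {G} Z.

Section EllisContinuity.
Variables (G : groupType) (Z : ambit G).

Lemma continuous_mcompl (S : topologicalType) (h : maps Z) (c : S -> maps Z) :
  continuous c -> continuous (fun s => mcomp (c s) h).
Proof. by move=> cc; exact: (continuousC cc (@mcomp_contl _ _ h)). Qed.

Lemma continuous_mcompr (S : topologicalType) (g : G) (c : S -> maps Z) :
  continuous c -> continuous (fun s => mcomp (gmap Z g) (c s)).
Proof. by move=> cc; exact: (continuousC cc (@mcomp_contr _ _ g)). Qed.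

Lemma continuous_fstC (S T U : topologicalType) (c : S -> T * U) :
  continuous c -> continuous (fun s => (c s).1).
Proof. by move=> cc; exact: (continuousC cc (@continuous_fst T U)). Qed.

Lemma continuous_sndC (S T U : topologicalType) (c : S -> T * U) :
  continuous c -> continuous (fun s => (c s).2).
Proof. by move=> cc; exact: (continuousC cc (@continuous_snd T U)). Qed.

Lemma continuous_evalC (S : topologicalType) (z : Z) (c : S -> maps Z) :
  continuous c -> continuous (fun s => c s z).
Proof. by move=> cc; exact: (continuousC cc (@ptws_eval _ _ z)). Qed.

End EllisContinuity.

Ltac ctn := repeat
  match goal with
  | |- continuous (@fst _ _) => exact: continuous_fst
  | |- continuous (@snd _ _) => exact: continuous_snd
  | |- continuous (mcomp (gmap _ _)) => exact: mcomp_contr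
  | |- continuous (fun x => x) => exact: continuous_id
  | |- continuous (fun _ => ?c) => exact: continuous_const
  | |- continuous (fun x => (_, _)) => apply: continuous_pair
  | |- continuous (fun x => fst _) => apply: continuous_fstC
  | |- continuous (fun x => snd _) => apply: continuous_sndC
  | |- continuous (fun x => mcomp (gmap _ _) _) => apply: continuous_mcompr
  | |- continuous (fun x => mcomp _ _) => apply: continuous_mcompl
  | |- continuous (fun x => ?f x) => apply: continuous_evalC
  end.

(** * Minimal left ideals and their groups *)

Section MinimalIdeal.
Variables (G : groupType) (Z : ambit G).
Local Notation T := (maps Z).
Local Notation gm := (gmap Z).
Local Infix "**" := (@mcomp G Z) (at level 40, left associativity).

(** Invariance is asked under [G] only: since [M] is closed, it then absorbs the Ellis semigroup on
    the left ([mi_mul]), so [M] is a left ideal. *)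
Record minimal_ideal (M : set T) : Prop := MinimalIdeal {
  mi_closed : closed M;
  mi_ellis : M `<=` ellis Z;
  mi_nonempty : M !=set0;
  mi_act : forall g m, M m -> M (gm g ** m);
  mi_min : forall B, closed B -> B !=set0 ->
    (forall g m, B m -> B (gm g ** m)) -> B `<=` M -> B = M }.

Lemma minimal_ideal_exists : exists M, minimal_ideal M.
Proof.
have [M [cM nM GM ME minM]] := @minimal_closed _
  (fun B => forall g m, B m -> B (gm g ** m)) (ellis Z) (@maps_compact _ Z)
  (@closed_ellis _ Z) (ex_intro _ (gm 1%g) (@gmap_ellis _ Z 1%g))
  (fun g m em => ellisM (@gmap_ellis _ Z g) em)
  (fun F _ FP => fun g m mF C FC => FP C FC g m (mF C FC)).
by exists M; split.
Qed.

Variable M : set T.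
Hypothesis miM : minimal_ideal M.

Lemma mi_mul p m : ellis Z p -> M m -> M (p ** m).
Proof.
move=> ep Mm; apply: (ellis_ind (c := fun p => p ** m)) ep.
- by ctn.
- exact: mi_closed.
- by move=> g; exact: mi_act.
Qed.

Lemma mi_mulM m m' : M m -> M m' -> M (m ** m').
Proof. by move=> /(mi_ellis miM); exact: mi_mul. Qed.

Lemma mi_compact : compact M.
Proof. exact: subclosed_compact (mi_closed miM) (@maps_compact _ Z) _. Qed.

(** The set of all [f ** m] with [f] in [M] is closed, nonempty and stable under [G], so by
    minimality it is [M]. *)
Lemma mi_solve m x : M m -> M x -> exists2 f, M f & f ** m = x.
Proof.
move=> Mm Mx.
suff : ((fun f : T => f ** m) @` M) x by move=> [f]; exists f.
rewrite (mi_min miM (B := (fun f : T => f ** m) @` M)) //.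
- apply: closed_img; [by ctn|exact: maps_compact|exact: maps_hausdorff|].
  exact: mi_closed.
- by exists (m ** m); exists m.
- move=> g _ [f Mf <-]; exists (gm g ** f) => //; exact: mi_act.
- by move=> _ [f Mf <-]; exact: mi_mulM.
Qed.

Lemma mi_idempotent : exists2 u, M u & u ** u = u.
Proof. by apply: ellis_idempotent; [exact: mi_closed|exact: mi_nonempty|exact: mi_mulM]. Qed.

Variable u : T.
Hypotheses (Mu : M u) (uu : u ** u = u).

Lemma mi_mulu m : M m -> m ** u = m.
Proof. by move=> Mm; have [f Mf <-] := mi_solve Mu Mm; rewrite -mcompA uu. Qed.

Definition ideal_group : set T := [set x | M x /\ u ** x = x].
Local Notation J := ideal_group.

Lemma Ju : J u. Proof. by split. Qed.

Lemma JM x : J x -> M x. Proof. by case. Qed.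

Lemma Jl x : J x -> u ** x = x. Proof. by case. Qed.

Lemma Jr x : J x -> x ** u = x. Proof. by move=> [Mx _]; exact: mi_mulu. Qed.

Lemma J_proj m : M m -> J (u ** m).
Proof. by move=> Mm; split; [exact: mi_mulM|rewrite mcompA uu]. Qed.

Lemma Jmul x y : J x -> J y -> J (x ** y).
Proof. by move=> [Mx ux] [My uy]; split; [exact: mi_mulM|rewrite mcompA ux]. Qed.

Lemma J_linv x : J x -> exists2 y, J y & y ** x = u.
Proof.
move=> Jx; have [f Mf fx] := mi_solve (JM Jx) Mu.
by exists (u ** f); [exact: J_proj|rewrite -mcompA fx].
Qed.

Lemma J_inv x : J x -> exists y, [/\ J y, y ** x = u & x ** y = u].
Proof.
move=> Jx; have [y Jy yx] := J_linv Jx; have [z Jz zy] := J_linv Jy.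
exists y; split=> //; rewrite -(Jl (Jmul Jx Jy)) -[in LHS]zy.
by rewrite -(mcompA z y) (mcompA y x) yx (Jl Jy).
Qed.

(** * The tau-topology *)

(** The circle operation of topological dynamics: the limits of [g_i a_i] with [g_i] in [G] tending
    to [p] and [a_i] in [A]. *)
Definition circ (p : T) (A : set T) : set T :=
  [set z | closure [set t | exists g a, A a /\ t = (gm g, gm g ** a)] (p, z)].

Lemma circS p A B : A `<=` B -> circ p A `<=` circ p B.
Proof.
move=> AB z; apply: closureS => t [g [a [Aa ->]]].
by exists g, a; split=> //; exact: AB.
Qed.

Lemma circ_mul p a A : ellis Z p -> A a -> circ p A (p ** a).
Proof.
move=> ep Aa; apply: (ellis_ind (c := fun p => (p, p ** a))) ep.
- by ctn.
- exact: closed_closure.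
- by move=> g; apply: subset_closure; exists g, a.
Qed.

(** The two limits are taken one after the other, elements of [G] acting continuously on the left.
    With [u ** u = u] this makes [tclosure] idempotent. *)
Lemma circ_circ p q A : circ p (circ q A) `<=` circ (p ** q) A.
Proof.
move=> z; apply: (@closure_subr _ _ (fun t : T * T => (t.1 ** q, t.2)) _ (closure _) _ _ _ (p, z)).
- by ctn.
- exact: closed_closure.
- move=> _ [g [b [qb ->]]] /=.
  apply: (@closure_subr _ _ (fun t : T * T => (gm g ** t.1, gm g ** t.2)) _ (closure _) _ _ _ (q, b)) qb.
  + by ctn.
  + exact: closed_closure.
  + move=> _ [g' [a [Aa ->]]]; apply: subset_closure.
    by exists (g * g')%g, a; rewrite gmapM.
Qed.

Lemma circ_mulr p A b z : circ p A z -> circ p [set a ** b | a in A] (z ** b).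
Proof.
apply: (@closure_subr _ _ (fun t : T * T => (t.1, t.2 ** b)) _ (closure _) _ _ _ (p, z)).
- by ctn.
- exact: closed_closure.
- move=> _ [g [a [Aa ->]]]; apply: subset_closure.
  by exists g, (a ** b); split=> //; exists a.
Qed.

Lemma circ_closure A : (forall a, A a -> J a) -> closure A `<=` circ u A.
Proof.
move=> AJ x; apply: (@closure_subr _ _ (fun a : T => (u, a)) _ (closure _) _ _ _ x).
- by ctn.
- exact: closed_closure.
- move=> a Aa; rewrite -(Jl (AJ _ Aa)); apply: circ_mul => //.
  exact: (mi_ellis miM Mu).
Qed.

(* The closed sets of the tau-topology on the ideal group J = u M. *)
Definition tclosed (A : set T) :=
  A `<=` J /\ forall x, J x -> circ u A x -> A x.

Definition tclosure (A : set T) : set T := circ u A `&` J.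

Lemma tclosed_tclosure A : tclosed (tclosure A).
Proof.
split=> [x []//|x Jx cx]; split=> //.
by rewrite -uu; apply: circ_circ; apply: circS cx => y [].
Qed.

Lemma sub_tclosure A : A `<=` J -> A `<=` tclosure A.
Proof.
move=> AJ x Ax; split; last exact: AJ.
by rewrite -(Jl (AJ _ Ax)); apply: circ_mul => //; exact: (mi_ellis miM Mu).
Qed.

(** A pointwise limit of elements of [A] may leave [J]; multiplication by [u] brings it back, since
    [x] is in [circ u A] and so [u ** x] is in [circ u (circ u A)]. *)
Lemma tclosed_closure A x : tclosed A -> closure A x -> A (u ** x).
Proof.
move=> [AJ tA] clx; have cx := circ_closure AJ clx.
have Mx : M x.
  have cM : closed M by exact: mi_closed.
  by apply: cM; apply: closureS clx => a /AJ /JM.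
apply: tA; first exact: J_proj.
rewrite -[X in circ X]uu; apply: circ_circ; apply: circ_mul => //; exact: (mi_ellis miM Mu).
Qed.

(** Left translations are tau-continuous because [J] is a group: with [k] the inverse of [j], the
    set lies in [circ k A], and [circ j (circ k A)] lies in [circ u A]. *)
Lemma tclosed_l A j : J j -> tclosed A -> tclosed [set x | J x /\ A (j ** x)].
Proof.
move=> Jj [AJ tA]; split=> [x []//|x Jx cx]; split=> //.
have [k [Jk kj jk]] := J_inv Jj.
have eJ y : J y -> ellis Z y by move=> /JM; exact: mi_ellis.
apply: tA; first exact: Jmul.
set B := [set x | _] in cx.
have BjB : B `<=` circ k A.
  move=> b [Jb Ajb]; rewrite -(Jl Jb) -kj -mcompA; apply: circ_mul => //.
  exact: eJ.
rewrite -jk; apply: circ_circ; apply: (@circS j _ _ BjB).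
rewrite -[X in circ X](Jr Jj); apply: circ_circ.
by apply: circ_mul => //; exact: eJ.
Qed.

Lemma tclosed_r A j : J j -> tclosed A -> tclosed [set x | J x /\ A (x ** j)].
Proof.
move=> Jj [AJ tA]; split=> [x []//|x Jx cx]; split=> //.
apply: tA; first exact: Jmul.
have := @circ_mulr _ _ j _ cx; apply: circS => _ [a [_ Aa] <-].
exact: Aa.
Qed.

(* x and y have no disjoint tau-open neighbourhoods; A and B are the complements
   of such neighbourhoods. *)
Definition sim (x y : T) := forall A B, tclosed A -> tclosed B ->
  (forall z, J z -> A z \/ B z) -> A x \/ B y.

Lemma sim_refl x : J x -> sim x x.
Proof. by move=> Jx A B _ _; exact. Qed.

Lemma sim_sym x y : sim x y -> sim y x.
Proof.
move=> xy A B tA tB AB; have [z Jz||] := xy B A tB tA; last by left.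
  by have [] := AB z Jz; [right|left].
by right.
Qed.

Lemma sim_l j x y : J j -> J x -> J y -> sim x y -> sim (j ** x) (j ** y).
Proof.
move=> Jj Jx Jy xy A B tA tB AB.
have [z Jz|[]|[]] := xy _ _ (tclosed_l Jj tA) (tclosed_l Jj tB); [|by left|by right].
by have [] := AB _ (Jmul Jj Jz); [left|right].
Qed.

Lemma sim_r j x y : J j -> J x -> J y -> sim x y -> sim (x ** j) (y ** j).
Proof.
move=> Jj Jx Jy xy A B tA tB AB.
have [z Jz|[]|[]] := xy _ _ (tclosed_r Jj tA) (tclosed_r Jj tB); [|by left|by right].
by have [] := AB _ (Jmul Jz Jj); [left|right].
Qed.

(** Failure of separation is not transitive in general; homogeneity makes it so here. With [k] the
    inverse of [y], the element [x ** k] is not separated from [u]. Right translation by [v] then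
    shows that every [v] outside [B] is sent into [A] by [x ** k], a cover to which [sim y z]
    applies. *)
Lemma sim_trans x y z : J x -> J y -> J z -> sim x y -> sim y z -> sim x z.
Proof.
move=> Jx Jy Jz xy yz A B tA tB AB.
have [k [Jk ky yk]] := J_inv Jy.
have Jh := Jmul Jx Jk.
have hu : sim (x ** k) u by rewrite -yk; apply: sim_r.
have cov v : J v -> (J v /\ A ((x ** k) ** v)) \/ B v.
  move=> Jv; have [Bv|nBv] := pselect (B v); [by right|left; split=> //].
  have [w Jw|[]//|[_]] := hu _ _ (tclosed_r Jv tA) (tclosed_r Jv tB).
    by have [] := AB _ (Jmul Jw Jv); [left|right].
  by rewrite (Jl Jv).
have [[_ Axky]|Bz] := yz _ _ (tclosed_l Jh tA) tB cov; last by right.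
by left; move: Axky; rewrite -mcompA ky (Jr Jx).
Qed.

(* Plays the role of the graph of the multiplication, which is not continuous on
   the closure of J; it becomes the graph of a continuous map modulo sim. *)
Definition Tr : set (T * (T * T)) :=
  closure [set t | exists g v, J v /\ t = (gm g, (v, gm g ** v))].

Lemma Tr_mul p y : ellis Z p -> closure J y -> Tr (p, (y, p ** y)).
Proof.
move=> ep cy; apply: (ellis_ind (c := fun p => (p, (y, p ** y)))) ep.
- by ctn.
- exact: closed_closure.
- move=> g; apply: (@closure_subr _ _ (fun y : T => (gm g, (y, gm g ** y))) _
    (closure _) _ _ _ y) cy.
  + by ctn.
  + exact: closed_closure.
  + by move=> v Jv; apply: subset_closure; exists g, v.
Qed.

Lemma Tr_l p x y z : ellis Z p -> Tr (x, (y, z)) -> Tr (p ** x, (y, p ** z)).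
Proof.
move=> ep xyz; apply: (ellis_ind (c := fun p => (p ** x, (y, p ** z)))) ep.
- by ctn.
- exact: closed_closure.
- move=> g; apply: (@closure_subr _ _ (fun t : T * (T * T) =>
    (gm g ** t.1, (t.2.1, gm g ** t.2.2))) _ (closure _) _ _ _ (x, (y, z))) xyz.
  + by ctn.
  + exact: closed_closure.
  + move=> _ [g' [v [Jv ->]]]; apply: subset_closure.
    by exists (g * g')%g, v; rewrite gmapM.
Qed.

Lemma closure_JM y : closure J y -> M y.
Proof.
by move=> cy; apply: (mi_closed miM); apply: closureS cy => x /JM.
Qed.

(** A cover of [J] by [A] and [B] splits the generators of [Tr] into two families, and the closure
    of a union is the union of the closures: the limit comes from [A], and [x] is in [A], or from
    [B], and [u ** v] is in [B]. *)
Lemma Tr_sim v x : J x -> Tr (u, (v, x)) -> sim x (u ** v).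
Proof.
move=> Jx uvx A B tA tB AB.
pose gen (C : set T) : set (T * (T * T)) :=
  [set t | exists g v, C v /\ t = (gm g, (v, gm g ** v))].
have [] : (closure (gen A) `|` closure (gen B)) (u, (v, x)).
- rewrite -closureU; move: uvx; apply: closureS => _ [g [w [Jw ->]]].
  by have [Aw|Bw] := AB w Jw; [left|right]; exists g, w.
- move=> cA; left; apply: (tA.2) => //.
  apply: (@closure_subr _ _ (fun t : T * (T * T) => (t.1, t.2.2)) _ (closure _)
    _ _ _ (u, (v, x))) cA.
  + by ctn.
  + exact: closed_closure.
  + by move=> _ [g [w [Aw ->]]]; apply: subset_closure; exists g, w.
- move=> cB; right; apply: tclosed_closure => //.
  apply: (@closure_subr _ _ (fun t : T * (T * T) => t.2.1) _ (closure _)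
    _ _ _ (u, (v, x))) cB.
  + by ctn.
  + exact: closed_closure.
  + by move=> _ [g [w [Bw ->]]]; apply: subset_closure.
Qed.

(** Translation by the inverse of [u ** x] reduces to first component [u], the case of [Tr_sim]. *)
Lemma Tr_mul_sim x y z : Tr (x, (y, z)) -> M x -> M z ->
  sim (u ** z) ((u ** x) ** (u ** y)).
Proof.
move=> xyz Mx Mz; have Jx := J_proj Mx.
have [k [Jk kx xk]] := J_inv Jx.
have ek : ellis Z k by apply: (mi_ellis miM); exact: JM.
have := Tr_l ek xyz; rewrite -[X in X ** x](Jr Jk) -mcompA kx => Tk.
have cy : closure J y.
  apply: (@closure_subr _ _ (fun t : T * (T * T) => t.2.1) _ (closure _)
    _ _ _ (x, (y, z))) xyz.
  + by ctn.
  + exact: closed_closure.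
  + by move=> _ [g [w [Bw ->]]]; apply: subset_closure.
have Jkz : J (k ** z) by rewrite -(Jl Jk) -mcompA; apply: J_proj; exact: mi_mul.
have := sim_l Jx Jkz (J_proj (closure_JM cy)) (Tr_sim Jkz Tk).
by rewrite mcompA xk.
Qed.

Lemma compact_closureJ : compact (closure J).
Proof. by apply: (subclosed_compact _ (@maps_compact _ Z)) => //; exact: closed_closure. Qed.

(** A converse of [Tr_sim]: inseparable points are limits of translates of one common [v]. *)
Lemma sim_Tr x y : J x -> J y -> sim x y ->
  exists v, [/\ closure J v, Tr (u, (v, x)) & Tr (u, (v, y))].
Proof.
move=> Jx Jy xy.
(* With [v] ranging over a compact set the condition is closed, so it suffices to meet it in every
   neighbourhood of [((u, u), (x, y))]. *)
pose W := [set w : (T * T) * (T * T) | exists2 v, closure J v &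
  [set t : ((T * T) * (T * T)) * T | Tr (t.1.1.1, (t.2, t.1.2.1)) /\
     Tr (t.1.1.2, (t.2, t.1.2.2))] (w, v)].
have cW : closed W.
  apply: closed_proj; first exact: compact_closureJ.
  apply: closedI.
    apply: (@closed_preim _ _ (fun t : ((T * T) * (T * T)) * T =>
      (t.1.1.1, (t.2, t.1.2.1))) Tr); [by ctn|exact: closed_closure].
  apply: (@closed_preim _ _ (fun t : ((T * T) * (T * T)) * T =>
    (t.1.1.2, (t.2, t.1.2.2))) Tr); [by ctn|exact: closed_closure].
suff : W ((u, u), (x, y)) by move=> [v cv [Tx Ty]]; exists v.
apply: cW => N [[P Q] /= [[[U U'] /= [nU nU'] UP] [[X Y] /= [nX nY] XQ]] PQN].
(* The points of [J] that no [g] near [u] moves near [x], respectively near [y]. If these two sets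
   covered [J], their tau-closures would separate [x] from [y]. *)
pose A := [set v | J v /\ forall g, U (gm g) -> ~ X (gm g ** v)].
pose B := [set v | J v /\ forall g, U' (gm g) -> ~ Y (gm g ** v)].
have AJ : A `<=` J by move=> v [].
have BJ : B `<=` J by move=> v [].
have [[v [Jv nv]]|cov] := pselect (exists v, J v /\ ~ (A v \/ B v)).
  have [g [Ug Xg]] : exists g, U (gm g) /\ X (gm g ** v).
    apply: contrapT => ng; apply: nv; left; split=> // g Ug Xg.
    by apply: ng; exists g.
  have [g' [Ug' Xg']] : exists g, U' (gm g) /\ Y (gm g ** v).
    apply: contrapT => ng; apply: nv; right; split=> // g' Ug' Xg'.
    by apply: ng; exists g'.
  exists ((gm g, gm g'), (gm g ** v, gm g' ** v)); split.
    exists v; first exact: subset_closure.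
    by split; apply: subset_closure; [exists g, v|exists g', v].
  by apply: PQN; split=> /=; [exact: UP|exact: XQ].
have [||z Jz|[cA _]|[cB _]] := xy (tclosure A) (tclosure B).
- exact: tclosed_tclosure.
- exact: tclosed_tclosure.
- have [Az|Bz] : A z \/ B z by apply: contrapT => nz; apply: cov; exists z.
    by left; exact: sub_tclosure.
  by right; exact: sub_tclosure.
- have [|_ [[g [a [[_ na] ->]]] [/= Ug Xga]]] := cA (U `*` X); first by exists (U, X).
  by case: (na g Ug).
- have [|_ [[g [a [[_ na] ->]]] [/= Ug Xga]]] := cB (U' `*` Y); first by exists (U', Y).
  by case: (na g Ug).
Qed.

(** Multiplication by [u] is not continuous, so [sim] is rewritten as the existence, over compact
    sets, of [v], [x'], [y'] linked by the closed relation [Tr] to each other and to the two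
    points. *)
Lemma closed_sim : closed [set p : T * T |
  [/\ closure J p.1, closure J p.2 & sim (u ** p.1) (u ** p.2)]].
Proof.
pose C := [set t : (T * T) * (T * (T * T)) |
  Tr (u, (t.2.1, t.2.2.1)) /\ Tr (u, (t.2.1, t.2.2.2)) /\
  Tr (u, (t.1.1, t.2.2.1)) /\ Tr (u, (t.1.2, t.2.2.2))].
have cC : closed C.
  have cl c : continuous c -> closed [set t | Tr (c t)].
    by move=> cc; apply: (@closed_preim _ _ c Tr) => //; exact: closed_closure.
  by apply: closedI; [|apply: closedI; [|apply: closedI]]; apply: cl; ctn.
have eu : ellis Z u by exact: (mi_ellis miM).
have -> : [set p : T * T | [/\ closure J p.1, closure J p.2 &
    sim (u ** p.1) (u ** p.2)]] =
  (closure J `*` closure J) `&`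
  [set p | exists2 w, (closure J `*` (M `*` M)) w & C (p, w)].
  apply/seteqP; split=> [[x y] /= [cx cy xy]|[x y] /= [[cx cy]]].
    split=> //; have Mx := closure_JM cx; have My := closure_JM cy.
    have [v [cv Tx Ty]] := sim_Tr (J_proj Mx) (J_proj My) xy.
    exists (v, (u ** x, u ** y)); last by split=> //; split=> //; split; exact: Tr_mul.
    by split=> //; split; exact: mi_mulM.
  move=> [[v [x' y']] /= [cv [Mx' My']] [/= T1 [T2 [T3 T4]]]]; split=> //.
  have H t z : M t -> M z -> Tr (u, (z, t)) -> sim (u ** t) (u ** z).
    move=> Mt Mz Tuz; have := Tr_mul_sim Tuz Mu Mt.
    by rewrite uu (mcompA u u) uu.
  have [Mx My Mv] : [/\ M x, M y & M v] by split; exact: closure_JM.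
  have s1 : sim (u ** x) (u ** v).
    apply: (@sim_trans _ (u ** x')); do ?exact: J_proj; last exact: H.
    by apply: sim_sym; exact: H.
  apply: (@sim_trans _ (u ** v)) => //; do ?exact: J_proj.
  apply: (@sim_trans _ (u ** y')); do ?exact: J_proj; last exact: H.
  by apply: sim_sym; exact: H.
apply: closedI.
  have cJ : closed (closure J) by exact: closed_closure.
  by apply: closedI; [apply: (@closed_preim _ _ fst)|apply: (@closed_preim _ _ snd)] => //; ctn.
apply: closed_proj => //; apply: compact_setX; first exact: compact_closureJ.
by apply: compact_setX; exact: mi_compact.
Qed.

End MinimalIdeal.

(** * The compact Hausdorff group of a minimal ideal *)

Lemma quotient_map_hausdorff (T Q : topologicalType) (g : T -> Q) :
  compact [set: T] -> hausdorff_space T -> (forall q, exists x, g x = q) ->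
  (forall C, closed (g @^-1` C) -> closed C) ->
  closed [set p : T * T | g p.1 = g p.2] -> hausdorff_space Q.
Proof.
move=> Tc Th gs gq cE a b ab.
have [x xa] := gs a; have [y yb] := gs b.
apply: contrapT => nab.
have cl z : closed [set w | g w = g z].
  by apply: (@closed_preim _ _ (fun w => (w, z)) _ _ cE); ctn.
have disj : [set w | g w = g x] `&` [set w | g w = g y] = set0.
  by apply/seteqP; split=> // w [/= wx wy]; apply: nab; rewrite -xa -yb -wx.
have [W nxW cW] := compact_normal Th Tc (cl x) (t := ~` [set w | g w = g y])
  (fun z xz => open_nbhs_nbhs (conj (closed_openC (cl y))
     (fun yz => eq_ind (_ `&` _) (fun S : set T => S z) (conj xz yz) set0 disj))).
have [U [oU xU UW]] := (set_nbhsP _ _).1 nxW.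
pose V := ~` closure W; have oV : open V by apply: closed_openC; exact: closed_closure.
have yV : [set w | g w = g y] `<=` V by move=> w wy /cW /(_ wy).
have UV : U `&` V = set0.
  by apply/seteqP; split=> // w [/UW Ww /(_ (subset_closure Ww))].
(* An open set is replaced by its largest saturated part; the saturation of its closed complement is
   closed, as a projection along a compact space. *)
have sat (N : set T) z : open N -> [set w | g w = g z] `<=` N ->
    nbhs (g z) (~` (g @` (~` N))).
  move=> oN zN; apply: open_nbhs_nbhs; split.
    apply: closed_openC; apply: gq.
    have -> : g @^-1` (g @` (~` N)) =
        [set w | exists2 v, (~` N) v & [set p : T * T | g p.1 = g p.2] (w, v)].
      by apply/seteqP; split=> w [v nNv /= vw]; exists v.
    apply: closed_proj => //; apply: subclosed_compact Tc _ => //.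
    exact: open_closedC.
  by move=> [w nNw wz]; apply: nNw; apply: zN.
have := ab _ _ (eq_ind _ (fun a => nbhs a _) (sat U x oU xU) _ xa)
  (eq_ind _ (fun a => nbhs a _) (sat V y oV yV) _ yb).
move=> [c [cU cV]]; have [z zc] := gs c.
have Uz : U z by apply: contrapT => nU; apply: cU; exists z.
have Vz : V z by apply: contrapT => nV; apply: cV; exists z.
by have : (U `&` V) z by []; rewrite UV.
Qed.

Lemma quot_hausdorff (T : topologicalType) (E : equiv_rel T) :
  compact [set: T] -> hausdorff_space T -> closed [set p : T * T | E p.1 p.2] ->
  hausdorff_space (quot E).
Proof.
move=> Tc Th cE; apply: (quotient_map_hausdorff Tc Th (class_surj (E := E))).
  by move=> C /quot_closedP.
by congr closed: cE; apply/seteqP; split=> p /= /classP.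
Qed.

Section GroupOfIdeal.
Variables (G : groupType) (Z : ambit G) (M : set (maps Z)) (u : maps Z).
Hypotheses (miM : minimal_ideal M) (Mu : M u) (uu : mcomp u u = u).
Local Notation T := (maps Z).
Local Infix "**" := (@mcomp G Z) (at level 40, left associativity).
Local Notation J := (ideal_group M u).
Local Notation sim := (sim M u).
Local Notation Y := (closure J : Type).

Lemma closureJ_u : u \in closure J.
Proof. by apply/mem_set/subset_closure; exact: Ju. Qed.

(** The default [u] is taken outside the closure; only the values on [J] matter. *)
Definition toY (x : T) : Y := insubd (exist _ u closureJ_u) x.

Lemma toYK x : J x -> val (toY x) = x.
Proof. by move=> Jx; rewrite val_insubd mem_set //; exact: subset_closure. Qed.

Lemma Yc (y : Y) : closure J (val y).
Proof. by case: y => y cy; exact: set_mem cy. Qed.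

Lemma JY (y : Y) : J (u ** val y).
Proof. by apply: J_proj => //; apply: closure_JM => //; exact: Yc. Qed.

(** The quotient is formed on the closure of [J] in order to be compact. Each class still meets [J],
    that of [y] at [u ** val y] ([class_toK]). *)
Definition simY : rel Y := fun x y => `[< sim (u ** val x) (u ** val y) >].

Lemma simY_class : equiv_class_of simY.
Proof.
split=> [x|x y|y x z].
- by apply/asboolP; apply: sim_refl; exact: JY.
- by apply/asboolP/asboolP; exact: sim_sym.
- move=> /asboolP xy /asboolP yz; apply/asboolP.
  by apply: (sim_trans miM Mu uu _ _ _ xy yz); exact: JY.
Qed.

Definition simY_equiv : equiv_rel Y := EquivRelPack simY_class.

Definition group_space : topologicalType := quot simY_equiv.
Local Notation K := group_space.

Definition toK (x : T) : K := class_of simY_equiv (toY x).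

Lemma toKP x y : J x -> J y -> toK x = toK y <-> sim x y.
Proof.
move=> Jx Jy; split=> [/classP /asboolP|xy].
  by rewrite !toYK // (Jl Jx) (Jl Jy).
by apply/classP/asboolP; rewrite !toYK // (Jl Jx) (Jl Jy).
Qed.

Lemma class_toK (y : Y) : class_of simY_equiv y = toK (u ** val y).
Proof.
apply/classP/asboolP; rewrite (toYK (JY y)) mcompA uu.
by apply: sim_refl; exact: JY.
Qed.

Lemma toK_surj (a : K) : exists2 x, J x & toK x = a.
Proof.
have [y <-] := class_surj a; exists (u ** val y); first exact: JY.
by rewrite class_toK.
Qed.

Definition reprJ (a : K) : T := s2val (cid2 (toK_surj a)).

Lemma reprJ_J a : J (reprJ a). Proof. by rewrite /reprJ; case: cid2. Qed.
Lemma reprJK a : toK (reprJ a) = a. Proof. by rewrite /reprJ; case: cid2. Qed.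

Definition mulK (a b : K) : K := toK (reprJ a ** reprJ b).
Definition oneK : K := toK u.
Definition invK (a : K) : K :=
  toK (s2val (cid2 (J_linv miM Mu uu (reprJ_J a)))).

Lemma mulKE x y : J x -> J y -> mulK (toK x) (toK y) = toK (x ** y).
Proof.
move=> Jx Jy; have Jm := Jmul miM.
set x' := reprJ (toK x); set y' := reprJ (toK y).
have Jx' : J x' by exact: reprJ_J.
have Jy' : J y' by exact: reprJ_J.
have sx : sim x' x by apply/toKP => //; exact: reprJK.
have sy : sim y' y by apply/toKP => //; exact: reprJK.
apply/toKP; [exact: Jm|exact: Jm|].
apply: (sim_trans miM Mu uu _ (Jm _ _ _ Jx Jy')); try exact: Jm.
  by apply: sim_r.
by apply: sim_l.
Qed.

Lemma mulKA : associative mulK.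
Proof.
move=> a b c; have [x Jx <-] := toK_surj a; have [y Jy <-] := toK_surj b.
by have [z Jz <-] := toK_surj c; rewrite !mulKE //; exact: Jmul.
Qed.

Lemma mul1K : left_id oneK mulK.
Proof.
by move=> a; have [x Jx <-] := toK_surj a; rewrite mulKE ?(Jl Jx).
Qed.

Lemma mulVK : left_inverse oneK invK mulK.
Proof.
move=> a; rewrite -{2}(reprJK a) /invK; case: cid2 => y /= Jy yx.
by rewrite mulKE ?yx //; exact: reprJ_J.
Qed.

Definition group_space_law : group_law K := mk_law mulKA mul1K mulVK.

Lemma Y_compact : compact [set: Y].
Proof. by apply: subtype_compact; exact: compact_closureJ. Qed.

Lemma Y_hausdorff : hausdorff_space Y.
Proof. by apply: subtype_hausdorff; exact: maps_hausdorff. Qed.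

Lemma val_continuous : continuous (fun y : Y => val y : T).
Proof. exact: subtype_val_continuous. Qed.

Lemma group_space_compact : compact [set: K].
Proof. exact: quot_compact Y_compact. Qed.

Lemma group_space_hausdorff : hausdorff_space K.
Proof.
apply: quot_hausdorff; [exact: Y_compact|exact: Y_hausdorff|].
have := @closed_preim _ _ (fun p : Y * Y => (val p.1 : T, val p.2 : T)) _ _
  (closed_sim miM Mu uu).
have -> : (fun p : Y * Y => (val p.1 : T, val p.2 : T)) @^-1`
    [set p : T * T | [/\ closure J p.1, closure J p.2 &
      sim (u ** p.1) (u ** p.2)]] = [set p | simY_equiv p.1 p.2].
  apply/seteqP; split=> -[x y] /=; first by case=> _ _ xy; apply/asboolP.
  by move=> /asboolP xy; split=> //; exact: Yc.
apply; apply: continuous_pair.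
  exact: (continuousC (@continuous_fst Y Y) val_continuous).
exact: (continuousC (@continuous_snd Y Y) val_continuous).
Qed.

(** Closed graphs between compact spaces: the graph of the product is the image of the part of [Tr]
    in the closure of [J], and the graph of the inverse is the fibre of the product over 1. *)
Lemma group_space_topological : topological_group group_space_law.
Proof.
have cc := @class_continuous Y simY_equiv.
have mc : continuous (fun p : K * K => mulK p.1 p.2).
  apply: closed_graph; first exact: group_space_compact.
  pose C := [set t : Y * (Y * Y) | Tr M u (val t.1, (val t.2.1, val t.2.2))].
  have cC : closed C.
    apply: (@closed_preim _ _ (fun t : Y * (Y * Y) =>
      (val t.1 : T, (val t.2.1 : T, val t.2.2 : T))) (Tr M u)); last exact: closed_closure.
    have cv (S : topologicalType) (c : S -> Y) : continuous c ->
        continuous (fun s => val (c s) : T).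
      by move=> cc'; exact: (continuousC cc' val_continuous).
    by apply: continuous_pair; [|apply: continuous_pair]; apply: cv; ctn.
  pose k (t : Y * (Y * Y)) : (K * K) * K :=
    ((class_of _ t.1, class_of _ t.2.1), class_of _ t.2.2).
  have kc : continuous k.
    have cv (S : topologicalType) (c : S -> Y) : continuous c ->
        continuous (fun s => class_of simY_equiv (c s)).
      by move=> cc'; exact: (continuousC cc' cc).
    by do 2?[apply: continuous_pair]; apply: cv; ctn.
  have Kh3 : hausdorff_space ((K * K) * K)%type.
    have Kh := group_space_hausdorff.
    by apply: hausdorff_prod => //; exact: hausdorff_prod.
  have Y3 : compact [set: Y * (Y * Y)].
    by rewrite -!setXTT; apply: compact_setX; [|apply: compact_setX]; exact: Y_compact.
  have -> : [set p : (K * K) * K | p.2 = mulK p.1.1 p.1.2] = k @` C.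
    apply/seteqP; split=> [[[a b] c] /= ->|_ [[x [y z]] /= xyz <-]].
      have [x Jx <-] := toK_surj a; have [y Jy <-] := toK_surj b.
      have Jxy : J (x ** y) by exact: Jmul.
      exists (toY x, (toY y, toY (x ** y))); last by rewrite /k /= mulKE.
      rewrite /C /= !toYK //; apply: Tr_mul; last exact: subset_closure.
      by apply: (mi_ellis miM); exact: JM Jx.
    rewrite /= !class_toK mulKE; try exact: JY.
    apply/toKP; [exact: JY|by apply: Jmul => //; exact: JY|].
    by apply: (Tr_mul_sim miM Mu uu xyz); apply: closure_JM => //; exact: Yc.
  exact: closed_img.
split; first exact: mc.
apply: closed_graph; first exact: group_space_compact.
have := @closed_preim _ _ (fun p : K * K => mulK p.1 p.2) [set oneK] mc.
have -> : (fun p : K * K => mulK p.1 p.2) @^-1` [set oneK] =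
   [set p | p.2 = ginv group_space_law p.1].
  apply/seteqP; split=> -[a b] /=.
    move=> ab; rewrite -(gmul1r group_space_law (ginv _ a)).
    have -> : gone group_space_law = gmul group_space_law a b by exact: esym ab.
    by rewrite gmulKV.
  by move=> ->; exact: (gmulVr group_space_law).
apply; apply: compact_closed; [exact: group_space_hausdorff|exact: compact_set1].
Qed.

End GroupOfIdeal.

(** * The homomorphism from the group of the ideal onto Z/F *)

Section Cover.
Variables (G : groupType) (Z : ambit G) (F : equiv_rel Z)
  (L : group_law (quot F)) (Gt : groupType) (pi : Gt -> Z).
Hypothesis prop : properly_group_like_with L pi.
Local Notation T := (maps Z).
Local Notation gm := (gmap Z).
Local Infix "**" := (@mcomp G Z) (at level 40, left associativity).

Definition psi (f : T) : quot F := class_of F (f (base Z)).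

Definition mulgraph : set (T * (T * T)) :=
  closure [set t | exists g h, t = (gm g, (h, gm g ** h))].

(** Multiplicativity holds on limits of products and not only on products; this makes [psi]
    compatible with [sim]. *)
Lemma psi_mulgraph x y z : mulgraph (x, (y, z)) -> psi z = gmul L (psi x) (psi y).
Proof.
move=> xyz; apply: (class_mul_limit prop).
apply: (@closure_subr _ _ (fun t : T * (T * T) =>
  (t.1 (base Z), (t.2.1 (base Z), t.2.2 (base Z)))) _ (closure _) _ _ _
  (x, (y, z))) xyz.
- apply: continuous_pair.
    by apply: (@continuous_evalC _ _ _ (base Z) (fun t : T * (T * T) => t.1)); ctn.
  apply: continuous_pair.
    by apply: (@continuous_evalC _ _ _ (base Z) (fun t : T * (T * T) => t.2.1)); ctn.
  by apply: (@continuous_evalC _ _ _ (base Z) (fun t : T * (T * T) => t.2.2)); ctn.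
- exact: closed_closure.
- move=> _ [g [h ->]]; apply: subset_closure.
  by exists g, (h (base Z)).
Qed.

Lemma psiM f h : ellis Z f -> psi (f ** h) = gmul L (psi f) (psi h).
Proof.
move=> ef; apply: psi_mulgraph.
apply: (ellis_ind (c := fun p => (p, (h, p ** h)))) ef.
- by ctn.
- exact: closed_closure.
- by move=> g; apply: subset_closure; exists g, h.
Qed.

Variables (M : set T) (u : T).
Hypotheses (miM : minimal_ideal M) (Mu : M u) (uu : u ** u = u).
Local Notation J := (ideal_group M u).
Local Notation K := (group_space miM Mu uu).
Local Notation Y := (closure J : Type).

Lemma psi_u : psi u = gone L.
Proof. by apply: gidem; rewrite -psiM ?uu //; exact: (mi_ellis miM). Qed.

Lemma psi_Tr x y z : Tr M u (x, (y, z)) -> psi z = gmul L (psi x) (psi y).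
Proof.
by move=> xyz; apply: psi_mulgraph; apply: closureS xyz => _ [g [v [_ ->]]]; exists g, v.
Qed.

Definition rho (k : K) : quot F := psi (reprJ k).

(** Two representatives of a class share some [v] with both in relation [Tr] to [(u, v)], so both
    have the value [gmul L (psi u) (psi v)]. *)
Lemma rho_toK x : J x -> rho (toK miM Mu uu x) = psi x.
Proof.
move=> Jx; have Jr := reprJ_J (toK miM Mu uu x).
have [v [_ T1 T2]] := sim_Tr miM Mu uu Jr Jx ((toKP miM Mu uu Jr Jx).1 (reprJK _)).
by rewrite /rho (psi_Tr T1) (psi_Tr T2).
Qed.

Lemma rhoM a b :
  rho (gmul (group_space_law miM Mu uu) a b) = gmul L (rho a) (rho b).
Proof.
have [x Jx <-] := toK_surj a; have [y Jy <-] := toK_surj b.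
have -> : gmul (group_space_law miM Mu uu) (toK miM Mu uu x) (toK miM Mu uu y) =
  toK miM Mu uu (x ** y) by exact: mulKE.
rewrite !rho_toK //; last exact: Jmul.
by apply: psiM; apply: (mi_ellis miM); exact: JM Jx.
Qed.

Lemma psi_proj f : ellis Z f -> psi (u ** (f ** u)) = psi f.
Proof.
move=> ef; have eu : ellis Z u by exact: (mi_ellis miM).
by rewrite psiM // psiM // psi_u gmul1l gmul1r.
Qed.

Lemma rho_surj q : exists k, rho k = q.
Proof.
have [z <-] := class_surj q; have [f ef <-] := ellis_base z.
exists (toK miM Mu uu (u ** (f ** u))); rewrite rho_toK.
  exact: psi_proj.
by apply: J_proj => //; exact: mi_mul.
Qed.

Lemma psi_Y (y : Y) :
  psi (val y) = rho (class_of (simY_equiv miM Mu uu) y).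
Proof.
have eu : ellis Z u by exact: (mi_ellis miM).
rewrite class_toK rho_toK; last exact: JY.
by rewrite psiM // psi_u gmul1l.
Qed.

(* The closure of the idempotents of M is mapped to 1 by psi: this makes rho a
   quotient map although m |-> u m is not continuous on M. *)
Lemma rho_quotient (C : set (quot F)) : closed (rho @^-1` C) -> closed C.
Proof.
move=> cC.
pose A := [set x | J x /\ C (psi x)].
have clA x : closure A x -> C (psi x).
  move=> clx; have cJ : closure J x by apply: closureS clx => y [].
  pose y : Y := exist _ x (mem_set cJ).
  have cD : closed [set y : Y | C (psi (val y))].
    have := closed_preim (@class_continuous _ (simY_equiv miM Mu uu)) cC.
    by congr closed; apply/seteqP; split=> t /=; rewrite psi_Y.
  suff : [set y : Y | C (psi (val y))] y by [].
  apply: cD => N [_ [[V oV <-] /= Vx VN]].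
  have [a [[Ja Ca] Va]] := clx V (open_nbhs_nbhs (conj oV Vx)).
  have cJa : closure J a by exact: subset_closure.
  exists (exist _ a (mem_set cJa)); split=> //; exact: VN.
pose D := [set m | M m /\ C (psi m)].
have cD : closed D.
  (* Every [m] in [M] is [w ** (u ** m)] with [w = m ** y] idempotent, where [y] is the inverse of
     [u ** m] in [J]. The closed condition [mulgraph (w, (w, w))] retains from idempotence what is
     needed, namely that [psi w] is 1. *)
  pose W := [set m | exists2 w : T * T, (closure A `*` M) w &
    [set t : T * (T * T) | mulgraph (t.2.2, (t.2.1, t.1)) /\
      mulgraph (t.2.2, (t.2.2, t.2.2))] (m, w)].
  have cW : closed W.
    apply: closed_proj.
      apply: compact_setX; last exact: mi_compact.
      by apply: (subclosed_compact _ (@maps_compact _ Z)) => //; exact: closed_closure.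
    apply: closedI.
      apply: (@closed_preim _ _ (fun t : T * (T * T) => (t.2.2, (t.2.1, t.1))) mulgraph).
        by ctn.
      exact: closed_closure.
    apply: (@closed_preim _ _ (fun t : T * (T * T) => (t.2.2, (t.2.2, t.2.2))) mulgraph).
      by ctn.
    exact: closed_closure.
  suff -> : D = M `&` W by apply: closedI => //; exact: mi_closed.
  apply/seteqP; split=> [m [Mm Cm]|m [Mm [[a w] [clAa Mw] [/= T1 T2]]]].
    split=> //; have Jm := J_proj miM Mu uu Mm.
    have [y [Jy yx xy]] := J_inv miM Mu uu Jm.
    have eu : ellis Z u by exact: (mi_ellis miM).
    have My := JM Jy; have Mmy : M (m ** y) by exact: mi_mulM.
    have emy := mi_ellis miM Mmy.
    have mg p v : ellis Z p -> mulgraph (p, (v, p ** v)).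
      move=> ep; apply: (ellis_ind (c := fun p => (p, (v, p ** v)))) ep.
      - by ctn.
      - exact: closed_closure.
      - by move=> g; apply: subset_closure; exists g, v.
    exists (u ** m, m ** y).
      by split=> //=; apply: subset_closure; split=> //; rewrite psiM // psi_u gmul1l.
    split=> /=.
      have {3}-> : m = (m ** y) ** (u ** m); last exact: mg.
      by rewrite -mcompA yx (mi_mulu miM Mu uu).
    have {3}-> : m ** y = (m ** y) ** (m ** y); last exact: mg.
    rewrite mcompA -(mcompA m y m).
    by rewrite -{2}(Jr miM Mu uu Jy) -(mcompA y u m) yx (mi_mulu miM Mu uu).
  split=> //.
  have pw : psi w = gone L by apply: gidem; rewrite -(psi_mulgraph T2).
  by rewrite (psi_mulgraph T1) pw gmul1l; exact: clA.
apply/quot_closedP.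
(* Every point of [Z] is [f (base Z)] with [f] in the Ellis semigroup, and [f ** u] is in [M] with
   the same [psi]; so closedness passes from [M] to [Z]. *)
have -> : class_of F @^-1` C =
    (fun f : T => f (base Z)) @` (ellis Z `&` [set f | D (f ** u)]).
  apply/seteqP; split=> [z Cz|_ [f [ef [_ Cf]] <-]].
    have [f ef fz] := ellis_base z; exists f => //; split=> //; split.
      exact: mi_mul.
    rewrite psiM // psi_u gmul1r.
    by rewrite /psi fz.
  by move: Cf; rewrite psiM // psi_u gmul1r.
apply: closed_img.
- exact: ptws_eval.
- exact: maps_compact.
- exact: ambit_hausdorff.
- apply: closedI; first exact: closed_ellis.
  by apply: (@closed_preim _ _ (fun f : T => f ** u) D) => //; ctn.
Qed.

End Cover.

(** [Y] is the closure of the ideal group, [f] the class map and [e] the evaluation at the base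
    point; together they link [K] and [Z] continuously over Z/F. *)
Theorem compact_group_cover (G : groupType) (Z : ambit G) (F : equiv_rel Z)
    (L : group_law (quot F)) (Gt : groupType) (pi : Gt -> Z) :
  properly_group_like_with L pi ->
  exists (K : topologicalType) (LK : group_law K) (rho : K -> quot F)
    (Y : topologicalType) (f : Y -> K) (e : Y -> Z),
  [/\ [/\ topological_group LK, compact [set: K] & hausdorff_space K],
    [/\ forall a b, rho (gmul LK a b) = gmul L (rho a) (rho b),
      forall q, exists k, rho k = q
      & forall C, closed (rho @^-1` C) -> closed C],
    [/\ compact [set: Y], continuous f & continuous e]
    & (forall k, exists y, f y = k) /\ forall y, class_of F (e y) = rho (f y)].
Proof.
move=> prop; have [M miM] := minimal_ideal_exists Z.
have [u Mu uu] := mi_idempotent miM.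
exists (group_space miM Mu uu), (group_space_law miM Mu uu), (@rho _ _ _ _ _ miM Mu uu).
exists (closure (ideal_group M u) : Type), (class_of (simY_equiv miM Mu uu)).
exists (fun y => (val y : maps Z) (base Z)); split.
- split; [exact: group_space_topological|exact: group_space_compact|].
  exact: group_space_hausdorff.
- split; [exact: (rhoM prop)|exact: (rho_surj prop)|exact: (rho_quotient prop)].
- split; [exact: Y_compact|exact: class_continuous|].
  by apply: continuous_evalC; exact: subtype_val_continuous.
- by split=> [k|y]; [exact: class_surj|rewrite -(psi_Y prop)].
Qed.

(** * Presentations as coset spaces *)

Definition subgroup (T : choiceType) (L : group_law T) (S : set T) :=
  S (gone L) /\ forall x y, S x -> S y -> S (gmul L (ginv L x) y).

Section Subgroup.
Variables (T : choiceType) (L : group_law T) (S : set T).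
Hypothesis sS : subgroup L S.

Lemma subgroupV x : S x -> S (ginv L x).
Proof. by move=> Sx; rewrite -[ginv L x](gmul1r L); apply: sS.2 => //; exact: sS.1. Qed.

Lemma subgroupM x y : S x -> S y -> S (gmul L x y).
Proof. by move=> /subgroupV Sx Sy; rewrite -(ginvK L x); exact: sS.2. Qed.

Lemma subgroupMl x y : S x -> S (gmul L x y) -> S y.
Proof. by move=> Sx Sxy; rewrite -(gmulKV L x y); exact: sS.2. Qed.

Lemma subgroupMr x y : S y -> S (gmul L x y) -> S x.
Proof.
move=> Sy Sxy; rewrite -(gmul1r L x) -(gmulVr L y) gmulA.
by apply: subgroupM => //; exact: subgroupV.
Qed.

End Subgroup.

(* X/E is presented as the coset space K/S of a compact Hausdorff group K; the
   compact space Y transports closed, hence analytic, subsets of X to K. *)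
Definition presented (X : topologicalType) (E : equiv_rel X)
    (K : topologicalType) (L : group_law K) (S : set K) (kappa : K -> quot E) :=
  [/\ [/\ topological_group L, compact [set: K], hausdorff_space K
        & subgroup L S],
    [/\ forall k k', kappa k = kappa k' <-> S (gmul L (ginv L k) k'),
      forall c, exists k, kappa k = c
      & forall C, closed (kappa @^-1` C) -> closed C]
    & exists (Y : topologicalType) (f : Y -> K) (e : Y -> X),
      [/\ compact [set: Y], continuous f, continuous e,
        forall k, exists y, f y = k
        & forall y, class_of E (e y) = kappa (f y)] ].

(** Equivariance turns [phib] into the orbit map of the point [c0], the image of 1, under the action
    of Z/F. Composed with [rho] it is the orbit map [kappa] of [K], and [S] is the stabilizer of
    [c0]. *)
Theorem dominated_presented (G : groupType) (X : ambit G) (E : equiv_rel X) :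
  weakly_uniformly_properly_group_like E ->
  exists (K : topologicalType) (L : group_law K) (S : set K)
    (kappa : K -> quot E), presented L S kappa.
Proof.
move=> [Z [F [L [[Gt [pi [EE [prop _ _ _]]]] [phi [[phic phiG phi0] _]]]]]].
move=> [phib phibE [a [a1 aM] aE]].
have [K [LK [rho [Y [f [e [Kt [rM rs rq] [Yc fc ec] [fs fe]]]]]]]] :=
  compact_group_cover prop.
(* The image of a morphism is compact, hence closed, and contains the dense orbit. *)
have phis x : exists z, phi z = x.
  have cl : closed (phi @` setT).
    by apply: closed_img => //; [exact: ambit_compact|exact: ambit_hausdorff].
  suff : (phi @` setT) x by move=> [z _ <-]; exists z.
  apply: cl => N nN.
  have [||y [Ny [g _ yE]]] := @orbit_dense _ X (interior N).
  - by exists x; exact: nbhs_singleton (nbhs_interior nN).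
  - exact: open_interior.
  - exists y; split; last exact: interior_subset.
    by exists (act Z g (base Z)) => //; rewrite phiG phi0.
pose kappa k := phib (rho k).
pose c0 := phib (gone L).
have phibq q : phib q = a q c0 by rewrite -aE gmul1r.
have kS k k' : kappa k = kappa k' <-> kappa (gmul LK (ginv LK k) k') = c0.
  have rV : gmul L (rho (ginv LK k)) (rho k) = gone L.
    rewrite -rM gmulVl; apply: gidem; by rewrite -rM gmul1l.
  rewrite /kappa rM aE; split=> [<-|H].
    by rewrite -aE rV.
  rewrite -[RHS]a1.
  have -> : (1%g : law_group L) = gmul L (rho k) (rho (ginv LK k)).
    by rewrite -rM gmulVr; apply/esym; apply: gidem; rewrite -rM gmul1l.
  by rewrite [RHS]aM H phibq.
have r1 : rho (gone LK) = gone L by apply: gidem; rewrite -rM gmul1l.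
have k1 : kappa (gone LK) = c0 by rewrite /kappa r1.
exists K, LK, [set k | kappa k = c0], kappa; split.
- case: Kt => Kt Kc Kh; split=> //; split=> //= x y xc yc.
  by apply/(kS _ _).1; rewrite xc yc.
- split=> [k k'|c|C cC]; first exact: kS.
    have [x <-] := class_surj c; have [z <-] := phis x.
    by have [k kz] := rs (class_of F z); exists k; rewrite /kappa kz phibE.
  have /quot_closedP cD : closed (phib @^-1` C) by apply: rq.
  apply/quot_closedP.
  have -> : class_of E @^-1` C = phi @` (class_of F @^-1` (phib @^-1` C)).
    apply/seteqP; split=> [x Cx|_ [z Cz <-]]; last by rewrite /= -phibE.
    by have [z zx] := phis x; exists z => //=; rewrite phibE zx.
  by apply: closed_img => //; [exact: ambit_compact|exact: ambit_hausdorff].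
- exists Y, f, (phi \o e); split=> //; first exact: continuousC ec phic.
  by move=> y /=; rewrite -phibE fe.
Qed.

(** * Baire category *)

Section Category.
Variable T : topologicalType.
Implicit Types A B C U V W : set T.

Definition nowhere_dense A := (closure A)° = set0.

Definition meager A := exists2 F : nat -> set T,
  (forall n, nowhere_dense (F n)) & A `<=` \bigcup_n F n.

Lemma nowhere_denseP A : nowhere_dense A <->
  forall U, open U -> U !=set0 -> exists2 V, open V & V !=set0 /\ V `<=` U `\` A.
Proof.
split=> [nA U oU [x Ux]|H].
  exists (U `&` ~` closure A).
    by apply: openI => //; apply: closed_openC; exact: closed_closure.
  split; last by move=> y [Uy ncy]; split=> // Ay; apply: ncy; exact: subset_closure.
  apply: contrapT => n; have : (closure A)° x.
    apply: (@filterS _ _ _ U); last exact: open_nbhs_nbhs.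
    by move=> y Uy; apply: contrapT => ncy; apply: n; exists y.
  by rewrite nA.
apply/seteqP; split=> // x nx; have [] := H _ (open_interior (closure A)).
  by exists x.
move=> V oV [[y Vy] VA]; have [/interior_subset cy nAy] := VA _ Vy.
have [z [Az Vz]] := cy _ (open_nbhs_nbhs (conj oV Vy)).
by have [_] := VA _ Vz.
Qed.

Lemma nowhere_denseS A B : A `<=` B -> nowhere_dense B -> nowhere_dense A.
Proof.
move=> AB /nowhere_denseP nB; apply/nowhere_denseP => U oU nU.
have [V oV [nV VU]] := nB U oU nU; exists V => //; split=> // x /VU [Ux nBx].
by split=> // /AB.
Qed.

Lemma closed_nowhere_dense C : closed C -> C° = set0 -> nowhere_dense C.
Proof. by move=> cC C0; rewrite /nowhere_dense -(proj1 (closure_id C) cC). Qed.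

Lemma nowhere_dense_meager A : nowhere_dense A -> meager A.
Proof. by move=> nA; exists (fun=> A) => // x Ax; exists 0%N. Qed.

Lemma meagerS A B : A `<=` B -> meager B -> meager A.
Proof. by move=> AB [F nF BF]; exists F => //; exact: subset_trans BF. Qed.

Lemma meager0 : meager set0.
Proof. by apply: nowhere_dense_meager; apply: closed_nowhere_dense; [exact: closed0|exact: interior0]. Qed.

Lemma meager_bigcup (F : nat -> set T) :
  (forall n, meager (F n)) -> meager (\bigcup_n F n).
Proof.
move=> mF.
have /choice [H HP] : forall n, exists H : nat -> set T,
    (forall m, nowhere_dense (H m)) /\ F n `<=` \bigcup_m H m.
  by move=> n; have [H] := mF n; exists H.
exists (fun k => if unpickle k is Some p then H p.1 p.2 else set0).
  move=> k; case: unpickle => [p|]; first by have [] := HP p.1.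
  by apply: closed_nowhere_dense; [exact: closed0|exact: interior0].
move=> x [n _ Fx]; have [_ /(_ x Fx) [m _ Hx]] := HP n.
by exists (pickle (n, m)) => //; rewrite pickleK.
Qed.

Lemma meagerU A B : meager A -> meager B -> meager (A `|` B).
Proof.
move=> mA mB; apply: (@meagerS _ (\bigcup_n (if n is 0 then A else B))).
  by move=> x [Ax|Bx]; [exists 0%N|exists 1%N].
by apply: meager_bigcup; case.
Qed.

Lemma boundary_nowhere_dense W :
  open W -> nowhere_dense (closure W `\` W).
Proof.
move=> oW; apply/nowhere_denseP => G oG [x Gx].
have [[y [Gy Wy]]|GW] := pselect (G `&` W !=set0).
  exists (G `&` W); first exact: openI.
  by split; [exists y|move=> z [Gz Wz]; split=> // -[]].
exists G => //; split; first by exists x.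
move=> z Gz; split=> // -[cWz _].
have [t [Wt Gt]] := cWz _ (open_nbhs_nbhs (conj oG Gz)).
by apply: GW; exists t.
Qed.

(* The witnesses of the meagerness of the members of a maximal disjoint family
   can be glued together. *)
Theorem banach_category A :
  meager (A `&` \bigcup_(U in [set U | open U /\ meager (A `&` U)]) U).
Proof.
pose good U := [/\ open U, U !=set0 & meager (A `&` U)].
pose fam (FF : set (set T)) := FF `<=` good /\
  forall U V, FF U -> FF V -> U `&` V !=set0 -> U = V.
have [|FF [[FFg FFd] FFmax]] := @Zorn_bigcup _ fam.
  move=> CC CCf CCt; split=> [U [FF CFF FU]|U V [FF CFF FU] [GG CGG GV] UV].
    by have [sub _] := CCf _ CFF; exact: sub.
  have [FG|GF] := CCt _ _ CFF CGG.
    by have [_] := CCf _ CGG; apply => //; exact: FG.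
  by have [_] := CCf _ CFF; apply => //; exact: GF.
have /choice [H HP] : forall U, exists H : nat -> set T, FF U ->
    (forall m, nowhere_dense (H m)) /\ A `&` U `<=` \bigcup_m H m.
  move=> U; have [FU|nFU] := pselect (FF U); last by exists (fun=> set0).
  by have [_ _ [H nH AH]] := FFg _ FU; exists H.
pose W := \bigcup_(U in FF) U.
have oW : open W by apply: bigcup_open => U /FFg [].
pose N n := \bigcup_(U in FF) (H U n `&` U).
have nN n : nowhere_dense (N n).
  apply/nowhere_denseP => G oG nG.
  have [[x [Gx [U FU Ux]]]|GW] := pselect (G `&` W !=set0); last first.
    exists G => //; split=> // x Gx; split=> // -[U FU [_ Ux]].
    by apply: GW; exists x; split=> //; exists U.
  have [oU _ _] := FFg _ FU; have [nH _] := HP U FU.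
  have [||V oV [nV VG]] := (nowhere_denseP (H U n)).1 (nH n) (G `&` U).
  - exact: openI.
  - by exists x.
  exists V => //; split=> // y Vy; have [[Gy Uy] nHy] := VG _ Vy; split=> //.
  move=> [U' FU' [HU'y U'y]]; apply: nHy; rewrite (FFd U U') //.
  by exists y.
have mW : meager (A `&` W).
  exists N => // x [Ax [U FU Ux]]; have [_ /(_ x) []//] := HP U FU.
  by move=> n _ Hx; exists n => //; exists U.
have nbW : nowhere_dense (closure W `\` W) := boundary_nowhere_dense oW.
apply: (@meagerS _ ((A `&` W) `|` (closure W `\` W))); last first.
  by apply: meagerU => //; exact: nowhere_dense_meager.
move=> x [Ax [U [oU mU] Ux]].
have [Wx|nWx] := pselect (W x); [by left|right; split=> //].
(* Points of [A] in a good open set but outside [W] lie on the boundary of [W]: otherwise [U'] could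
   be added to the maximal family. *)
apply: contrapT => ncWx.
pose U' := U `&` ~` closure W.
have gU' : good U'.
  split.
  - by apply: openI => //; apply: closed_openC; exact: closed_closure.
  - by exists x.
  - by apply: meagerS mU => y [Ay []].
have U'W : U' `&` W = set0.
  by apply/seteqP; split=> // y [[_ nc] /subset_closure].
apply: (FFmax (FF `|` [set U'])).
  split; first by move=> ? ?; left.
  move=> /(_ U') FU'; have : (U' `&` W) x.
    by split=> //; exists U' => //; apply: FU'; right.
  by rewrite U'W.
have dis V : FF V -> V `&` U' !=set0 -> False.
  move=> FV [y [Vy U'y]]; have : (U' `&` W) y by split=> //; exists V.
  by rewrite U'W.
split=> [V [/FFg//|->//]|V V' [FV|->] [FV'|->] VV' //].
- exact: FFd.
- by case: (dis V).
- by case: (dis V'); rewrite // setIC.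
Qed.

End Category.

Lemma compact_decreasing (T : topologicalType) (C : nat -> set T) :
  compact [set: T] -> (forall n, closed (C n)) -> (forall n, C n !=set0) ->
  (forall n, C n.+1 `<=` C n) -> \bigcap_n C n !=set0.
Proof.
move=> Tc cC nC dC.
have mono m n : (m <= n)%N -> C n `<=` C m.
  elim: n => [|n IH]; first by rewrite leqn0 => /eqP ->.
  rewrite leq_eqVlt => /orP[/eqP -> //|]; rewrite ltnS => /IH; exact: subset_trans.
have pF : ProperFilter (filter_from setT C).
  apply: filter_from_proper; last by move=> n _.
  apply: filter_from_filter; first by exists 0%N.
  move=> m n _ _; exists (maxn m n) => // x Cx.
  by split; apply: mono Cx; [exact: leq_maxl|exact: leq_maxr].
have [x [_ clx]] := Tc _ pF filterT.
by exists x => n _; apply: cC => N nN; apply: clx => //; exists n.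
Qed.

Lemma compact_shrink (T : topologicalType) (U : set T) (x : T) :
  compact [set: T] -> hausdorff_space T -> open U -> U x ->
  exists V, [/\ open V, V x & closure V `<=` U].
Proof.
move=> Tc Th oU Ux.
have [W nxW cW] := compact_normal Th Tc
  (compact_closed Th (@compact_set1 _ x)) (t := U)
  (fun z xz => eq_ind x (fun z => nbhs z U) (open_nbhs_nbhs (conj oU Ux)) z (esym xz)).
have [V [oV xV VW]] := (set_nbhsP _ _).1 nxW.
by exists V; split=> //; [exact: xV|exact: subset_trans (closureS VW) cW].
Qed.

Theorem baire (T : topologicalType) (A U : set T) :
  compact [set: T] -> hausdorff_space T -> meager A -> open U -> U !=set0 ->
  U `\` A !=set0.
Proof.
move=> Tc Th [F nF AF] oU nU.
have /choice [s sP] : forall p : nat * set T, exists V, open p.2 -> p.2 !=set0 ->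
    [/\ open V, V !=set0 & closure V `<=` p.2 `\` F p.1].
  move=> [n V] /=; have [[oV nV]|n0] := pselect (open V /\ V !=set0); last first.
    by exists set0 => oV nV; case: n0.
  have [W oW [[x Wx] WV]] := (nowhere_denseP (F n)).1 (nF n) V oV nV.
  have [V' [oV' V'x cV']] := compact_shrink Tc Th oW Wx.
  by exists V' => _ _; split=> //; [exists x|exact: subset_trans WV].
pose V := fix V n := if n is n'.+1 then s (n', V n') else U.
have VP n : open (V n) /\ V n !=set0.
  by elim: n => [//|n [oV nV]] /=; have [] := sP (n, V n) oV nV.
have cV n : closure (V n.+1) `<=` V n `\` F n.
  by have [oV nV] := VP n; have [] := sP (n, V n) oV nV.
have [x Vx] : \bigcap_n closure (V n) !=set0.
  apply: compact_decreasing => // n; first exact: closed_closure.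
    by have [_ [x Vx]] := VP n; exists x; exact: subset_closure.
  by move=> x /cV [Vx _]; exact: subset_closure.
exists x; split; first by have [] := cV 0%N x (Vx 1%N I).
by move=> /AF [n _ Fx]; have [] := cV n x (Vx n.+1 I).
Qed.

Lemma closedD_interior_nowhere_dense (T : topologicalType) (C : set T) :
  closed C -> nowhere_dense (C `\` C°).
Proof.
move=> cC; apply: nowhere_denseS (boundary_nowhere_dense (closed_openC cC)).
move=> x [Cx nCx]; split; last by apply.
move=> N nN; apply: contrapT => nCN; apply: nCx.
by apply: filterS nN => y Ny; apply: contrapT => nCy; apply: nCN; exists y.
Qed.

(* In the proof, C t is the set of points of P t near which the part B t of A
   coming from the branches through t is nonmeager. *)
Theorem analytic_almost_closed (T : topologicalType) (A : set T) :
  analytic A -> exists C, [/\ closed C, meager (A `\` C) & meager (C `\` A)].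
Proof.
move=> [P cP ->].
pose B (t : seq nat) := [set x | exists s : nat -> nat, mkseq s (size t) = t /\
  forall n, P (mkseq s n) x].
have BP t : B t `<=` P t by move=> x [s [st /(_ (size t))]]; rewrite st.
have BU t : B t = \bigcup_n B (rcons t n).
  apply/seteqP; split=> x.
    move=> [s [st Ps]]; exists (s (size t)) => //; exists s; split=> //.
    by rewrite size_rcons mkseqS st.
  move=> [n _ [s [st Ps]]]; exists s; split=> //.
  by move: st; rewrite size_rcons mkseqS => /rcons_inj [].
pose N t := \bigcup_(U in [set U | open U /\ meager (B t `&` U)]) U.
have mN t : meager (B t `&` N t) by exact: banach_category.
have oN t : open (N t) by apply: bigcup_open => U [].
pose C t := P t `\` N t.
have cC t : closed (C t) by apply: closedI => //; exact: open_closedC.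
pose D t := C t `\` \bigcup_n C (rcons t n).
have mD t : meager (D t).
  pose W := (C t)°; pose I := \bigcup_n (C (rcons t n))°.
  have oI : open I by apply: bigcup_open => n _; exact: open_interior.
  (* On an open part of [W] away from the interiors of all [C (rcons t n)], each [B (rcons t n)] is
     meager, hence so is [B t]; but [C t] has lost all points near which [B t] is meager. *)
  have WI : W `<=` closure I.
    move=> x Wx; apply: contrapT => nIx.
    pose U := W `&` ~` closure I.
    have oU : open U.
      apply: openI; first exact: open_interior.
      by apply: closed_openC; exact: closed_closure.
    have [_ ] : C t x by exact: interior_subset.
    apply; exists U => //; split=> //.
    apply: (@meagerS _ _ (\bigcup_n ((B (rcons t n) `&` N (rcons t n)) `|`
        (C (rcons t n) `\` (C (rcons t n))°)))); last first.
      apply: meager_bigcup => n; apply: meagerU; first exact: mN.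
      by apply: nowhere_dense_meager; exact: closedD_interior_nowhere_dense.
    rewrite BU => y [[n _ By] [_ ncIy]]; exists n => //.
    have [Ny|nNy] := pselect (N (rcons t n) y); [by left|right].
    split; first by split=> //; exact: BP.
    by move=> iy; apply: ncIy; apply: subset_closure; exists n.
  apply: (@meagerS _ _ ((C t `\` W) `|` (closure I `\` I))); last first.
    apply: meagerU; apply: nowhere_dense_meager.
      exact: closedD_interior_nowhere_dense.
    exact: boundary_nowhere_dense.
  move=> x [Cx nx]; have [Wx|nWx] := pselect (W x); [right|by left].
  split; first exact: WI.
  by move=> [n _ /interior_subset Cnx]; apply: nx; exists n.
exists (C [::]); split=> //.
- apply: meagerS (mN [::]) => x [[s _ Ps] nCx].
  have Bx : B [::] x by exists s; split=> // n; exact: Ps.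
  split=> //; apply: contrapT => nNx; apply: nCx; split=> //; exact: BP.
- apply: (@meagerS _ _ (\bigcup_k D (odflt [::] (unpickle k)))).
    move=> x [Cx nAx]; apply: contrapT => nD; apply: nAx.
    have next t : exists n, C t x -> C (rcons t n) x.
      have [Ctx|nCt] := pselect (C t x); last by exists 0%N.
      apply: contrapT => nn; apply: nD; exists (pickle t) => //; rewrite pickleK.
      by split=> // -[n _ Cn]; apply: nn; exists n.
    have /choice [f fP] := next.
    (* A point outside every [D t] passes from each [C t] containing it to a child; the branch so
       obtained puts it in the analytic set. *)
    pose u := fix u n := if n is n'.+1 then rcons (u n') (f (u n')) else [::].
    have Cu n : C (u n) x by elim: n => [//|n IH] /=; exact: fP.
    have uE n : mkseq (fun k => f (u k)) n = u n.
      by elim: n => [//|n IH]; rewrite mkseqS IH.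
    exists (fun k => f (u k)) => // n _; rewrite uE.
    by have [] := Cu n.
  by apply: meager_bigcup => k; exact: mD.
Qed.

Corollary analytic_dichotomy (T : topologicalType) (A : set T) :
  analytic A -> meager A \/ exists U, [/\ open U, U !=set0 & meager (U `\` A)].
Proof.
move=> /analytic_almost_closed [C [cC mAC mCA]].
have [C0|nC0] := pselect (C° = set0).
  left; apply: (@meagerS _ _ ((A `\` C) `|` C)).
    by move=> x Ax; have [Cx|nCx] := pselect (C x); [right|left].
  by apply: meagerU => //; apply: nowhere_dense_meager; exact: closed_nowhere_dense.
right; exists C°; split; first exact: open_interior.
  by apply/set0P/eqP.
by apply: meagerS mCA => x [/interior_subset Cx nAx].
Qed.

(** * Analytic sets *)

Lemma take_mkseq (T : Type) (s : nat -> T) m n : (m <= n)%N ->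
  take m (mkseq s n) = mkseq s m.
Proof. by move=> mn; rewrite /mkseq -map_take take_iota (minn_idPl mn). Qed.

Lemma analytic_preim (S T : topologicalType) (f : S -> T) (A : set T) :
  continuous f -> analytic A -> analytic (f @^-1` A).
Proof.
move=> fc [P cP ->]; exists (fun t => f @^-1` P t) => // t.
exact: closed_preim.
Qed.

Lemma analytic_closed (T : topologicalType) (C : set T) : closed C -> analytic C.
Proof.
move=> cC; exists (fun=> C) => //; apply/seteqP; split=> [x Cx|x [s _ /(_ 0%N)]].
  by exists (fun=> 0%N).
exact.
Qed.

(** An image commutes with the union over branches but not with the intersection along one. For
    decreasing closed sets compactness of the fibre repairs this, and [Q] makes the scheme
    decreasing. *)
Lemma analytic_img (S T : topologicalType) (f : S -> T) (A : set S) :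
  continuous f -> compact [set: S] -> hausdorff_space T ->
  analytic A -> analytic (f @` A).
Proof.
move=> fc Sc Th [P cP ->].
pose Q t := \bigcap_(n in [set n | (n <= size t)%N]) P (take n t).
have cQ t : closed (Q t) by apply: closed_bigI.
exists (fun t => f @` Q t); first by move=> t; exact: closed_img.
have QE s n x : Q (mkseq s n) x <-> forall m, (m <= n)%N -> P (mkseq s m) x.
  split=> H m mn; first by rewrite -(take_mkseq s mn); apply: H; rewrite /= size_mkseq.
  by move: mn; rewrite /= size_mkseq => mn; rewrite take_mkseq //; exact: H.
apply/seteqP; split=> [_ [x [s _ Px] <-]|y [s _ Qy]].
  by exists s => // n _; exists x => //; apply/QE => m _; exact: Px.
have [x Cx] : \bigcap_n (Q (mkseq s n) `&` f @^-1` [set y]) !=set0.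
  apply: compact_decreasing => // n.
  - apply: closedI => //; apply: closed_preim => //.
    by apply: compact_closed => //; exact: compact_set1.
  - by have [x Qx xy] := Qy n I; exists x.
  - move=> x [/QE Qx fx]; split=> //; apply/QE => m mn; apply: Qx.
    exact: leq_trans mn _.
exists x; last by have [_] := Cx 0%N I.
exists s => // n _; have [/QE Qx _] := Cx n I; exact: Qx.
Qed.

(** The first entry of a branch selects [n]; the remaining ones form a branch for [A n]. *)
Lemma analytic_bigcup (T : topologicalType) (A : nat -> set T) :
  (forall n, analytic (A n)) -> analytic (\bigcup_n A n).
Proof.
move=> aA; have /choice [P HP] : forall n, exists P : seq nat -> set T,
    (forall t, closed (P t)) /\
    A n = \bigcup_(s in [set: nat -> nat]) \bigcap_(k in [set: nat]) P (mkseq s k).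
  by move=> n; have [P cP AP] := aA n; exists P.
exists (fun t => if t is n :: t' then P n t' else setT).
  by case=> [|n t]; [exact: closedT|have [] := HP n].
apply/seteqP; split=> [x [n _]|x [s _ Ps]].
  have [_ ->] := HP n; move=> [s _ Ps].
  exists (fun k => if k is k'.+1 then s k' else n) => // -[//|k] _.
  by have := Ps k I; rewrite /mkseq /= -[1%N]addn0 iotaDl -map_comp.
exists (s 0%N) => //; have [_ ->] := HP (s 0%N).
exists (fun k => s k.+1) => // k _; have := Ps k.+1 I.
by rewrite /mkseq /= -[1%N]addn0 iotaDl -map_comp.
Qed.

(** One branch codes a branch for every [A k], read at the places [pickle (k, i)]. At [t] only those
    initial segments are tested whose places all lie below [size t]. *)
Lemma analytic_bigcap (T : topologicalType) (A : nat -> set T) :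
  (forall n, analytic (A n)) -> analytic (\bigcap_n A n).
Proof.
move=> aA; have /choice [P HP] : forall n, exists P : seq nat -> set T,
    (forall t, closed (P t)) /\
    A n = \bigcup_(s in [set: nat -> nat]) \bigcap_(k in [set: nat]) P (mkseq s k).
  by move=> n; have [P cP AP] := aA n; exists P.
pose br (u : nat -> nat) (k : nat) := fun i : nat => u (pickle (k, i)).
exists (fun t => \bigcap_(p in [set p : nat * nat |
    forall i, (i < p.2)%N -> (pickle (p.1, i) < size t)%N])
    P p.1 (mkseq (br (nth 0%N t) p.1) p.2)).
  by move=> t; apply: closed_bigI => p _; have [] := HP p.1.
apply/seteqP; split=> [x Ax|x [s _ Ps] k _].
  have /choice [s sP] : forall k, exists s : nat -> nat, forall n, P k (mkseq s n) x.
    by move=> k; have := Ax k I; have [_ ->] := HP k; move=> [s _ Ps]; exists s => n; exact: Ps.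
  exists (fun j => if unpickle j is Some p then s p.1 p.2 else 0%N) => // n _.
  move=> [k m] /= km; rewrite (_ : mkseq _ _ = mkseq (s k) m) //.
  apply/eq_in_map => i; rewrite mem_iota add0n => /= im.
  by rewrite /br nth_mkseq ?pickleK //; move: (km i im); rewrite size_mkseq.
have [_ ->] := HP k; exists (br s k) => // m _.
pose N := (\max_(i < m) pickle (k, val i)).+1.
have lt i : (i < m)%N -> (pickle (k, i) < N)%N.
  by move=> im; rewrite ltnS (leq_bigmax (F := fun i : 'I_m => pickle (k, val i)) (Ordinal im)).
have ltN i : (i < m)%N -> (pickle (k, i) < size (mkseq s N))%N.
  by rewrite size_mkseq; exact: lt.
have := Ps N I (k, m) ltN; rewrite (_ : mkseq _ _ = mkseq (br s k) m) //.
apply/eq_in_map => i; rewrite mem_iota add0n => /= im.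
by rewrite /br nth_mkseq //; exact: lt.
Qed.

Definition countable_base (T : topologicalType) := exists B : nat -> set T,
  (forall n, open (B n)) /\
  forall x U, open U -> U x -> exists n, B n x /\ B n `<=` U.

Lemma analytic_open (T : topologicalType) (U : set T) :
  compact [set: T] -> hausdorff_space T -> countable_base T ->
  open U -> analytic U.
Proof.
move=> Tc Th [B [oB bB]] oU.
rewrite (_ : U = \bigcup_n (if `[< closure (B n) `<=` U >] then closure (B n) else set0)).
  apply: analytic_bigcup => n; case: ifP => _; apply: analytic_closed.
    exact: closed_closure.
  exact: closed0.
apply/seteqP; split=> [x Ux|x [n _]]; last by case: asboolP => // sub /sub.
have [V [oV Vx cV]] := compact_shrink Tc Th oU Ux.
have [n [Bx BV]] := bB x V oV Vx; exists n => //.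
case: asboolP => [_|[]]; first exact: subset_closure.
exact: subset_trans (closureS BV) cV.
Qed.

(** Sets that are analytic together with their complements form a sigma-algebra containing the open
    sets. *)
Lemma analytic_borel (T : topologicalType) (A : set T) :
  compact [set: T] -> hausdorff_space T -> countable_base T ->
  <<s @open T >> A -> analytic A.
Proof.
move=> Tc Th bT sA.
suff [] : [set A | analytic A /\ analytic (~` A)] A by [].
apply: sA; split; last first.
  move=> U oU; split; first exact: analytic_open.
  by apply: analytic_closed; exact: open_closedC.
split.
- by rewrite /= setC0; split; apply: analytic_closed; [exact: closed0|exact: closedT].
- by move=> B [aB aCB]; rewrite setTD /= setCK.
- move=> F aF; split; first by apply: analytic_bigcup => n; have [] := aF n.
  rewrite setC_bigcup; apply: analytic_bigcap => n; by have [] := aF n.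
Qed.

(** * Category in compact groups *)

Lemma meager_homeo (S T : topologicalType) (f : S -> T) (g : T -> S) (A : set T) :
  continuous f -> continuous g -> cancel f g -> cancel g f ->
  meager A -> meager (f @^-1` A).
Proof.
move=> fc gc fg gf [F nF AF]; exists (fun n => f @^-1` F n); last first.
  by move=> x /AF [n _ Fx]; exists n.
move=> n; apply/nowhere_denseP => U oU [x Ux].
have [||V oV [[y Vy] VU]] := (nowhere_denseP (F n)).1 (nF n) (g @^-1` U).
- by move/continuousP: gc; exact.
- by exists (f x); rewrite /= fg.
exists (f @^-1` V); first by move/continuousP: fc; exact.
split; first by exists (g y); rewrite /= gf.
by move=> z /VU [/= Uz nFz]; rewrite fg in Uz.
Qed.

Section TopGroup.
Variables (K : topologicalType) (L : group_law K).
Hypothesis tL : topological_group L.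
Local Infix "*" := (gmul L).
Local Notation inv := (ginv L).

Lemma continuous_gmul (S : topologicalType) (f g : S -> K) :
  continuous f -> continuous g -> continuous (fun x => f x * g x).
Proof. by move=> fc gc; exact: (continuousC (continuous_pair fc gc) tL.1). Qed.

Lemma continuous_ginv (S : topologicalType) (f : S -> K) :
  continuous f -> continuous (fun x => inv (f x)).
Proof. by move=> fc; exact: (continuousC fc tL.2). Qed.

Lemma continuous_mull a : continuous (fun x => a * x).
Proof. by apply: continuous_gmul; ctn. Qed.

Lemma continuous_mulr a : continuous (fun x => x * a).
Proof. by apply: continuous_gmul; ctn. Qed.

Lemma open_mull a (U : set K) : open U -> open [set x | U (a * x)].
Proof. by move: U; apply/continuousP; exact: continuous_mull. Qed.

Lemma open_mulr a (U : set K) : open U -> open [set x | U (x * a)].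
Proof. by move: U; apply/continuousP; exact: continuous_mulr. Qed.

Lemma meager_mull a (A : set K) : meager A -> meager [set x | A (a * x)].
Proof.
apply: (@meager_homeo _ _ (fun x => a * x) (fun x => inv a * x)).
- exact: continuous_mull.
- exact: continuous_mull.
- by move=> x; rewrite gmulKV.
- by move=> x; rewrite gmulVK.
Qed.

Lemma gmulrK a x : x * a * inv a = x.
Proof. by rewrite -gmulA gmulVr gmul1r. Qed.

Lemma gmulrVK a x : x * inv a * a = x.
Proof. by rewrite -gmulA gmulVl gmul1r. Qed.

Lemma meager_mulr a (A : set K) : meager A -> meager [set x | A (x * a)].
Proof.
apply: (@meager_homeo _ _ (fun x => x * a) (fun x => x * inv a)).
- exact: continuous_mulr.
- exact: continuous_mulr.
- by move=> x; exact: gmulrK.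
- by move=> x; exact: gmulrVK.
Qed.

Section Subgroups.
Variable S : set K.
Hypothesis sS : subgroup L S.

Lemma open_subgroup (U : set K) : open U -> U (gone L) -> U `<=` S -> open S.
Proof.
move=> oU U1 US; rewrite openE => x Sx.
apply: (@filterS _ _ _ [set k | U (inv x * k)]).
  by move=> k /US; apply: subgroupMl => //; exact: subgroupV.
by apply: open_nbhs_nbhs; split; [exact: open_mull|rewrite /= gmulVl].
Qed.

Lemma open_subgroup_closed : open S -> closed S.
Proof.
move=> oS x clx.
have nx : nbhs x [set y | S (inv x * y)].
  by apply: open_nbhs_nbhs; split; [exact: open_mull|rewrite /= gmulVl; exact: sS.1].
have [y [Sy Sxy]] := clx _ nx.
by rewrite -(ginvK L x); apply: subgroupV => //; exact: subgroupMr Sxy.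
Qed.

Lemma closure_subgroup : subgroup L (closure S).
Proof.
split; first exact: subset_closure sS.1.
move=> x y clx cly.
apply: (closure_subr (f := fun z => inv z * y)) clx.
- by apply: continuous_gmul; [apply: continuous_ginv|]; ctn.
- exact: closed_closure.
- move=> z Sz; apply: (closure_subr (f := fun y => inv z * y)) cly.
  + exact: continuous_mull.
  + exact: closed_closure.
  + by move=> w Sw; apply: subset_closure; exact: sS.2.
Qed.

End Subgroups.

Hypotheses (Kc : compact [set: K]) (Kh : hausdorff_space K).

(** The argument of Pettis: for [k] close to 1 the set [U] meets its translate by [k], and Baire
    gives there a point [x] with both [x] and [inv k * x] in [S]. *)
Lemma comeager_subgroup_open (S U : set K) : subgroup L S ->
  open U -> U !=set0 -> meager (U `\` S) -> open S.
Proof.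
move=> sS oU nU mU; have [s [Us nUs]] := baire Kc Kh mU oU nU.
have Ss : S s by apply: contrapT => nSs; apply: nUs.
apply: (open_subgroup sS (U := [set k | U (k * s)])); first exact: open_mulr.
  by rewrite /= gmul1l.
move=> k /= Uks.
have [|x [[Ux Ukx] nx]] := baire Kc Kh
    (meagerU mU (meager_mull (inv k) mU)) (openI oU (open_mull (inv k) oU)).
  by exists (k * s); split=> //=; rewrite gmulKV.
have Sx : S x by apply: contrapT => nS; apply: nx; left.
have Skx : S (inv k * x) by apply: contrapT => nS; apply: nx; right.
by rewrite -(ginvK L k); apply: subgroupV => //; exact: subgroupMr Skx.
Qed.

(** Near [u] in [U] some [z] with [u * z] in [V] has a neighbourhood free of [N]; continuity of
    [inv x * y] at [(u, u * z)] gives the two open sets. *)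
Lemma pair_shrink (U V N : set K) : open U -> open V -> U !=set0 -> V !=set0 ->
  nowhere_dense N -> exists U' V', [/\ open U', open V', U' !=set0, V' !=set0 &
    [/\ U' `<=` U, V' `<=` V & forall x y, U' x -> V' y -> ~ N (inv x * y)]].
Proof.
move=> oU oV [u Uu] [v Vv] nN.
have [||W oW [[z Wz] WV]] := (nowhere_denseP N).1 nN [set z | V (u * z)].
- exact: open_mull.
- by exists (inv u * v); rewrite /= gmulVK.
have qc : continuous (fun p : K * K => inv p.1 * p.2).
  by apply: continuous_gmul; [apply: continuous_ginv|]; ctn.
have : nbhs (u, u * z) [set p : K * K | W (inv p.1 * p.2)].
  by apply: qc; apply: open_nbhs_nbhs; split=> //; rewrite /= gmulKV.
move=> [[A B] /= [nA nB] AB].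
exists (U `&` A°), (V `&` B°); split.
- by apply: openI => //; exact: open_interior.
- by apply: openI => //; exact: open_interior.
- by exists u.
- by exists (u * z); split=> //; have [] := WV _ Wz.
- split=> [x []//|x []//|x y [_ /interior_subset Ax] [_ /interior_subset By] Nxy].
  by have [] := WV (inv x * y) (AB (x, y) (conj Ax By)).
Qed.

Lemma family_shrink (I J : eqType) (F : J -> set K) (U : I -> set K)
    (l : seq (I * I * J)) :
  (forall j, nowhere_dense (F j)) -> (forall i, open (U i) /\ U i !=set0) ->
  exists U' : I -> set K, [/\ forall i, open (U' i) /\ U' i !=set0,
    forall i, U' i `<=` U i &
    forall t, t \in l -> t.1.1 != t.1.2 -> forall x y,
      U' t.1.1 x -> U' t.1.2 y -> ~ F t.2 (inv x * y)].
Proof.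
move=> nF; elim: l U => [|[[i1 i2] j] l IH] U HU.
  exists U; split; [exact: HU|by move=> i|by move=> t].
have [U1 [H1 U1U H1l]] := IH U HU.
have [e12|n12] := eqVneq i1 i2.
  exists U1; split=> // t; rewrite inE => /orP[/eqP -> /=|]; last exact: H1l.
  by rewrite e12 eqxx.
have [V1 [V2 [oV1 oV2 nV1 nV2 [VU1 VU2 HV]]]] :=
  pair_shrink (H1 i1).1 (H1 i2).1 (H1 i1).2 (H1 i2).2 (nF j).
pose U2 i := if i == i1 then V1 else if i == i2 then V2 else U1 i.
have U21 i : U2 i `<=` U1 i.
  rewrite /U2; case: eqP => [->|_]; first exact: VU1.
  by case: eqP => [->|_]; [exact: VU2|move=> x].
exists U2; split.
- by move=> i; rewrite /U2; case: eqP => // _; case: eqP => // _; exact: H1.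
- by move=> i; apply: subset_trans (U21 i) (U1U i).
- move=> t; rewrite inE => /orP[/eqP -> /= _ x y|tl nt x y /U21 Ux /U21 Uy].
    by rewrite /U2 eqxx eq_sym (negbTE n12) eqxx; exact: HV.
  exact: H1l Ux Uy.
Qed.

(** Mycielski's construction: a binary scheme of open sets in which [inv x * y] avoids [F 0], ...,
    [F n] for [x], [y] in distinct nodes of length [n.+1]. Compactness gives every branch a
    point. *)
Theorem meager_subgroup_cosets (S : set K) : meager S ->
  exists j : (nat -> bool) -> K,
    forall s t, s <> t -> ~ S (inv (j s) * j t).
Proof.
move=> [F nF SF].
pose good (U : seq bool -> set K) := forall s, open (U s) /\ U s !=set0.
have step (p : nat * (seq bool -> set K)) : exists U' : seq bool -> set K,
    good p.2 -> [/\ good U', forall s, closure (U' s) `<=` p.2 (take p.1 s) &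
      forall s t m, size s = p.1.+1 -> size t = p.1.+1 -> (m <= p.1)%N -> s != t ->
      forall x y, U' s x -> U' t y -> ~ F m (inv x * y)].
  case: p => n U /=; have [gU|ngU] := pselect (good U); last first.
    by exists (fun=> set0).
  pose al := [seq val x | x <- enum {: n.+1.-tuple bool}].
  have alP s : size s = n.+1 -> s \in al.
    by move=> /eqP hs; apply/mapP; exists (Tuple hs) => //; rewrite mem_enum.
  have [U1 [gU1 U1U H1]] := @family_shrink _ _ F (fun s => U (take n s))
    (allpairs pair (allpairs pair al al) (iota 0 n.+1)) nF (fun s => gU _).
  have /choice [U' HU'] : forall s, exists V, [/\ open V, V !=set0 & closure V `<=` U1 s].
    move=> s; have [oU1 [x U1x]] := gU1 s.
    by have [V [oV Vx cV]] := compact_shrink Kc Kh oU1 U1x; exists V; split=> //; exists x.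
  have U'1 s : U' s `<=` U1 s.
    by have [_ _ cU] := HU' s; exact: subset_trans (@subset_closure _ _) cU.
  exists U' => _; split.
  - by move=> s; have [] := HU' s.
  - by move=> s; have [_ _ cU] := HU' s; exact: subset_trans cU (U1U s).
  - move=> s t m hs ht mn st x y /U'1 Ux /U'1 Uy.
    apply: (H1 ((s, t), m)) => //; apply: allpairs_f.
      by apply: allpairs_f; exact: alP.
    by rewrite mem_iota.
have /choice [nx nxP] := step.
pose U := fix U n := if n is n'.+1 then nx (n', U n') else fun=> setT.
have gU n : good (U n).
  elim: n => [|n IH] /=; last by have [] := nxP (n, U n) IH.
  by move=> s; split; [exact: openT|exists (gone L)].
have cU n s : closure (U n.+1 s) `<=` U n (take n s).
  by have [_ H _] := nxP (n, U n) (gU n); exact: H.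
have cUm n (s : nat -> bool) : closure (U n.+1 (mkseq s n.+1)) `<=` U n (mkseq s n).
  by have := @cU n (mkseq s n.+1); rewrite take_mkseq.
have /choice [j jP] : forall s : nat -> bool, exists x, forall n, U n (mkseq s n) x.
  move=> s; have [|||x xP] := @compact_decreasing _ (fun n => closure (U n (mkseq s n))) Kc.
  - by move=> n; exact: closed_closure.
  - by move=> n; have [_ [x Ux]] := gU n (mkseq s n); exists x; exact: subset_closure.
  - by move=> n x /cUm Ux; exact: subset_closure.
  - by exists x => n; apply: cUm; exact: xP.
exists j => s t st /SF [m _ Fm].
have [i sti] : exists i, s i != t i.
  apply: contrapT => ni; apply: st; apply/funext => i.
  by apply/eqP; apply: contrapT => /negP n; apply: ni; exists i.
(* At length [n.+1] the two branches already differ and [F m] is being avoided. *)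
pose n := maxn i m; have [_ _ H] := nxP (n, U n) (gU n).
apply: (H (mkseq s n.+1) (mkseq t n.+1) m _ _ _ _ (j s) (j t)) => //.
- by rewrite size_mkseq.
- by rewrite size_mkseq.
- exact: leq_maxr.
- apply/eqP => /(congr1 (nth false ^~ i)); rewrite !nth_mkseq ?ltnS ?leq_maxl //.
  by apply/eqP.
- exact: (jP s n.+1).
- exact: (jP t n.+1).
Qed.

(** The topological 0-1 law. Otherwise [A] is comeager in an open [U] and its complement in an open
    [V]; an element of the dense [S] translates [U] so that it meets [V], and invariance contradicts
    Baire. *)
Lemma invariant_dense_meager (S A : set K) : dense S -> analytic A ->
  analytic (~` A) -> (forall k s, S s -> A k <-> A (k * s)) ->
  meager A \/ meager (~` A).
Proof.
move=> dS aA aCA invA.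
have [|[U [oU [u Uu] mU]]] := analytic_dichotomy aA; first by left.
have [|[V [oV [v Vv] mV]]] := analytic_dichotomy aCA; first by right.
have [||s [Vus Ss]] := dS [set k | V (u * k)].
- by exists (inv u * v); rewrite /= gmulVK.
- exact: open_mull.
have [|x [[Ux Vx] nx]] := baire Kc Kh
    (meagerU mV (meager_mulr (inv s) mU)) (openI (open_mulr (inv s) oU) oV).
  by exists (u * s); split=> //=; rewrite gmulrK.
exfalso; apply: nx; have [Ax|nAx] := pselect (A x); first by left; split=> //; apply.
right; split=> //= /(invA _ s Ss); by rewrite gmulrVK.
Qed.

(** By the 0-1 law each [A n] or its complement is meager. Outside the union of these meager sets
    all points have the same pattern, hence lie in one coset: [S] is comeager, so open, so
    closed. *)
Lemma dense_separated_full (S : set K) (A : nat -> set K) :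
  subgroup L S -> dense S ->
  (forall n, analytic (A n)) -> (forall n, analytic (~` A n)) ->
  (forall n k s, S s -> A n k <-> A n (k * s)) ->
  (forall k k', (forall n, A n k <-> A n k') -> S (inv k * k')) -> S = setT.
Proof.
move=> sS dS aA aCA invA sepA.
pose B n := if `[< meager (A n) >] then A n else ~` A n.
have mB : meager (\bigcup_n B n).
  apply: meager_bigcup => n; rewrite /B; case: asboolP => // nmA.
  by have [] := invariant_dense_meager dS (aA n) (aCA n) (invA n).
have [|k0 [_ nk0]] := baire Kc Kh mB openT; first by exists (gone L).
have oS : open S.
  apply: (comeager_subgroup_open sS openT); first by exists (gone L).
  have := meager_mull k0 mB; apply: meagerS => k [_ nSk].
  apply: contrapT => nk; apply: nSk.
  rewrite -(gmulKV L k0 k); apply: sepA => n.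
  have nB0 : ~ B n k0 by move=> Bn; apply: nk0; exists n.
  have nB : ~ B n (k0 * k) by move=> Bn; apply: nk; exists n.
  move: nB0 nB; rewrite /B; case: asboolP => _ //= h1 h2.
  by move: h1 h2 => /contrapT h1 /contrapT h2.
have cS := open_subgroup_closed sS oS.
apply/seteqP; split=> // x _; apply: cS => N nN.
have [||y [Ny Sy]] := dS (N°).
- by exists x; exact: nbhs_singleton (nbhs_interior nN).
- exact: open_interior.
- by exists y; split=> //; exact: interior_subset.
Qed.

End TopGroup.

Section ClosedSubgroup.
Variables (K : topologicalType) (L : group_law K) (C : set K).
Hypotheses (sC : subgroup L C) (tL : topological_group L).
Local Notation CT := (C : Type).

Definition sub_mk (x : K) (Cx : C x) : CT := exist _ x (mem_set Cx).
Lemma sub_in (x : CT) : C (val x). Proof. by case: x => x Cx; exact: set_mem Cx. Qed.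
Definition sub_mul (x y : CT) : CT := sub_mk (subgroupM sC (sub_in x) (sub_in y)).
Definition sub_one : CT := sub_mk sC.1.
Definition sub_inv (x : CT) : CT := sub_mk (subgroupV sC (sub_in x)).

Lemma sub_mulA : associative sub_mul.
Proof. by move=> x y z; apply: val_inj; exact: gmulA. Qed.

Lemma sub_mul1 : left_id sub_one sub_mul.
Proof. by move=> x; apply: val_inj; exact: gmul1l. Qed.

Lemma sub_mulV : left_inverse sub_one sub_inv sub_mul.
Proof. by move=> x; apply: val_inj; exact: gmulVl. Qed.

Definition sub_law : group_law CT := mk_law sub_mulA sub_mul1 sub_mulV.

Lemma continuous_to_subtype (S : topologicalType) (f : S -> CT) :
  continuous (fun s => val (f s) : K) -> continuous f.
Proof.
move=> fc s N [_ [[V oV <-] /= Vf VN]].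
by apply: filterS VN _; apply: fc; exact: open_nbhs_nbhs.
Qed.

Lemma sub_topological : topological_group sub_law.
Proof.
have vc := @subtype_val_continuous K C.
split; apply: continuous_to_subtype.
  apply: (continuous_gmul tL).
    exact: (continuousC (@continuous_fst CT CT) vc).
  exact: (continuousC (@continuous_snd CT CT) vc).
exact: (continuous_ginv tL vc).
Qed.

End ClosedSubgroup.

(** In the compact group [closure S] the subgroup is dense, and [dense_separated_full] applies
    there. *)
Theorem separated_subgroup_closed (K : topologicalType) (L : group_law K)
    (S : set K) (A : nat -> set K) :
  topological_group L -> compact [set: K] -> hausdorff_space K -> subgroup L S ->
  (forall n, analytic (A n)) -> (forall n, analytic (~` A n)) ->
  (forall n k s, S s -> A n k <-> A n (gmul L k s)) ->
  (forall k k', (forall n, A n k <-> A n k') -> S (gmul L (ginv L k) k')) ->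
  closed S.
Proof.
move=> tL Kc Kh sS aA aCA invA sepA.
have sC := closure_subgroup tL sS.
pose C : Type := closure S.
have vc := @subtype_val_continuous K (closure S).
have Cc : compact [set: C].
  apply: subtype_compact; apply: (subclosed_compact _ Kc) => //.
  exact: closed_closure.
pose S' : set C := [set x | S (val x)].
have S'T : S' = setT.
  apply: (@dense_separated_full _ (sub_law sC) (sub_topological sC tL) Cc
    (subtype_hausdorff Kh) S' (fun n => (fun x : C => val x) @^-1` A n)).
  - split; first exact: sS.1.
    by move=> x y; exact: sS.2.
  - move=> N [x Nx] oN; have [V oV VN] := oN.
    have cx : closure S (val x) by exact: sub_in.
    have Vx : V (val x) by rewrite -VN in Nx.
    have [y [Sy Vy]] := cx V (open_nbhs_nbhs (conj oV Vx)).
    exists (sub_mk (subset_closure Sy)); split=> //.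
    by rewrite -VN.
  - by move=> n; exact: analytic_preim.
  - by move=> n; exact: (analytic_preim vc (aCA n)).
  - by move=> n k s Ss; exact: invA.
  - by move=> k k' H; exact: sepA.
move=> x clx; have : S' (sub_mk clx) by rewrite S'T.
by [].
Qed.

(** * Countable bases *)

(** The base consists of the points whose whole fibre lies in a given finite union of members of
    [B]; a compact fibre inside an open set is covered by such a union. *)
Lemma countable_base_img (T Q : topologicalType) (g : T -> Q) :
  compact [set: T] -> hausdorff_space T -> hausdorff_space Q -> continuous g ->
  (forall q, exists x, g x = q) -> countable_base T -> countable_base Q.
Proof.
move=> Tc Th Qh gc gs [B [oB bB]].
pose N (F : seq nat) := \bigcup_(n in [set` F]) B n.
have oN F : open (N F) by apply: bigcup_open.
pose V F := ~` (g @` (~` N F)).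
have oV F : open (V F).
  by apply: closed_openC; apply: closed_img => //; exact: open_closedC.
exists (fun n => V (odflt [::] (unpickle n))); split=> // q U oU Uq.
pose C := g @^-1` [set q].
have cC : compact C.
  apply: (subclosed_compact _ Tc) => //; apply: closed_preim => //.
  by apply: compact_closed => //; exact: compact_set1.
have gU x : C x -> U (g x) by move=> ->.
have oW : open (g @^-1` U) by move/continuousP: gc; exact.
have [F [CF FU]] : exists F, C `<=` N F /\ N F `<=` g @^-1` U.
  apply: contrapT => nF.
  pose good F := N F `<=` g @^-1` U.
  have pF : ProperFilter (filter_from good (fun F => C `\` N F)).
    apply: filter_from_proper; last first.
      move=> F gF; apply: contrapT => n0; apply: nF; exists F; split=> // x Cx.
      by apply: contrapT => nNx; apply: n0; exists x.
    apply: filter_from_filter; first by exists [::] => x [].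
    move=> F F' gF gF'; exists (F ++ F').
      by move=> x [n /=]; rewrite mem_cat => /orP[nF1|nF1] Bx; [apply: gF|apply: gF']; exists n.
    move=> x [Cx nx]; split; split=> // -[n nF1 Bx]; apply: nx; exists n => //=.
      by rewrite mem_cat nF1.
    by rewrite mem_cat (_ : n \in F') ?orbT.
  have [|x [Cx clx]] := cC _ pF.
    by exists [::]; [move=> x []|move=> x []].
  have [n [Bx BU]] := bB x _ oW (gU x Cx).
  have [||y [[Cy nNy] By]] := clx (C `\` N [:: n]) (B n).
  - by exists [:: n] => // y [m /=]; rewrite inE => /eqP -> /BU.
  - exact: open_nbhs_nbhs.
  - by apply: nNy; exists n => //=; rewrite inE.
exists (pickle F); rewrite pickleK /=; split.
  by move=> [x nNx gx]; apply: nNx; exact: CF.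
move=> r nr; have [x gx] := gs r; rewrite -gx; apply: FU.
by apply: contrapT => nNx; apply: nr; exists x.
Qed.

Lemma countable_base_homeo (S T : topologicalType) :
  homeomorphic S T -> countable_base T -> countable_base S.
Proof.
move=> [f [g [fg gf fc gc]]] [B [oB bB]]; exists (fun n => f @^-1` B n); split.
  by move=> n; move/continuousP: fc; exact.
move=> x U oU Ux; have oV : open (g @^-1` U) by move/continuousP: gc; exact.
have [|n [Bx BU]] := bB (f x) _ oV; first by rewrite /= fg.
by exists n; split=> // y /BU /=; rewrite fg.
Qed.

Local Open Scope ring_scope.

Lemma metric_countable_base (R : realType) (M : metricType R) (D : set M) :
  countable D -> dense D -> countable_base M.
Proof.
move=> /countable_injP [c cI] dD.
(* The union has at most one term, the ball around the point of [D] with code [p.1], and is empty if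
   there is none. *)
pose B (p : nat * nat) := (\bigcup_(d in [set d | D d /\ c d = p.1])
  ball d (p.2.+1%:R^-1 : R))°.
exists (fun n => B (odflt (0, 0)%N (unpickle n))); split.
  by move=> n; exact: open_interior.
move=> x U oU Ux.
have : nbhs x U by exact: open_nbhs_nbhs.
move=> /nbhs_ballP [e /= e0 eU].
have [n ne] : exists n, n.+1%:R^-1 + n.+1%:R^-1 < e.
  have [n _ /(_ n)] := near_infty_natSinv_lt (PosNum (divr_gt0 e0 (ltr0n R 2))).
  by rewrite /= leqnn => /(_ isT) H; exists n; rewrite (splitr e) ltrD.
have r0 : 0 < n.+1%:R^-1 :> R by rewrite invr_gt0 ltr0n.
have [||d [xd Dd]] := dD ((ball x (n.+1%:R^-1 / 2))°).
- exists x; apply: nbhs_singleton; apply: nbhs_interior.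
  by apply: nbhsx_ballx; rewrite divr_gt0.
- exact: open_interior.
exists (pickle (c d, n)); rewrite pickleK /=; split.
  apply: (@filterS _ _ _ (ball x (n.+1%:R^-1 / 2))); last first.
    by apply: nbhsx_ballx; rewrite divr_gt0.
  move=> y xy; exists d => //; rewrite (splitr n.+1%:R^-1).
  by apply: ball_triangle xy; apply: ball_sym; exact: interior_subset.
move=> y /interior_subset [d' [Dd' cd'] dy].
have dd' : d' = d by apply: cI => //; apply/mem_set.
apply: eU; apply: (le_ball (ltW ne)); apply: (ball_triangle _ dy).
rewrite dd'; apply: le_ball (interior_subset xd).
by rewrite ler_pdivrMr // mulr_natr mulr2n lerDl ltW.
Qed.

Lemma polish_countable_base (R : realType) (T : topologicalType) :
  polish R T -> countable_base T.
Proof.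
move=> [M [hM _ [D cD dD]]]; apply: countable_base_homeo hM _.
exact: metric_countable_base cD dD.
Qed.

Local Close Scope ring_scope.

(** * The trichotomy *)

Lemma card_le_injective (S T : Type) (f : S -> T) :
  injective f -> ([set: S] #<= [set: T])%card.
Proof.
move=> fi; apply: (card_le_trans (B := f @` setT)); last exact: card_leT.
have fI : {in [set: S] &, injective f} by move=> x y _ _; exact: fi.
by have := inj_card_eq fI; rewrite card_eq_le => /andP[].
Qed.

Lemma countable_base_embedding (T : topologicalType) :
  hausdorff_space T -> countable_base T -> exists f : T -> (nat -> bool), injective f.
Proof.
move=> Th [B [oB bB]]; exists (fun x n => `[< B n x >]) => x y fxy.
apply: Th => U V /nbhs_interior nU nV.
have [n [Bx BU]] := bB x _ (open_interior U) (nbhs_singleton nU).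
exists y; split; last exact: nbhs_singleton.
apply: interior_subset; apply: BU; apply/asboolP.
by have := congr1 (fun f => f n) fxy => /= <-; apply/asboolP.
Qed.

(** On an infinite space the cofinite sets form a proper filter, which has no cluster point when
    points are open. *)
Lemma discrete_compact_finite (Q : topologicalType) :
  compact [set: Q] -> (forall q : Q, open [set q]) -> finite_set [set: Q].
Proof.
move=> Qc oQ; apply: contrapT => nfin.
have pF : ProperFilter (fun A : set Q => finite_set (~` A)).
  split; first by rewrite setC0.
  split; first by rewrite setCT; exact: finite_set0.
    by move=> A B fA fB; rewrite setCI finite_setU.
  by move=> A B AB; apply: sub_finite_set; exact: subsetC.
have [q [_ clq]] := Qc _ pF filterT.
have [||r [/= nr qr]] := clq (~` [set q]) [set q].
- by rewrite /= setCK; exact: finite_set1.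
- by apply: open_nbhs_nbhs.
- exact: nr.
Qed.

Lemma cylinder_nbhs (U : set cantor_space) (c : cantor_space) :
  open U -> U c -> exists n, forall d : cantor_space, mkseq d n = mkseq c n -> U d.
Proof.
move=> oU Uc; apply: contrapT => nn.
have /choice [d dP] : forall n, exists d : cantor_space, mkseq d n = mkseq c n /\ ~ U d.
  move=> n; apply: contrapT => nd; apply: nn; exists n => d dc.
  by apply: contrapT => nU; apply: nd; exists d.
have dc : d @ \oo --> c.
  apply/cvg_sup => i N [V [[W oW <-] /= Wc WN]].
  apply: filterS WN _; exists i.+1 => // n /= ni.
  have [/(congr1 (nth false ^~ i)) + _] := dP n.
  by rewrite !nth_mkseq // => ->.
have [n _ /(_ n (leqnn n)) Ud] := dc U (open_nbhs_nbhs (conj oU Uc)).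
by have [_] := dP n; apply.
Qed.

(** An open set of the Cantor space is a countable union of cylinders. *)
Lemma borel_map_cantor (T : topologicalType) (f : T -> cantor_space) :
  (forall n, <<s @open T >> [set x | f x n]) -> borel_map f.
Proof.
move=> mf U oU; set SA := <<s _ >>.
have sA : sigma_algebra setT SA by exact: smallest_sigma_algebra.
have [sA0 sAC sAU] := sA.
have sAC' A : SA A -> SA (~` A) by move=> /sAC; rewrite setTD.
have sAT : SA setT by rewrite -setC0; exact: sAC'.
have sAU2 A B : SA A -> SA B -> SA (A `|` B).
  move=> mA mB; have := sAU (fun n => if n is 0%N then A else B) _.
  rewrite (_ : \bigcup_n _ = A `|` B); first by apply; case.
  apply/seteqP; split=> [x [[|n] _]|x [Ax|Bx]]; [by left|by right| |].
    by exists 0%N.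
  by exists 1%N.
have sAI A B : SA A -> SA B -> SA (A `&` B).
  by move=> mA mB; rewrite -[_ `&` _]setCK setCI; apply: (sAC'); apply: sAU2; exact: sAC'.
pose cyl t := [set x | mkseq (f x) (size t) = t].
have mcyl t : SA (cyl t).
  elim/last_ind: t => [|t b IH]; first by rewrite (_ : cyl _ = setT) //; apply/seteqP.
  rewrite (_ : cyl _ = cyl t `&` [set x | f x (size t) = b]).
    apply: sAI => //; case: b; first exact: mf.
    rewrite (_ : [set x | _] = ~` [set x | f x (size t)]); first by apply: sAC'; exact: mf.
    by apply/seteqP; split=> x /=; [move=> ->|move/negP/negbTE].
  apply/seteqP; split=> x; rewrite /cyl /= size_rcons mkseqS.
    by move=> /rcons_inj [].
  by move=> [-> ->].
rewrite (_ : f @^-1` U = \bigcup_k (if `[< cyl (odflt [::] (unpickle k)) `<=` f @^-1` U >]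
    then cyl (odflt [::] (unpickle k)) else set0)).
  by apply: sAU => k; case: ifP.
apply/seteqP; split=> [x Ux|x [k _]]; last by case: asboolP => // sub; exact: sub.
have [n nU] := cylinder_nbhs oU Ux.
exists (pickle (mkseq (f x) n)) => //; rewrite pickleK /=.
have cx : cyl (mkseq (f x) n) x by rewrite /cyl /= size_mkseq.
by case: asboolP => // -[]; move=> y; rewrite /cyl /= size_mkseq => /nU.
Qed.

Section Presented.
Variables (X : topologicalType) (E : equiv_rel X) (K : topologicalType)
  (L : group_law K) (S : set K) (kappa : K -> quot E).
Hypotheses (Xc : compact [set: X]) (Xh : hausdorff_space X)
  (Xb : countable_base X) (pres : presented L S kappa).

Let tL : topological_group L. Proof. by case: pres => [[]]. Qed.
Let Kc : compact [set: K]. Proof. by case: pres => [[]]. Qed.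
Let Kh : hausdorff_space K. Proof. by case: pres => [[]]. Qed.
Let sS : subgroup L S. Proof. by case: pres => [[]]. Qed.
Let kS k k' : kappa k = kappa k' <-> S (gmul L (ginv L k) k').
Proof. by case: pres => _ [H _ _] _; exact: H. Qed.
Let ks c : exists k, kappa k = c. Proof. by case: pres => _ [_ H _] _; exact: H. Qed.
Let kq C : closed (kappa @^-1` C) -> closed C.
Proof. by case: pres => _ [_ _ H] _; exact: H. Qed.

(** The preimage of a closed set is the image under [f] of a closed subset of the compact [Y]. *)
Lemma kappa_continuous : continuous kappa.
Proof.
have [_ _ [Y [f [e [Yc fc ec fs fe]]]]] := pres.
apply/continuous_closedP => C cC.
rewrite (_ : kappa @^-1` C = f @` (e @^-1` (class_of E @^-1` C))).
  apply: closed_img => //; apply: closed_preim => //.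
  exact: closed_preim (@class_continuous _ E) cC.
apply/seteqP; split=> [k Ck|_ [y Cy <-]]; last by rewrite /= -fe.
by have [y yk] := fs k; exists y => //; rewrite /= fe yk.
Qed.

Lemma analytic_kappa (A : set (quot E)) :
  analytic (class_of E @^-1` A) -> analytic (kappa @^-1` A).
Proof.
have [_ _ [Y [f [e [Yc fc ec fs fe]]]]] := pres.
move=> aA; rewrite (_ : kappa @^-1` A = f @` (e @^-1` (class_of E @^-1` A))).
  by apply: analytic_img => //; exact: analytic_preim.
apply/seteqP; split=> [k Ck|_ [y Cy <-]]; last by rewrite /= -fe.
by have [y yk] := fs k; exists y => //; rewrite /= fe yk.
Qed.

Lemma S_kappa : S = kappa @^-1` [set kappa (gone L)].
Proof.
apply/seteqP; split=> k /=.
  by move=> Sk; apply/esym/kS; rewrite ginv1 gmul1l.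
by move=> /esym/kS; rewrite ginv1 gmul1l.
Qed.

Lemma closed_S_hausdorff : closed S -> hausdorff_space (quot E).
Proof.
move=> cS; apply: (quotient_map_hausdorff Kc Kh ks kq).
rewrite (_ : [set p | _] = (fun p : K * K => gmul L (ginv L p.1) p.2) @^-1` S).
  apply: closed_preim => //; apply: continuous_gmul => //; last by ctn.
  by apply: continuous_ginv => //; ctn.
by apply/seteqP; split=> p /= /kS.
Qed.

Lemma closed_graphE : closed (graph E) <-> closed S.
Proof.
split=> [cE|/closed_S_hausdorff Qh].
  rewrite S_kappa; apply: closed_preim; first exact: kappa_continuous.
  apply/quot_closedP; have [x <-] := class_surj (kappa (gone L)).
  have := closed_preim (f := fun y => (y, x)) (C := graph E) _ cE.
  rewrite (_ : _ @^-1` _ = class_of E @^-1` [set class_of E x]).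
    by apply; ctn.
  by apply/seteqP; split=> y /= /classP.
have := closed_preim (f := fun p : X * X => (class_of E p.1, class_of E p.2))
  _ (closed_diag Qh).
rewrite (_ : _ @^-1` _ = graph E); last by apply/seteqP; split=> y /= /classP.
apply; apply: continuous_pair.
  exact: (continuousC (@continuous_fst X X) (@class_continuous _ E)).
exact: (continuousC (@continuous_snd X X) (@class_continuous _ E)).
Qed.

Lemma quot_le_continuum : ([set: quot E] #<= [set: nat -> bool])%card.
Proof.
have [f fi] := countable_base_embedding Xh Xb.
apply: (card_le_injective (f := fun q : quot E => f (repr q))) => p q /fi.
by move=> /(congr1 (class_of E)); rewrite /class_of !reprK.
Qed.

Lemma meager_S_continuum : meager S -> has_continuum_classes E.
Proof.
move=> mS; have [j jP] := meager_subgroup_cosets tL Kc Kh mS.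
apply/card_eqPle; split; first exact: quot_le_continuum.
apply: (card_le_injective (f := kappa \o j)) => s t /= /kS st.
by apply: contrapT => /jP.
Qed.

Lemma open_or_meager : closed S -> open S \/ meager S.
Proof.
move=> cS; have [S0|nS0] := pselect (S° = set0).
  by right; apply: nowhere_dense_meager; exact: closed_nowhere_dense.
left; apply: (comeager_subgroup_open tL Kc Kh sS (open_interior S)).
  by apply/set0P/eqP.
rewrite (_ : _ `\` _ = set0); first exact: meager0.
by apply/seteqP; split=> // x [/interior_subset].
Qed.

Lemma open_S_points : open S -> forall c, open [set c : quot E].
Proof.
move=> oS c; have [k <-] := ks c.
rewrite -[X in open X]setCK; apply: closed_openC; apply: kq.
rewrite -preimage_setC; apply: open_closedC.
rewrite (_ : _ @^-1` _ = [set k' | S (gmul L (ginv L k) k')]); first exact: open_mull.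
by apply/seteqP; split=> k' /= => [/esym/kS|/kS].
Qed.

(** X/E is then compact Hausdorff with a countable base inherited from [X]; membership in the basic
    sets gives the bits of the reduction. *)
Lemma smooth_of_closed : closed (graph E) -> smooth E.
Proof.
move=> /closed_graphE cS; have Qh := closed_S_hausdorff cS.
have [B [oB bB]] : countable_base (quot E).
  apply: (countable_base_img (g := class_of E)) => //; first exact: class_continuous.
  exact: class_surj.
exists (fun x n => `[< B n (class_of E x) >]).
  apply: borel_map_cantor => n; apply: sub_sigma_algebra.
  rewrite (_ : [set x | _] = class_of E @^-1` B n).
    exact: ((quot_openP (B n)).1 (oB n)).
  by apply/seteqP; split=> x /= /asboolP.
move=> x y; split=> [/classP -> //|xy].
apply/classP; apply: Qh => U V /nbhs_interior nU nV.
have [n [Bx BU]] := bB _ _ (open_interior U) (nbhs_singleton nU).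
exists (class_of E y); split; last exact: nbhs_singleton.
apply: interior_subset; apply: BU; apply/asboolP.
by have := congr1 (fun f => f n) xy => /= <-; apply/asboolP.
Qed.

(** The bits of a reduction are Borel and constant on classes, so they and their complements pass to
    analytic subsets of [K] that are invariant under [S] and separate its cosets. *)
Lemma closed_of_smooth : smooth E -> closed (graph E).
Proof.
move=> [f bf fE]; apply/closed_graphE.
have an b n : analytic [set x | f x n = b].
  apply: analytic_borel => //.
  apply: (bf [set c | c n = b]).
  have cn : continuous (fun c : cantor_space => c n) by exact: (@ptws_eval nat bool n).
  by move/continuousP: cn => /(_ [set b]); apply; exact: discrete_open.
pose A (b : bool) n : set (quot E) := [set c | f (repr c) n = b].
have AE b n : class_of E @^-1` A b n = [set x | f x n = b].
  apply/seteqP; split=> x; rewrite /A /=.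
    by rewrite (fE x (repr (class_of E x))).1 //; apply/classP; rewrite /class_of reprK.
  by rewrite -(fE x (repr (class_of E x))).1 //; apply/classP; rewrite /class_of reprK.
apply: (@separated_subgroup_closed K L S (fun n => kappa @^-1` A true n) tL Kc Kh sS).
- by move=> n; apply: analytic_kappa; rewrite AE.
- move=> n; rewrite (_ : ~` _ = kappa @^-1` A false n).
    by apply: analytic_kappa; rewrite AE.
  by apply/seteqP; split=> k; rewrite /A /=; case: (f _ n).
- by move=> n k s Ss; rewrite /preimage /= (kS k (gmul L k s)).2 // gmulKV.
- move=> k k' H; apply/kS.
  rewrite -[LHS]reprK -[RHS]reprK; apply/classP/fE/funext => n.
  have := H n; rewrite /A /=; case: (f _ n); case: (f _ n) => // -[h1 h2].
    by rewrite h1.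
  by rewrite h2.
Qed.

Lemma presented_trichotomy :
  exactly_one_of3
    (clopen (graph E) /\ finite_set [set: quot E])
    (closed (graph E) /\ has_continuum_classes E)
    [/\ ~ closed (graph E), ~ smooth E
      & analytic (graph E) -> has_continuum_classes E].
Proof.
split; last first.
  split; [move=> [[_ fin] [_ cont]]|by move=> [[[_ cE] _] []]|by move=> [[cE _] []]].
  have : finite_set [set: nat -> bool].
    by apply: card_le_finite fin; move: cont; rewrite /has_continuum_classes card_eq_sym card_eq_le => /andP[].
  have : ([set: nat] #<= [set: nat -> bool])%card.
    apply: (card_le_injective (f := fun n m => n == m)) => n m /(congr1 (fun f => f m)).
    by rewrite eqxx => /eqP.
  by move=> /card_le_finite h /h; exact: infinite_nat.
have [cE|ncE] := pselect (closed (graph E)); last first.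
  right; right; split=> //; first by move/closed_of_smooth.
  move=> aE; apply: meager_S_continuum.
  have [x0 x0E] := class_surj (kappa (gone L)).
  have aS : analytic S.
    rewrite S_kappa; apply: analytic_kappa; rewrite -x0E.
    have := analytic_preim (f := fun x => (x, x0)) _ aE.
    rewrite (_ : _ @^-1` _ = class_of E @^-1` [set class_of E x0]); last first.
      by apply/seteqP; split=> y /= /classP.
    by apply; ctn.
  (* A nonmeager analytic [S] would be open, hence closed. *)
  have [//|[U [oU nU mU]]] := analytic_dichotomy aS.
  exfalso; apply: ncE; apply/closed_graphE; apply: (open_subgroup_closed tL sS).
  exact: (comeager_subgroup_open tL Kc Kh sS oU nU mU).
have [oS|mS] := open_or_meager (closed_graphE.1 cE); last first.
  by right; left; split=> //; exact: meager_S_continuum.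
left; have oQ := open_S_points oS; split.
  split=> //; rewrite openE => -[x y] Exy.
  exists (class_of E @^-1` [set class_of E x], class_of E @^-1` [set class_of E x]).
    split; apply: open_nbhs_nbhs; split=> //=; do ?exact: ((quot_openP _).1 (oQ _)).
    by apply/esym/classP.
  by move=> [x' y'] /= [xx' yx']; apply/classP; rewrite xx' yx'.
exact: (discrete_compact_finite (quot_compact Xc)).
Qed.

End Presented.

(** * Metrization *)

Local Open Scope ring_scope.

Record distance (R : realType) (C : choiceType) := Distance {
  dist_fun : C -> C -> R;
  distxx : forall x, dist_fun x x = 0;
  dist_sep : forall x y, dist_fun x y = 0 -> x = y;
  dist_sym : forall x y, dist_fun x y = dist_fun y x;
  dist_triangle : forall y x z, dist_fun x z <= dist_fun x y + dist_fun y z }.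

(** An alias depending on [d], so that the metric topology does not clash with one that [C] already
    carries. *)
Definition metric_of (R : realType) (C : choiceType) (d : distance R C) : Type := C.

Section MetricOf.
Variables (R : realType) (C : choiceType) (d : distance R C).

HB.instance Definition _ := Choice.copy (metric_of d) C.
HB.instance Definition _ := @isMetric.Build R (metric_of d) (dist_fun d)
  (distxx d) (dist_sep (d := d)) (dist_sym d) (dist_triangle d).

Lemma metric_ofE (x y : metric_of d) (e : R) :
  ball x e y = (dist_fun d x y < e) :> Prop.
Proof. by rewrite ballEmdist. Qed.

End MetricOf.

Section Functions.
Variables (R : realType) (T : topologicalType) (f : nat -> T -> R).
Hypotheses (Tc : compact [set: T]) (fc : forall n, continuous (f n))
  (f01 : forall n x, 0 <= f n x <= 1)
  (fsep : forall x y, (forall n, f n x = f n y) -> x = y).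

Definition dterm (x y : T) (n : nat) : R := `|f n x - f n y| / n.+1%:R.
(** A supremum in place of the usual weighted series; no convergence has to be shown. *)
Definition fdist (x y : T) : R := sup (range (dterm x y)).

Lemma dterm_le x y n : dterm x y n <= n.+1%:R^-1.
Proof.
rewrite /dterm ler_pdivrMr ?ltr0n // mulVf ?pnatr_eq0 //.
have /andP[x0 x1] := f01 n x; have /andP[y0 y1] := f01 n y.
rewrite ler_norml; apply/andP; split.
  by rewrite lerBrDr (le_trans _ x0) // addrC subr_le0.
by rewrite lerBlDr (le_trans x1) // lerDl.
Qed.

Lemma dterm_has_sup x y : has_sup (range (dterm x y)).
Proof.
split; first by exists (dterm x y 0%N); exists 0%N.
exists 1 => _ [n _ <-]; apply: le_trans (dterm_le x y n) _.
by rewrite invf_le1 ?ltr0n // ler1n.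
Qed.

Lemma dterm_fdist x y n : dterm x y n <= fdist x y.
Proof. by apply: (sup_upper_bound (dterm_has_sup x y)); exists n. Qed.

Lemma fdist_le x y e : (forall n, dterm x y n <= e) -> fdist x y <= e.
Proof.
move=> H; apply: ge_sup; first by have [] := dterm_has_sup x y.
by move=> _ [n _ <-].
Qed.

Lemma dterm_ge0 x y n : 0 <= dterm x y n.
Proof. by rewrite /dterm divr_ge0. Qed.

Lemma fdist_ge0 x y : 0 <= fdist x y.
Proof. exact: le_trans (dterm_ge0 x y 0) (dterm_fdist x y 0). Qed.

Lemma fdistxx x : fdist x x = 0.
Proof.
apply/eqP; rewrite eq_le fdist_ge0 andbT; apply: fdist_le => n.
by rewrite /dterm subrr normr0 mul0r.
Qed.

Lemma fdist_sep x y : fdist x y = 0 -> x = y.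
Proof.
move=> d0; apply: fsep => n; have := dterm_fdist x y n.
rewrite d0 /dterm ler_pdivrMr ?ltr0n // mul0r normr_le0 subr_eq0.
by move/eqP.
Qed.

Lemma fdist_sym x y : fdist x y = fdist y x.
Proof.
by rewrite /fdist; have -> // : dterm x y = dterm y x; apply/funext => n; rewrite /dterm distrC.
Qed.

Lemma fdist_triangle y x z : fdist x z <= fdist x y + fdist y z.
Proof.
apply: fdist_le => n; apply: le_trans (lerD (dterm_fdist x y n) (dterm_fdist y z n)).
by rewrite /dterm -mulrDl ler_wpM2r ?invr_ge0 // ler_distD.
Qed.

Definition fmetric : metricType R :=
  metric_of (Distance fdistxx fdist_sep fdist_sym fdist_triangle).

Lemma fmetric_continuous : continuous (fun x : T => x : fmetric).
Proof.
move=> x U /nbhs_ballP [e /= e0 eU].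
(* From [N] on the weight alone keeps a term below [e / 2]; the finitely many earlier terms use
   continuity at [x]. *)
have [N _ /(_ N (leqnn N)) /= Ne] := near_infty_natSinv_lt (PosNum (divr_gt0 e0 (ltr0n R 2))).
have : \forall y \near x, forall n, (n < N)%N -> `|f n x - f n y| < e / 2.
  have H : forall M, \forall y \near x, forall n, (n < M)%N -> `|f n x - f n y| < e / 2.
    elim=> [|M IH]; first by apply: nearW.
    have cM : \forall y \near x, `|f M x - f M y| < e / 2.
      have /cvgrPdist_lt := @fc M x; apply; first by rewrite divr_gt0.
    near=> y => n; rewrite ltnS leq_eqVlt => /orP[/eqP ->|]; first by near: y.
    by move: n; near: y.
  exact: H.
apply: filterS => y Hy; apply: eU; rewrite metric_ofE.
apply: (@le_lt_trans _ _ (e / 2)); last by rewrite ltr_pdivrMr // ltr_pMr // ltr1n.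
apply: fdist_le => n; have [nN|Nn] := ltnP n N.
  apply: le_trans (ltW (Hy n nN)); rewrite /dterm ler_pdivrMr ?ltr0n //.
  by rewrite ler_peMr // ler1n.
apply: le_trans (dterm_le x y n) _; apply: le_trans (ltW Ne).
by rewrite lef_pV2 ?posrE ?ltr0n // ler_nat ltnS.
Unshelve. all: by end_near. Qed.

Lemma fmetric_homeo : homeomorphic T fmetric.
Proof.
exists id, id; split=> //; first exact: fmetric_continuous.
apply/continuous_closedP => A cA.
have -> : (fun x : fmetric => x : T) @^-1` A = (fun x : T => x : fmetric) @` A.
  by apply/seteqP; split=> [x Ax|_ [x Ax <-]] //; exists x.
apply: closed_img => //; [exact: fmetric_continuous|exact: metric_hausdorff].
Qed.

Lemma fmetric_compact : compact [set: fmetric].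
Proof.
have := compact_img fmetric_continuous Tc; congr compact.
by apply/seteqP; split=> // x _; exists x.
Qed.

End Functions.

Lemma compact_metric_complete (R : realType) (M : metricType R)
    (F : set_system M) :
  compact [set: M] -> ProperFilter F -> cauchy F -> exists x : M, F --> x.
Proof.
move=> Mc PF cF; have [x [_ clx]] := Mc F PF filterT.
exists x => U /nbhs_ballP [e /= e0 eU].
have e2 : 0 < e / 2 by rewrite divr_gt0.
have [[A B] /= [FA FB] AB] := cF _ (entourage_ball M (PosNum e2)).
have [a [Aa xa]] := clx A _ FA (nbhsx_ballx x _ e2).
apply: filterS FB => b Bb; apply: eU; rewrite (splitr e).
exact: ball_triangle xa (AB (a, b) (conj Aa Bb)).
Qed.

Lemma compact_metric_separable (R : realType) (M : metricType R) :
  compact [set: M] -> exists2 D : set M, countable D & dense D.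
Proof.
move=> Mc.
have net n : exists s : seq M, forall x, exists2 y, y \in s & ball y (n.+1%:R^-1 : R) x.
  apply: contrapT => nnet.
  pose A (s : seq M) := [set x | forall y, y \in s -> ~ ball y (n.+1%:R^-1 : R) x].
  have pF : ProperFilter (filter_from setT A).
    apply: filter_from_proper; last first.
      move=> s _; apply: contrapT => n0; apply: nnet; exists s => x.
      apply: contrapT => nx; apply: n0; exists x => y ys yx; apply: nx.
      by exists y.
    apply: filter_from_filter; first by exists [::].
    move=> s t _ _; exists (s ++ t) => // x Ax.
    by split=> y ys; apply: Ax; rewrite mem_cat ys ?orbT.
  have [x [_ clx]] := Mc _ pF filterT.
  have [||y [Ay xy]] := clx (A [:: x]) (ball x (n.+1%:R^-1 : R)).
  - by exists [:: x].
  - by apply: nbhsx_ballx; rewrite invr_gt0 ltr0n.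
  - by apply: (Ay x) => //; rewrite inE.
have /choice [s sP] := net.
exists (\bigcup_n [set` s n]); first by apply: bigcup_countable => // n _; exact: finite_set_countable.
move=> U [x Ux] oU.
have /nbhs_ballP [e /= e0 eU] : nbhs x U by exact: open_nbhs_nbhs.
have [n _ /(_ n (leqnn n)) /= ne] := near_infty_natSinv_lt (PosNum e0).
have [y ys yx] := sP n x; exists y; split; last by exists n.
by apply: eU; apply: ball_sym; apply: le_ball yx; exact: ltW.
Qed.

Theorem polish_of_functions (R : realType) (T : topologicalType)
    (f : nat -> T -> R) :
  compact [set: T] -> (forall n, continuous (f n)) ->
  (forall n x, 0 <= f n x <= 1) -> (forall x y, (forall n, f n x = f n y) -> x = y) ->
  polish R T.
Proof.
move=> Tc fc f01 fsep; have Mc : compact [set: fmetric f01 fsep] by exact: fmetric_compact.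
exists (fmetric f01 fsep); split; first exact: fmetric_homeo.
- by move=> F PF cF; exact: compact_metric_complete.
- exact: compact_metric_separable.
Qed.

Local Close Scope ring_scope.

(** * Squares of infinite sets *)

(** Comparability of cardinals: a maximal partial bijection exhausts one of the two types. *)
Lemma injective_total (S T : Type) :
  (exists f : S -> T, injective f) \/ (exists f : T -> S, injective f).
Proof.
pose P (G : set (S * T)) := (forall x y y', G (x, y) -> G (x, y') -> y = y') /\
  (forall x x' y, G (x, y) -> G (x', y) -> x = x').
have [|G [[Gf Gi] Gmax]] := @Zorn_bigcup _ P.
  move=> F FP Ft; split=> [x y y' [G1 F1 G1x] [G2 F2 G2x]|x x' y [G1 F1 G1x] [G2 F2 G2x]].
    have [G12|G21] := Ft _ _ F1 F2.
      by have [H _] := FP _ F2; apply: (H x) => //; exact: G12.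
    by have [H _] := FP _ F1; apply: (H x) => //; exact: G21.
  have [G12|G21] := Ft _ _ F1 F2.
    by have [_ H] := FP _ F2; apply: (H _ _ y) => //; exact: G12.
  by have [_ H] := FP _ F1; apply: (H _ _ y) => //; exact: G21.
have [tot|ntot] := pselect (forall x, exists y, G (x, y)).
  have /choice [f fP] := tot; left; exists f => x x' xx'.
  by apply: (Gi _ _ (f x)) => //; rewrite xx'.
have [sur|nsur] := pselect (forall y, exists x, G (x, y)).
  have /choice [f fP] := sur; right; exists f => y y' yy'.
  by apply: (Gf (f y)) => //; rewrite yy'.
exfalso; move/existsNP: ntot => [x nx]; move/existsNP: nsur => [y ny].
apply: (Gmax (G `|` [set (x, y)])).
  split; first by move=> p Gp; left.
  by move=> /(_ (x, y)) H; apply: nx; exists y; apply: H; right.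
split=> [a b b'|a a' b].
  case=> [Gab|[ea eb]]; case=> [Gab'|[ea' eb']].
  - exact: Gf Gab Gab'.
  - by case: nx; exists b; rewrite -ea'.
  - by case: nx; exists b'; rewrite -ea.
  - by rewrite eb eb'.
case=> [Gab|[ea eb]]; case=> [Gab'|[ea' eb']].
- exact: Gi Gab Gab'.
- by case: ny; exists a; rewrite -eb'.
- by case: ny; exists a'; rewrite -eb.
- by rewrite ea ea'.
Qed.

(* Zorn's lemma for injections D * D -> D, D infinite: at a maximal D, the
   complement of D cannot contain a copy of D. *)
Theorem infinite_square (T : Type) : infinite_set [set: T] ->
  exists f : T * T -> T, injective f.
Proof.
move=> infT; have natinj (D : set T) : infinite_set D ->
    exists i : nat -> T, injective i /\ forall n, D (i n).
  move=> /infiniteP /card_leP [i].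
  exists (fun n => val (i (exist _ n (mem_set I)))); split=> [m n|n].
    by move=> /val_inj /inj E; have [] := E (mem_set I) (mem_set I).
  by case: (i _) => x /= /set_mem.
have [i [iI _]] := natinj _ infT.
pose part (D : set T) (F : T * T -> T) := [/\ infinite_set D,
  forall x y, D x -> D y -> D (F (x, y)) &
  forall p q, (D `*` D) p -> (D `*` D) q -> F p = F q -> p = q].
pose gr (D : set T) (F : T * T -> T) := [set t : (T * T) * T | (D `*` D) t.1 /\ t.2 = F t.1].
pose P G := G = set0 \/ exists D F, part D F /\ G = gr D F.
have [|G [PG Gmax]] := @Zorn_bigcup _ P.
  move=> FF FP Ft.
  have [[G0 [F0 [D0 [F0' [p0 G0E]]]]]|n0] := pselect (exists G, FF G /\
      exists D F, part D F /\ G = gr D F); last first.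
    left; apply/seteqP; split=> // t [G FG Gt]; apply: n0; exists G; split=> //.
    by have [G0|//] := FP G FG; rewrite G0 in Gt.
  right; pose U := \bigcup_(G in FF) G.
  (* The domain is recovered from the graph through the diagonal. *)
  pose D := [set x | exists y, U ((x, x), y)].
  have two (G1 G2 : set ((T * T) * T)) : FF G1 -> FF G2 ->
      exists D F, [/\ part D F, FF (gr D F), G1 `<=` gr D F & G2 `<=` gr D F].
    move=> F1 F2; have e0 : FF (gr D0 F0') by rewrite -G0E.
    have max G G' : FF G -> FF G' -> G' = set0 \/ exists D F, [/\ part D F, FF (gr D F), G `<=` gr D F
        & G' `<=` gr D F].
      move=> FG FG'; have [->|[D' [F' [p' E']]]] := FP G' FG'; [by left|right].
      have [->|[D1 [F1' [p1 E1]]]] := FP G FG.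
        by exists D', F'; split=> //; rewrite -E'.
      have [GG'|G'G] := Ft _ _ FG FG'.
        by exists D', F'; split=> //; rewrite -E'.
      by exists D1, F1'; split=> //; rewrite -E1.
    have [E2|//] := max G1 G2 F1 F2.
    have [E1|[D' [F' [p' e' _ s']]]] := max G2 G1 F2 F1.
      by exists D0, F0'; split=> //; rewrite ?E1 ?E2.
    by exists D', F'; split=> //; rewrite E2.
  have UD t : U t -> (D `*` D) t.1.
    move=> [G FG Gt]; have [D' [F' [p' e' s' _]]] := two G G FG FG.
    have [[Dx Dy] _] := s' _ Gt.
    by split; [exists (F' (t.1.1, t.1.1))|exists (F' (t.1.2, t.1.2))]; exists (gr D' F').
  have DU p : (D `*` D) p -> exists z, U (p, z).
    move=> [[y1 [G1 F1 G1x]] [y2 [G2 F2 G2x]]].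
    have [D' [F' [p' e' s1 s2]]] := two G1 G2 F1 F2.
    have [[D1 _] _] := s1 _ G1x; have [[D2 _] _] := s2 _ G2x.
    by exists (F' p); exists (gr D' F').
  have /choice [F HF] : forall p, exists z, (D `*` D) p -> U (p, z).
    move=> p; have [Dp|nDp] := pselect ((D `*` D) p); last by exists p.1.
    by have [z Uz] := DU p Dp; exists z.
  have Uf p z z' : U (p, z) -> U (p, z') -> z = z'.
    move=> [G1 F1 G1x] [G2 F2 G2x]; have [D' [F' [p' e' s1 s2]]] := two G1 G2 F1 F2.
    by have [_ /= ->] := s1 _ G1x; have [_ /= ->] := s2 _ G2x.
  exists D, F; split; last first.
    apply/seteqP; split=> [[p z] Upz|[p z] [/= Dp ->]]; last exact: HF.
    have Dp := UD _ Upz; split=> //=; exact: Uf Upz (HF _ Dp).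
  split.
  - apply: sub_infinite_set (_ : D0 `<=` D) _; last by case: p0.
    by move=> x D0x; exists (F0' (x, x)); exists G0 => //; rewrite G0E.
  - move=> x y Dx Dy; have [G FG Gt] := HF (x, y) (conj Dx Dy).
    have [D' [F' [p' e' s' _]]] := two G G FG FG.
    have [[/= D'x D'y] /= ->] := s' _ Gt; have [_ pF _] := p'.
    exists (F' (F' (x, y), F' (x, y))), (gr D' F') => //.
    by split=> //; split; exact: pF.
  - move=> p q Dp Dq Fpq.
    have [G1 F1 G1x] := HF p Dp; have [G2 F2 G2x] := HF q Dq.
    have [D' [F' [p' e' s1 s2]]] := two G1 G2 F1 F2.
    have [/= D'p Ep] := s1 _ G1x; have [/= D'q Eq] := s2 _ G2x.
    by have [_ _ pi] := p'; apply: pi => //; rewrite -[LHS]Ep -[RHS]Eq.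
have [G0|[D [F [[Dinf FD FI] GE]]]] := PG.
  (* A countable subset carries such an injection by the pairing of natural numbers, so the maximal
     graph is not empty. *)
  exfalso; have /choice [j jP] : forall x, exists n, (exists m, x = i m) -> x = i n.
    by move=> x; have [[m xm]|nx] := pselect (exists m, x = i m); [exists m|exists 0%N].
  have ji n : j (i n) = n by apply: iI; rewrite -jP //; exists n.
  pose F p := i (pickle (j p.1, j p.2)).
  apply: (Gmax (gr (range i) F)).
    rewrite G0; split=> // sub; apply: (sub ((i 0%N, i 0%N), F (i 0%N, i 0%N))).
    by split=> //; split; exists 0%N.
  right; exists (range i), F; split=> //; split.
  - apply/infiniteP; have iI' : {in [set: nat] &, injective i} by move=> ? ? _ _; exact: iI.
    by have := inj_card_eq iI'; rewrite card_eq_le => /andP[].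
  - by move=> x y _ _; exists (pickle (j x, j y)).
  - move=> [x y] [x' y'] [/= [m _ <-] [n _ <-]] [/= [m' _ <-] [n' _ <-]].
    by move=> /iI /(pcan_inj pickleK) /=; rewrite !ji => -[-> ->].
have [iD [iDI iDD]] := natinj _ Dinf.
have FI' x y x' y' : D x -> D y -> D x' -> D y' -> F (x, y) = F (x', y') ->
    x = x' /\ y = y'.
  by move=> Dx Dy Dx' Dy' /(FI (x, y) (x', y') (conj Dx Dy) (conj Dx' Dy')) [].
(* If the complement embeds in [D], so does all of [T], the tags [iD 0] and [iD 1] keeping the two
   parts apart, and [F] finishes. Otherwise [D] has a disjoint copy, and [F] extends to the union of
   both. *)
have [[g gI]|[g gI]] := injective_total (~` D : Type) (D : Type).
- have gD (x : (~` D : Type)) : D (val (g x)) by case: (g x) => y /= /set_mem.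
  pose e x := if pselect (D x) is right nx then F (val (g (exist _ x (mem_set nx))), iD 1%N)
    else F (x, iD 0%N).
  have eD x : D (e x) by rewrite /e; case: pselect => H; apply: FD.
  have eI x y : e x = e y -> x = y.
    rewrite /e; case: pselect => Hx; case: pselect => Hy.
    + by move/(FI' _ _ _ _ Hx (iDD _) Hy (iDD _)) => [].
    + by move/(FI' _ _ _ _ Hx (iDD _) (gD _) (iDD _)) => [_ /iDI].
    + by move/(FI' _ _ _ _ (gD _) (iDD _) Hy (iDD _)) => [_ /iDI].
    + by move/(FI' _ _ _ _ (gD _) (iDD _) (gD _) (iDD _)) => [/val_inj /gI []].
  exists (fun p => F (e p.1, e p.2)) => -[x y] [x' y'] /=.
  by move/(FI' _ _ _ _ (eD _) (eD _) (eD _) (eD _)) => [/eI -> /eI ->].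
- exfalso.
  have gD (x : (D : Type)) : ~ D (val (g x)) by case: (g x) => y /= /set_mem.
  pose gT x := if pselect (D x) is left Dx then val (g (exist _ x (mem_set Dx))) else x.
  have gTD x : D x -> ~ D (gT x) by rewrite /gT; case: pselect => // Dx _; exact: gD.
  have gTI x y : D x -> D y -> gT x = gT y -> x = y.
    rewrite /gT; case: pselect => // Dx _; case: pselect => // Dy _.
    by move=> /val_inj /gI [].
  have /choice [pr prP] : forall x, exists y,
      (D x -> y = x) /\ (~ D x -> (exists2 z, D z & x = gT z) -> D y /\ x = gT y).
    move=> x; have [Dx|nDx] := pselect (D x); first by exists x.
    have [[z Dz xz]|nz] := pselect (exists2 z, D z & x = gT z); last by exists x.
    by exists z.
  pose D2 := D `|` (gT @` D).
  have prD x : D2 x -> D (pr x).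
    have [p1 p2] := prP x; have [Dx|nDx] := pselect (D x); first by rewrite p1.
    move=> [//|[z Dz zx]]; have [] // := p2 nDx.
    by exists z.
  have prI x y : D2 x -> D2 y -> pr x = pr y -> `[< D x >] = `[< D y >] -> x = y.
    move=> Dx Dy pxy E.
    have [px1 px2] := prP x; have [py1 py2] := prP y.
    have [HDx|nDx] := pselect (D x).
      have HDy : D y by apply/asboolP; rewrite -E; apply/asboolP.
      by rewrite -[x](px1 HDx) -[y](py1 HDy).
    have nDy : ~ D y.
      by move=> HDy; apply: nDx; apply/asboolP; rewrite E; apply/asboolP.
    have [_ ->] : D (pr x) /\ x = gT (pr x).
      by apply: px2 => //; case: Dx => [//|[z Dz zx]]; exists z.
    have [_ ->] : D (pr y) /\ y = gT (pr y).
      by apply: py2 => //; case: Dy => [//|[z Dz zx]]; exists z.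
    by rewrite pxy.
  (* [pr] folds [D2] onto [D], and [tg] records in which half each coordinate lies, so [W] injects
     the pairs from [D2] into [D]. New pairs are then given values in the copy of [D], away from the
     values of [F]. *)
  pose tg (p : T * T) := iD (pickle (`[< D p.1 >], `[< D p.2 >])).
  pose W p := F (F (pr p.1, pr p.2), tg p).
  pose V p := if `[< (D `*` D) p >] then F p else gT (W p).
  have WD p : (D2 `*` D2) p -> D (W p).
    by move=> [p1 p2]; apply: (FD); [apply: (FD); exact: prD|exact: iDD].
  apply: (Gmax (gr D2 V)).
    rewrite GE; split=> [[p z] [/= [p1 p2] ->]|sub].
      split; first by split; left.
      by rewrite /= /V; case: asboolP => // -[].
    have [|[/= nD _] _] := sub ((gT (iD 0%N), iD 0%N), V (gT (iD 0%N), iD 0%N)).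
      by split=> //; split; [right; exists (iD 0%N); [exact: iDD|]|left; exact: iDD].
    by apply: (gTD (iD 0%N)).
  right; exists D2, V; split=> //; split.
  - by apply: sub_infinite_set Dinf => x; left.
  - move=> x y Dx Dy; rewrite /V; case: asboolP => [[D1 D1']|_].
      by left; exact: FD.
    by right; exists (W (x, y)) => //; exact: WD.
  - move=> p q Dp Dq; rewrite /V; case: asboolP => Hp; case: asboolP => Hq.
    + exact: FI.
    + by move=> E; case: (gTD _ (WD _ Dq)); rewrite -E; case: p Hp {E Dp} => x y [? ?]; exact: FD.
    + by move=> E; case: (gTD _ (WD _ Dp)); rewrite E; case: q Hq {E Dq} => x y [? ?]; exact: FD.
    + move=> /(gTI _ _ (WD _ Dp) (WD _ Dq)).
      have [p1 p2] := Dp; have [q1 q2] := Dq.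
      have DF r : (D2 `*` D2) r -> D (F (pr r.1, pr r.2)).
        by move=> [r1 r2]; apply: FD; exact: prD.
      move=> /(FI' _ _ _ _ (DF _ Dp) (iDD _) (DF _ Dq) (iDD _)) [E1 /iDI].
      move=> /(pcan_inj pickleK) [E2 E3].
      have [e1 e2] := FI' _ _ _ _ (prD _ p1) (prD _ p2) (prD _ q1) (prD _ q2) E1.
      rewrite [p]surjective_pairing [q]surjective_pairing.
      by congr (_, _); exact: prI.
Qed.

(** * Dense subgroups of prescribed index *)

Local Open Scope ring_scope.

Definition separating_functions (R : realType) (T : topologicalType) :=
  exists f : nat -> T -> R, [/\ forall n, continuous (f n),
    forall n x, 0 <= f n x <= 1 & forall x y, (forall n, f n x = f n y) -> x = y].

(** The compact space of sequences of integers modulo [n.+1]; the case [n = 1] serves every infinite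
    index. *)
Definition digits (n : nat) : topologicalType :=
  {ptws nat -> discrete_topology 'I_n.+1}.

Section Digits.
Variable n : nat.
Implicit Types x y z : digits n.

Definition dadd x y : digits n := fun k => (x k + y k : 'I_n.+1).
Definition dopp x : digits n := fun k => (- x k : 'I_n.+1).
Definition dzero : digits n := fun k => (0 : 'I_n.+1).

Lemma daddA : associative dadd.
Proof. by move=> x y z; apply/funext => k; exact: addrA. Qed.

Lemma dadd0 : left_id dzero dadd.
Proof. by move=> x; apply/funext => k; exact: add0r. Qed.

Lemma daddN : left_inverse dzero dopp dadd.
Proof. by move=> x; apply/funext => k; exact: addNr. Qed.

Definition digits_law : group_law (digits n) := mk_law daddA dadd0 daddN.

Lemma discrete_continuous2 (A B : discreteTopologicalType) (C : topologicalType)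
    (h : A * B -> C) : continuous h.
Proof.
move=> [a b] U nU; exists ([set a], [set b]); first by split; exact: discrete_set1.
by move=> [a' b'] [/= -> ->]; exact: nbhs_singleton.
Qed.

Lemma discrete_continuous (A : discreteTopologicalType) (C : topologicalType)
    (h : A -> C) : continuous h.
Proof.
move=> a U nU; apply: (@filterS _ _ _ [set a]); last exact: discrete_set1.
by move=> _ ->; exact: (nbhs_singleton nU).
Qed.

Lemma digits_topological : topological_group digits_law.
Proof.
have ev (S : topologicalType) (c : S -> digits n) k : continuous c ->
    continuous (fun s => c s k).
  by move=> cc; exact: (continuousC cc (@ptws_eval nat _ k)).
split; apply: ptws_continuous => k.
  apply: (continuousC (continuous_pair (ev _ _ k (@continuous_fst _ _))
    (ev _ _ k (@continuous_snd _ _)))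
    (@discrete_continuous2 (discrete_topology 'I_n.+1) (discrete_topology 'I_n.+1)
     (discrete_topology 'I_n.+1) (fun p => (p.1 + p.2 : 'I_n.+1)))).
exact: (continuousC (@ptws_eval nat _ k) (@discrete_continuous
  (discrete_topology 'I_n.+1) (discrete_topology 'I_n.+1) (fun a => (- a : 'I_n.+1)))).
Qed.

Lemma digits_compact : compact [set: digits n].
Proof.
apply: ptws_compact; apply: finite_compact.
exact: (@finite_finset 'I_n.+1).
Qed.

Lemma digits_hausdorff : hausdorff_space (digits n).
Proof. by apply: ptws_hausdorff; exact: discrete_hausdorff. Qed.

Lemma digits_separating (R : realType) : separating_functions R (digits n).
Proof.
exists (fun k x => (val (x k : 'I_n.+1))%:R / n.+1%:R); split.
- move=> k; exact: (continuousC (@ptws_eval nat _ k) (@discrete_continuous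
    (discrete_topology 'I_n.+1) R (fun a => (val (a : 'I_n.+1))%:R / n.+1%:R))).
- move=> k x; have xk := ltn_ord (x k : 'I_n.+1); apply/andP; split.
    by rewrite divr_ge0.
  by rewrite ler_pdivrMr ?ltr0n // mul1r ler_nat ltnW.
- move=> x y xy; apply/funext => k; apply: val_inj.
  have := xy k; move=> /(divIf _) H; apply/eqP; rewrite -(eqr_nat R); apply/eqP.
  by apply: H; rewrite pnatr_eq0.
Qed.

Definition eventually0 : set (digits n) :=
  [set x | exists m, forall k, (m <= k)%N -> x k = (0 : 'I_n.+1)].

Lemma eventually0_dense x : closure eventually0 x.
Proof.
move=> U nU.
pose d m : digits n := fun k => if (k < m)%N then x k else (0 : 'I_n.+1).
have dx : d @ \oo --> x.
  apply/cvg_sup => i N [V [[W oW <-] /= Wc WN]].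
  apply: filterS WN _; exists i.+1 => // m /= ni.
  by rewrite /d ni.
have [m _ /(_ m (leqnn m)) Ud] := dx U nU.
exists (d m); split=> //; exists m => k mk.
by rewrite /d ltnNge mk.
Qed.

End Digits.

Section FiniteIndex.
Variable n : nat.
Local Notation D := (digits n).

(* The kernel of such a phi is a dense subgroup of index n.+1. *)
Lemma ultrafilter_limit : exists phi : D -> 'I_n.+1,
  [/\ forall x y : D, phi (dadd x y) = phi x + phi y,
    forall x, eventually0 x -> phi x = 0 &
    forall a : 'I_n.+1, phi (fun=> a) = a].
Proof.
(* [phi x] is the value that [x] takes on a member of [U]; as [U] contains the cofinite sets,
   finitely many terms do not matter. *)
have [U [UU subU]] := ultraFilterLemma (eventually_filter).
have ex (x : D) : exists a : 'I_n.+1, U [set k | x k = a].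
  apply: contrapT => na.
  have : \forall k \near U, forall a : 'I_n.+1, x k <> a.
    apply: filter_forall => a.
    by have [Ua|//] := in_ultra_setVsetC [set k | x k = a] UU; case: na; exists a.
  by move=> /filter_ex [k /(_ (x k))].
have /choice [phi phiP] := ex.
have uniq (x : D) a : U [set k | x k = a] -> phi x = a.
  move=> Ua; have H : U ([set k | x k = phi x] `&` [set k | x k = a]).
    exact: filterI.
  by have [k [<- <-]] := filter_ex H.
exists phi; split.
- move=> x y; apply: uniq.
  have H : U ([set k | x k = phi x] `&` [set k | y k = phi y]) by exact: filterI.
  by apply: filterS H => k /= [<- <-].
- move=> x [m mx]; apply: uniq; apply: subU; exists m => // k; exact: mx.
- move=> a; apply: uniq; have H : U setT by exact: filterT.
  exact: filterS H.
Qed.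

End FiniteIndex.

(* beta maps A bijectively onto a transversal of the left cosets of S. *)
Definition coset_representation (Q : Type) (A : set Q) (T : choiceType)
    (L : group_law T) (S : set T) (beta : Q -> T) :=
  (forall a b, A a -> A b -> S (gmul L (ginv L (beta a)) (beta b)) -> a = b) /\
  (forall t, exists2 a, A a & S (gmul L (ginv L (beta a)) t)).

Lemma finite_index (Q : Type) (A : set Q) : A !=set0 -> finite_set A ->
  exists (n : nat) (S : set (digits n)) (beta : Q -> digits n),
    [/\ subgroup (digits_law n) S, forall x, closure S x &
      coset_representation A (digits_law n) S beta].
Proof.
move=> [a0 Aa0] /finite_setP [m /card_set_bijP [g [gf gi gs]]].
have gm a : A a -> (g a < m)%N by move=> Aa; have := gf a Aa.
case: m gf gs gm => [|n] gf gs gm; first by have := gm a0 Aa0.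
have [phi [phiD phi0 phic]] := ultrafilter_limit n.
have phiN (x : digits n) : phi (dopp x) = - phi x.
  apply/eqP; rewrite -addr_eq0 -phiD daddN; apply/eqP; apply: phi0.
  by exists 0%N.
(* Constant sequences are a transversal of the kernel, as [phi] returns their value; [g] numbers the
   elements of [A]. *)
exists n, [set x | phi x = 0], (fun a _ => inord (g a)); split.
- split; first by apply: phi0; exists 0%N.
  move=> x y /= px py; rewrite -[gmul _ _ _]/(dadd (dopp x) y).
  by rewrite phiD phiN px py oppr0 addr0.
- move=> x; apply: closureS (@eventually0_dense n x); exact: phi0.
- split=> [a b Aa Ab|t] /=.
    rewrite -[gmul _ _ _]/(dadd (dopp _) _) phiD phiN !phic => E.
    apply: gi; rewrite ?inE //.
    have /(congr1 val) /= : inord (g b) = inord (g a) :> 'I_n.+1.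
      by apply/eqP; rewrite -subr_eq0 addrC E.
    by rewrite !inordK ?gm // => ->.
  have [a Aa ga] := gs (phi t) (ltn_ord (phi t)); exists a => //.
  rewrite -[gmul _ _ _]/(dadd (dopp _) _) phiD phiN !phic ga.
  by rewrite inord_val addNr.
Qed.

Section InfiniteIndex.
Variables (Q : Type) (A : set Q) (c : Q -> (nat -> bool)).
Hypotheses (Ainf : infinite_set A) (cI : forall a b, A a -> A b -> c a = c b -> a = b).
Local Notation D := (digits 1).
Local Notation "x + y" := (dadd (n := 1) x y).

Lemma digit2D (a : 'I_2) : (a + a = 0)%R.
Proof. by apply: val_inj; case: a => -[|[|a]]. Qed.

Lemma daddxx (x : D) : x + x = dzero 1.
Proof. by apply/funext => k; exact: digit2D. Qed.

Lemma daddC (x y : D) : x + y = y + x.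
Proof. by apply/funext => k; exact: addrC. Qed.

Lemma daddKK (x y : D) : x + (x + y) = y.
Proof. by rewrite daddA daddxx dadd0. Qed.

(** Each bit of [c q] is repeated infinitely often, so that one differing bit keeps a sum
    [j a + j b] from being eventually 0. *)
Let j (q : Q) : D :=
  fun k => if c q (odflt (0, 0)%N (unpickle k)).1 then (1 : 'I_2) else 0.

Let j_sep a b : A a -> A b -> eventually0 (j a + j b) -> a = b.
Proof.
move=> Aa Ab [m mj]; apply: cI => //; apply/funext => i.
have inf : exists2 k, (m <= k)%N & (odflt (0, 0)%N (unpickle k)).1 = i.
  pose f (l : nat) := pickle (i, l); have fI : injective f by move=> x y /(pcan_inj pickleK) [].
  have [l ml] := injective_gtn fI m.
  by exists (f l); [exact: ltnW|rewrite /f pickleK].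
have [k mk ki] := inf; have := mj k mk.
rewrite /dadd /j ki; case: (c a i); case: (c b i) => //.
Qed.

Definition add_closed (S : set D) := forall x y, S x -> S y -> S (x + y).

Let P (S : set D) := S = set0 \/ [/\ add_closed S, @eventually0 1 `<=` S &
  forall a b, A a -> A b -> S (j a + j b) -> a = b].

(* The cosets of such an S are at least as many as A and at most as many as
   A * A. *)
Lemma maximal_separating_subgroup : exists S : set D,
  [/\ add_closed S, @eventually0 1 `<=` S,
    forall a b, A a -> A b -> S (j a + j b) -> a = b &
    forall v, exists a b, [/\ A a, A b & S (v + (j a + j b))] ].
Proof.
have [a0 Aa0] := infinite_setN0 Ainf.
have Pe : P (@eventually0 1).
  right; split; [|by []|by move=> a b Aa Ab; exact: j_sep].
  move=> x y [m mx] [m' my]; exists (maxn m m') => k.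
  rewrite geq_max => /andP[mk m'k]; rewrite /dadd mx // my //.
  exact: addr0.
have e0 : @eventually0 1 (dzero 1) by exists 0%N.
have [|S [PS Smax]] := @Zorn_bigcup _ P.
  move=> FF FP Ft.
  have [[S0 [FS0 [x0 Sx0]]]|n0] := pselect (exists S, FF S /\ S !=set0); last first.
    left; apply/seteqP; split=> // x [S FS Sx]; apply: n0.
    by exists S; split=> //; exists x.
  right; split.
  - move=> x y [S FS Sx] [S' FS' S'y].
    have [SS'|S'S] := Ft _ _ FS FS'.
      have [S'0|[cS' _ _]] := FP _ FS'; first by rewrite S'0 in S'y.
      by exists S' => //; apply: cS' => //; exact: SS'.
    have [S0'|[cS _ _]] := FP _ FS; first by rewrite S0' in Sx.
    by exists S => //; apply: cS => //; exact: S'S.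
  - have [S0'|[_ eS _]] := FP _ FS0; first by rewrite S0' in Sx0.
    by move=> x /eS S0x; exists S0.
  - move=> a b Aa Ab [S FS Sab]; have [S0'|[_ _ HS]] := FP _ FS; first by rewrite S0' in Sab.
    exact: HS.
have [S0|[cS eS sS]] := PS.
  exfalso; apply: (Smax (@eventually0 1)) => //; rewrite S0; split=> // sub.
  by have := sub _ e0.
exists S; split=> // v.
have [Sv|nSv] := pselect (S v).
  by exists a0, a0; split=> //; rewrite daddxx daddC dadd0.
(* Since [v + v] is 0, adjoining [v] to [S] only adds one coset; by maximality the larger subgroup
   identifies [j a] and [j b] for some [a], [b] distinct in [A]. *)
have nP : ~ P (S `|` [set x | S (v + x)]).
  apply: Smax; split; first by move=> x Sx; left.
  move=> /(_ v) H; apply: nSv; apply: H; right; rewrite /= daddxx; exact: eS.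
apply: contrapT => nab; apply: nP; right; split.
- move=> x y [Sx|Sx] [Sy|Sy].
  + by left; exact: cS.
  + by right; rewrite /= daddC -daddA; apply: cS => //; rewrite daddC.
  + by right; rewrite /= daddA; exact: cS.
  + by left; have := cS _ _ Sx Sy; rewrite (daddC v x) -daddA daddKK.
- by move=> x /eS Sx; left.
- move=> a b Aa Ab [|Sv]; first exact: sS.
  by exfalso; apply: nab; exists a, b.
Qed.

Lemma infinite_index : exists (S : set D) (beta : Q -> D),
  [/\ subgroup (digits_law 1) S, forall x, closure S x &
    coset_representation A (digits_law 1) S beta].
Proof.
have [S [cS eS sS allS]] := maximal_separating_subgroup.
have S0 : S (dzero 1) by apply: eS; exists 0%N.
have oppE (x : D) : dopp x = x.
  by rewrite -[LHS]dadd0 -(daddxx x) -daddA (daddC x (dopp x)) daddN daddC dadd0.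
(* The set handed to [xget] is the coset of [v], so the value depends on the coset only. *)
pose rep (v : D) := xget (dzero 1) [set w | S (v + w)].
have repP v : S (v + rep v).
  by rewrite /rep; case: xgetP => [w -> //|/(_ v)] []; rewrite /= daddxx.
have repE v w : S (v + w) -> rep v = rep w.
  move=> vw; rewrite /rep; congr (xget _ _); apply/seteqP; split=> x /= Sx.
    by have := cS _ _ vw Sx; rewrite (daddC v w) -daddA daddKK.
  by have := cS _ _ vw Sx; rewrite -daddA daddKK.
have repS v w : rep v = rep w -> S (v + w).
  move=> vw; have := cS _ _ (repP v) (repP w).
  by rewrite vw -daddA (daddC w) daddKK.
pose W := range rep.
have AT : (A #= [set: (A : Type)])%card.
  have := @inj_card_eq _ _ [set: (A : Type)] val.
  rewrite (_ : val @` _ = A); first by apply; move=> x y _ _; exact: val_inj.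
  by apply/seteqP; split=> [_ [x _ <-]|x Ax]; [case: x => x /= /set_mem|exists (exist _ x (mem_set Ax))].
have WT : (W #= [set: (W : Type)])%card.
  have := @inj_card_eq _ _ [set: (W : Type)] val.
  rewrite (_ : val @` _ = W); first by apply; move=> x y _ _; exact: val_inj.
  by apply/seteqP; split=> [_ [x _ <-]|x Wx]; [case: x => x /= /set_mem|exists (exist _ x (mem_set Wx))].
have ATinf : infinite_set [set: (A : Type)].
  apply/infiniteP; have /infiniteP := Ainf.
  by move=> h; apply: card_le_trans h _; move: AT; rewrite card_eq_le => /andP[].
have Aval (a : (A : Type)) : A (val a) by case: a => a /= /set_mem.
have [sq sqI] := infinite_square ATinf.
(* [A] embeds in the cosets by [j], the cosets embed in pairs from [A] by [allS], and pairs embed in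
   [A] by [sq]. *)
have AW : (A #= W)%card.
  rewrite (card_eql AT) (card_eqr WT) card_eq_le; apply/andP; split.
    apply: (card_le_injective (f := fun a : (A : Type) =>
      (exist _ (rep (j (val a))) (mem_set (imageP rep (I : [set: D] (j (val a))))) : (W : Type)))).
    move=> a b E; apply: val_inj; apply: sS; [exact: Aval|exact: Aval|].
    by apply: repS; have := congr1 val E.
  have /choice [pr prP] : forall w : (W : Type), exists p : (A : Type) * (A : Type),
      S (val w + (j (val p.1) + j (val p.2))).
    move=> w; have [a [b [Aa Ab Sab]]] := allS (val w).
    by exists (exist _ a (mem_set Aa), exist _ b (mem_set Ab)).
  apply: (card_le_injective (f := fun w : (W : Type) => sq (pr w))).
  move=> w w' /sqI ww'; apply: val_inj.
  have := cS _ _ (prP w) (prP w'); rewrite ww' (daddC (val w')) -daddA daddKK => Sww'.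
  have repid (v : (W : Type)) : rep (val v) = val v.
    case: v => v /= Wv; have [x _ xv] := set_mem Wv.
    by rewrite -xv; apply/esym/repE; exact: repP.
  by rewrite -(repid w) -(repid w'); exact: repE.
have [f [fi ff' f'f]] := (card_bijP AW).
pose beta q : D := if pselect (A q) is left Aq then val (f (exist _ q (mem_set Aq))) else dzero 1.
exists S, beta; split.
- split=> // x y Sx Sy; rewrite -[gmul _ _ _]/(dadd (dopp x) y) oppE; exact: cS.
- by move=> x; apply: closureS (@eventually0_dense 1 x).
- split=> [a b Aa Ab|t].
    rewrite -[gmul _ _ _]/(dadd (dopp _) _) oppE /beta.
    case: pselect => // Aa' ; case: pselect => // Ab'.
    set fa := f _; set fb := f _ => /repE E.
    have repid (v : (W : Type)) : rep (val v) = val v.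
      case: v => v /= Wv; have [x _ xv] := set_mem Wv.
      by rewrite -xv; apply/esym/repE; exact: repP.
    by move: E; rewrite !repid => /val_inj /(can_inj ff') [].
  pose w : (W : Type) := exist _ (rep t) (mem_set (imageP rep (I : [set: D] t))).
  have Aa := Aval (fi w); exists (val (fi w)) => //.
  rewrite -[gmul _ _ _]/(dadd (dopp _) _) oppE /beta; case: pselect => // Aa'.
  rewrite (_ : exist _ _ _ = fi w); last exact: val_inj.
  by rewrite f'f /= daddC; exact: repP.
Qed.

End InfiniteIndex.

Theorem dense_subgroup_of_index (R : realType) (Q : Type) (A : set Q)
    (c : Q -> (nat -> bool)) :
  A !=set0 -> (forall a b, A a -> A b -> c a = c b -> a = b) ->
  exists (T : topologicalType) (L : group_law T) (S : set T) (beta : Q -> T),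
  [/\ topological_group L, compact [set: T], hausdorff_space T &
    separating_functions R T] /\
  [/\ subgroup L S, forall x, closure S x & coset_representation A L S beta].
Proof.
move=> A0 cI; have [n [S [beta H]]] : exists n S beta,
    [/\ subgroup (digits_law n) S, forall x, closure S x &
      coset_representation A (digits_law n) S beta].
  have [Af|Ai] := pselect (finite_set A); first exact: finite_index.
  by exists 1%N; exact: infinite_index cI.
exists (digits n), (digits_law n), S, beta; split=> //; split.
- exact: digits_topological.
- exact: digits_compact.
- exact: digits_hausdorff.
- exact: digits_separating.
Qed.

Local Close Scope ring_scope.

(** * Subgroups, quotients and products of topological groups *)

Section SubgroupPred.
Variables (T : choiceType) (L : group_law T) (S : set T) (sS : subgroup L S).

Definition subgroup_pred : {pred law_group L} := fun x => `[< S x >].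

Lemma subgroup_predM : mulg_closed subgroup_pred.
Proof. by move=> x y /asboolP Sx /asboolP Sy; apply/asboolP; exact: (subgroupM sS). Qed.

Lemma subgroup_pred1 : (1%g : law_group L) \in subgroup_pred.
Proof. by apply/asboolP; exact: sS.1. Qed.

Lemma subgroup_predV : invg_closed subgroup_pred.
Proof. by move=> x /asboolP Sx; apply/asboolP; exact: (subgroupV sS). Qed.

Definition groupClosed_of_subgroup : groupClosed (law_group L) :=
  HB.pack subgroup_pred
    (isInvClosed.Build _ subgroup_pred subgroup_predV)
    (isMul1Closed.Build _ subgroup_pred subgroup_pred1)
    (isMulClosed.Build _ subgroup_pred subgroup_predM).

Lemma coset_equivP (x y : T) :
  coset_equiv groupClosed_of_subgroup x y <-> S (gmul L (ginv L x) y).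
Proof. by split=> [/asboolP|?]; [|apply/asboolP]. Qed.

End SubgroupPred.

(** The graphs of the operations of [K1] are images of the compact graphs of those of [K], hence
    closed. *)
Lemma quotient_topological_group (K K1 : topologicalType) (L : group_law K)
    (L1 : group_law K1) (q : K -> K1) :
  topological_group L -> compact [set: K] -> compact [set: K1] ->
  hausdorff_space K1 -> continuous q -> (forall a, exists x, q x = a) ->
  (forall x y, q (gmul L x y) = gmul L1 (q x) (q y)) -> topological_group L1.
Proof.
move=> tL Kc K1c K1h qc qs qM.
have qV x : q (ginv L x) = ginv L1 (q x).
  rewrite -(gmul1r L1 (ginv L1 (q x))) -[gone L1](_ : q (gone L) = _).
    by rewrite -(gmulVr L x) qM gmulKV.
  by apply: gidem; rewrite -qM gmul1l.
have KKc : compact [set: (K * K)%type] by rewrite -setXTT; exact: compact_setX.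
split; apply: closed_graph => //.
  rewrite (_ : [set p | _] =
    (fun p : K * K => ((q p.1, q p.2), q (gmul L p.1 p.2))) @` setT).
    apply: closed_img => //; last by apply: hausdorff_prod => //; exact: hausdorff_prod.
    have q1 : continuous (fun p : K * K => q p.1) by apply: (continuousC _ qc); ctn.
    have q2 : continuous (fun p : K * K => q p.2) by apply: (continuousC _ qc); ctn.
    apply: continuous_pair; first exact: continuous_pair.
    by apply: (continuousC _ qc); apply: continuous_gmul => //; ctn.
  apply/seteqP; split=> [[[a b] c] /= ->|_ [[x y] _ <-] /=]; last exact: qM.
  have [x <-] := qs a; have [y <-] := qs b.
  by exists (x, y) => //=; rewrite qM.
rewrite (_ : [set p | _] = (fun x => (q x, q (ginv L x))) @` setT).
  apply: closed_img => //; last exact: hausdorff_prod.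
  by apply: continuous_pair => //; apply: (continuousC _ qc); apply: continuous_ginv => //; ctn.
apply/seteqP; split=> [[a b] /= ->|_ [x _ <-] /=]; last exact: qV.
by have [x <-] := qs a; exists x => //; rewrite qV.
Qed.

Section ProductLaw.
Variables (T1 T2 : topologicalType) (L1 : group_law T1) (L2 : group_law T2).

Definition prod_mul (x y : T1 * T2) : (T1 * T2)%type :=
  (gmul L1 x.1 y.1, gmul L2 x.2 y.2).
Definition prod_one : (T1 * T2)%type := (gone L1, gone L2).
Definition prod_inv (x : T1 * T2) : (T1 * T2)%type := (ginv L1 x.1, ginv L2 x.2).

Lemma prod_mulA : associative prod_mul.
Proof. by move=> x y z; rewrite /prod_mul /= !gmulA. Qed.

Lemma prod_mul1 : left_id prod_one prod_mul.
Proof. by move=> [x y]; rewrite /prod_mul /= !gmul1l. Qed.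

Lemma prod_mulV : left_inverse prod_one prod_inv prod_mul.
Proof. by move=> [x y]; rewrite /prod_mul /= !gmulVl. Qed.

Definition prod_law : group_law (T1 * T2)%type :=
  mk_law prod_mulA prod_mul1 prod_mulV.

Lemma prod_topological :
  topological_group L1 -> topological_group L2 -> topological_group prod_law.
Proof.
move=> t1 t2; split; apply: continuous_pair.
- by apply: (continuous_gmul t1); ctn.
- by apply: (continuous_gmul t2); ctn.
- by apply: (continuous_ginv t1); ctn.
- by apply: (continuous_ginv t2); ctn.
Qed.

Lemma prod_subgroup S1 S2 :
  subgroup L1 S1 -> subgroup L2 S2 -> subgroup prod_law (S1 `*` S2).
Proof.
move=> s1 s2; split; first by split; [exact: s1.1|exact: s2.1].
by move=> x y [x1 x2] [y1 y2]; split; [exact: s1.2|exact: s2.2].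
Qed.

End ProductLaw.

Lemma separating_prod (R : realType) (S T : topologicalType) :
  separating_functions R S -> separating_functions R T ->
  separating_functions R (S * T)%type.
Proof.
move=> [f [fc f01 fs]] [g [gc g01 gs]].
exists (fun n p => if odd n then f n./2 p.1 else g n./2 p.2); split.
- move=> n; case: (odd n).
    exact: (continuousC (@continuous_fst S T) (fc _)).
  exact: (continuousC (@continuous_snd S T) (gc _)).
- by move=> n p; case: (odd n).
- move=> [a b] [c d] H; congr (_, _).
    by apply: fs => n; have := H n.*2.+1; rewrite /= odd_double uphalf_double.
  by apply: gs => n; have := H n.*2; rewrite odd_double doubleK.
Qed.

Lemma separating_polish (R : realType) (T : topologicalType) :
  compact [set: T] -> separating_functions R T -> polish R T.
Proof. by move=> Tc [f [fc f01 fs]]; exact: polish_of_functions fs. Qed.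

(* Urysohn functions for the pairs of members of a countable base. *)
Lemma separating_compact (R : realType) (T : topologicalType) :
  compact [set: T] -> hausdorff_space T -> countable_base T ->
  separating_functions R T.
Proof.
move=> Tc Th [B [oB bB]].
exists (fun n => Urysohn (closure (B (odflt (0, 0) (unpickle n)).1))
  (~` B (odflt (0, 0) (unpickle n)).2)); split.
- by move=> n; exact: Urysohn_continuous.
- move=> n x; have := @Urysohn_range T R (closure (B (odflt (0, 0) (unpickle n)).1))
    (~` B (odflt (0, 0) (unpickle n)).2).
  by move=> /(_ _ (ex_intro2 _ _ x I erefl)) /=; rewrite in_itv.
- move=> x y H; apply: contrapT => nxy.
  have oy : open (~` [set y]).
    by apply: closed_openC; apply: compact_closed => //; exact: compact_set1.
  have [n [Bx By]] := bB x _ oy nxy.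
  have [V [oV Vx cV]] := compact_shrink Tc Th (oB n) Bx.
  have [m [Bmx BmV]] := bB x V oV Vx.
  have sep : uniform_separator (closure (B m)) (~` B n).
    apply: (normal_separatorP (R := R)).1; first exact: compact_normal.
    - exact: closed_closure.
    - exact: open_closedC.
    - by apply/seteqP; split=> // z [/(closureS BmV) /cV].
  have := H (pickle (m, n)); rewrite pickleK /=.
  have -> := Urysohn_sub0 (R := R) sep (imageP _ (subset_closure Bmx)).
  have nBy : (~` B n) y by move=> /By /(_ erefl).
  have -> := Urysohn_sub1 (R := R) sep (imageP _ nBy).
  by move/esym/eqP; rewrite GRing.oner_eq0.
Qed.

(** * The compact Polish group *)

(* C a closed subgroup of K with K/C second countable: dividing K by the kernel
   of its action on K/C gives a metrizable group. *)
Section Metrizable.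
Variables (R : realType) (K : topologicalType) (L : group_law K) (C : set K).
Hypotheses (tL : topological_group L) (Kc : compact [set: K])
  (Kh : hausdorff_space K) (sC : subgroup L C) (cC : closed C).
Local Infix "*" := (gmul L).
Local Notation inv := (ginv L).

Lemma coset_class : equiv_class_of (fun x y => `[< C (inv x * y) >]).
Proof.
split=> [x|x y|y x z].
- by apply/asboolP; rewrite gmulVl; exact: sC.1.
- by apply/asboolP/asboolP => /(subgroupV sC); rewrite ginvM ginvK.
- move=> /asboolP xy /asboolP yz; apply/asboolP.
  by have := subgroupM sC xy yz; rewrite -gmulA gmulVK.
Qed.

Definition cosets : topologicalType := quot (EquivRelPack coset_class).
Definition coset (x : K) : cosets := class_of _ x.

Lemma cosetP x y : coset x = coset y <-> C (inv x * y).
Proof. by split=> [/classP/asboolP|?]; [|apply/classP/asboolP]. Qed.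

Lemma coset_l a x y : coset x = coset y -> coset (a * x) = coset (a * y).
Proof. by move=> /cosetP xy; apply/cosetP; rewrite ginvM -gmulA gmulKV. Qed.

Lemma coset_continuous : continuous coset.
Proof. exact: class_continuous. Qed.

Lemma cosets_compact : compact [set: cosets].
Proof. exact: quot_compact. Qed.

Lemma cosets_hausdorff : hausdorff_space cosets.
Proof.
apply: quot_hausdorff => //.
rewrite (_ : [set p | _] = (fun p : K * K => inv p.1 * p.2) @^-1` C).
  apply: closed_preim => //; apply: continuous_gmul => //; last by ctn.
  by apply: continuous_ginv => //; ctn.
by apply/seteqP; split=> p /= /asboolP.
Qed.

Lemma coset_closed_eq a b : closed [set m | coset (a * m) = coset (b * m)].
Proof.
apply: (closed_preim (f := fun m => (coset (a * m), coset (b * m))) _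
  (closed_diag cosets_hausdorff)).
by apply: continuous_pair; apply: continuousC coset_continuous; exact: continuous_mull.
Qed.

Lemma kernel_class :
  equiv_class_of (fun x y => `[< forall m, coset (x * m) = coset (y * m) >]).
Proof.
split=> [x|x y|y x z]; first exact/asboolP.
- by apply/asboolP/asboolP => H m.
- by move=> /asboolP xy /asboolP yz; apply/asboolP => m; rewrite xy.
Qed.

(** The quotient by the core of [C], the intersection of its conjugates. *)
Definition faithful : topologicalType := quot (EquivRelPack kernel_class).
Definition toF (x : K) : faithful := class_of _ x.

Lemma toFP x y : toF x = toF y <-> forall m, coset (x * m) = coset (y * m).
Proof. by split=> [/classP/asboolP|?]; [|apply/classP/asboolP]. Qed.

Lemma toF_repr (a : faithful) : toF (repr a) = a. Proof. exact: reprK. Qed.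

Definition fmul (a b : faithful) : faithful := toF (repr a * repr b).
Definition finv (a : faithful) : faithful := toF (inv (repr a)).

Lemma toFM x y : toF (x * y) = fmul (toF x) (toF y).
Proof.
have /toFP ex := toF_repr (toF x); have /toFP ey := toF_repr (toF y).
apply/toFP => m; rewrite -!gmulA ex.
exact/esym/coset_l.
Qed.

Lemma fmulA : associative fmul.
Proof.
by move=> a b c; rewrite -(toF_repr a) -(toF_repr b) -(toF_repr c) -!toFM gmulA.
Qed.

Lemma fmul1 : left_id (toF (gone L)) fmul.
Proof. by move=> a; rewrite -(toF_repr a) -toFM gmul1l. Qed.

Lemma fmulV : left_inverse (toF (gone L)) finv fmul.
Proof. by move=> a; rewrite /finv -{2}(toF_repr a) -toFM gmulVl. Qed.

Definition faithful_law : group_law faithful := mk_law fmulA fmul1 fmulV.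

Lemma faithful_compact : compact [set: faithful].
Proof. exact: quot_compact. Qed.

Lemma toF_continuous : continuous toF.
Proof. exact: class_continuous. Qed.

Lemma faithful_hausdorff : hausdorff_space faithful.
Proof.
apply: quot_hausdorff => //.
rewrite (_ : [set p | _] = \bigcap_(m in [set: K])
    [set p : K * K | coset (p.1 * m) = coset (p.2 * m)]).
  apply: closed_bigI => m _.
  apply: (closed_preim (f := fun p : K * K => (coset (p.1 * m), coset (p.2 * m))) _
    (closed_diag cosets_hausdorff)).
  apply: continuous_pair; apply: continuousC coset_continuous.
    by apply: continuous_gmul => //; ctn.
  by apply: continuous_gmul => //; ctn.
by apply/seteqP; split=> p /= => [/asboolP H m _|H]; [exact: H|apply/asboolP => m; exact: H].
Qed.

Lemma faithful_topological : topological_group faithful_law.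
Proof.
apply: (quotient_topological_group (q := toF) tL Kc faithful_compact).
- exact: faithful_hausdorff.
- exact: toF_continuous.
- exact: class_surj.
- exact: toFM.
Qed.

Lemma toF_coset x y : toF x = toF y -> coset x = coset y.
Proof. by move=> /toFP /(_ (gone L)); rewrite !gmul1r. Qed.

(** An element is determined by its action on a countable dense set of cosets [coset (d j)], and the
    images of these are told apart by the functions [h i]. *)
Lemma faithful_separating : countable_base cosets ->
  separating_functions R faithful.
Proof.
move=> bB; have [h [hc h01 hs]] :=
  separating_compact R cosets_compact cosets_hausdorff bB.
have [B [oB bBB]] := bB.
have /choice [d dP] : forall n, exists m, B n !=set0 -> B n (coset m).
  move=> n; have [[b Bb]|nB] := pselect (B n !=set0); last by exists (gone L).
  by have [m mb] := class_surj b; exists m => _; rewrite /coset mb.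
exists (fun n a => h (odflt (0, 0) (unpickle n)).1
  (coset (repr a * d (odflt (0, 0) (unpickle n)).2))); split.
- move=> n; set p := odflt _ _; apply/continuous_closedP => D cD.
  apply/quot_closedP.
  have := closed_preim (f := fun x => h p.1 (coset (x * d p.2))) _ cD.
  rewrite (_ : _ @^-1` D = class_of _ @^-1` ((fun a : faithful =>
      h p.1 (coset (repr a * d p.2))) @^-1` D)).
    apply; apply: (continuousC _ (hc _)); apply: continuousC coset_continuous.
    exact: continuous_mulr.
  apply/seteqP; split=> x /=; have /toFP -> // := toF_repr (toF x).
- by move=> n a; exact: h01.
- move=> a b H; rewrite -(toF_repr a) -(toF_repr b); apply/toFP => m.
  have Hd n : coset (repr a * d n) = coset (repr b * d n).
    by apply: hs => i; have := H (pickle (i, n)); rewrite pickleK.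
  apply: contrapT => nm.
  have oO := closed_openC (@coset_closed_eq (repr a) (repr b)).
  (* The points where the two actions differ form an open union of cosets; its image is open, so it
     contains some [coset (d n)]. *)
  pose O1 := coset @` (~` [set m | coset (repr a * m) = coset (repr b * m)]).
  have oO1 : open O1.
    apply/quot_openP.
    rewrite (_ : _ @^-1` _ = ~` [set m | coset (repr a * m) = coset (repr b * m)]) //.
    apply/seteqP; split=> [x [y ny yx] /= E|x nx]; last by exists x.
    by apply: ny => /=; rewrite (coset_l _ yx) (coset_l _ yx).
  have [|n [Bn BnO]] := bBB (coset m) O1 oO1; first by exists m.
  have /BnO [y ny /= yd] : B n (coset (d n)) by apply: dP; exists (coset m).
  by apply: ny => /=; rewrite (coset_l _ yd) (coset_l _ yd).
Qed.

End Metrizable.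

Section Homeomorphism.
Variables (R : realType) (X : topologicalType) (E : equiv_rel X)
  (K : topologicalType) (L : group_law K) (S : set K) (kappa : K -> quot E).
Hypotheses (Xc : compact [set: X]) (Xh : hausdorff_space X)
  (Xb : countable_base X) (pres : presented L S kappa).
Local Infix "*" := (gmul L).
Local Notation inv := (ginv L).

Let tL : topological_group L. Proof. by case: pres => [[]]. Qed.
Let Kc : compact [set: K]. Proof. by case: pres => [[]]. Qed.
Let Kh : hausdorff_space K. Proof. by case: pres => [[]]. Qed.
Let sS : subgroup L S. Proof. by case: pres => [[]]. Qed.
Let kS k k' : kappa k = kappa k' <-> S (inv k * k').
Proof. by case: pres => _ [H _ _] _; exact: H. Qed.
Let ks c : exists k, kappa k = c. Proof. by case: pres => _ [_ H _] _; exact: H. Qed.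
Let kq A : closed (kappa @^-1` A) -> closed A.
Proof. by case: pres => _ [_ _ H] _; exact: H. Qed.

Let C := closure S.
Let sC : subgroup L C. Proof. exact: closure_subgroup. Qed.
Let cC : closed C. Proof. exact: closed_closure. Qed.
Local Notation cos := (coset sC).
Local Notation toFa := (toF sC).

Lemma kappa_coset k k' : kappa k = kappa k' -> cos k = cos k'.
Proof. by move=> /kS Skk'; apply/cosetP; exact: subset_closure. Qed.

Lemma section_exists : exists s : quot E -> K, forall c, kappa (s c) = c.
Proof. by have /choice [s sP] := ks; exists s. Qed.

(** As [S] lies in [C], the cosets of [C] are a continuous image of X/E, hence of [X]; the choice of
    the section [s] is immaterial. *)
Lemma cosets_countable_base : countable_base (cosets sC).
Proof.
have [s sP] := section_exists.
apply: (countable_base_img (g := fun x => cos (s (class_of E x)))) => //.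
- exact: cosets_hausdorff.
- apply/continuous_closedP => D cD.
  have /quot_closedP : closed ((fun c => cos (s c)) @^-1` D) => //.
  apply: kq; have := closed_preim (coset_continuous (sC := sC)) cD.
  rewrite (_ : cos @^-1` D = kappa @^-1` ((fun c => cos (s c)) @^-1` D)) //.
  by apply/seteqP; split=> k /=; rewrite (kappa_coset (sP (kappa k))).
- move=> b; have [k kb] := class_surj b; have [x xk] := class_surj (kappa k).
  by exists x; rewrite xk -kb; apply: kappa_coset.
Qed.

(** The source of indiscreteness: a closed set invariant under a subgroup is invariant under its
    closure. *)
Lemma closed_invariant (T : topologicalType) (M : group_law T) (A V : set T) :
  topological_group M -> closed A -> (forall x v, A x -> V v -> A (gmul M x v)) ->
  forall x v, A x -> closure V v -> A (gmul M x v).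
Proof.
move=> tM cA inv x v Ax; apply: (closure_subr (f := fun v => gmul M x v)) => //.
  exact: continuous_mull.
by move=> w Vw; exact: inv.
Qed.

(** Both spaces fibre over the cosets of [C], and their closed sets are unions of fibres. A
    bijection over the identity of the base is then a homeomorphism, whatever it does inside the
    fibres. *)
Theorem presented_homeomorphic :
  exists (K' : topologicalType) (L' : group_law K') (H : groupClosed (law_group L')),
     [/\ topological_group L', compact [set: K'], polish R K'
       & homeomorphic (quot E) (@quot K' (coset_equiv H))].
Proof.
have [s sP] := section_exists.
have [cc ccI] := countable_base_embedding Xh Xb.
(* The fibre over the trivial coset, a copy of C/S; [cc] bounds its cardinality by the continuum. *)
pose A := kappa @` C.
have [T [LT [ST [beta [[tT Tc Th Tf] [sST dST [bI bS]]]]]]] :=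
  @dense_subgroup_of_index R (quot E) A (fun q => cc (repr q))
    (ex_intro _ (kappa (gone L)) (imageP kappa sC.1))
    (fun a b _ _ ab => etrans (esym (reprK a))
       (etrans (congr1 (class_of E) (ccI _ _ ab)) (reprK b))).
pose K1 := faithful sC; pose L1 := faithful_law sC.
have tL1 : topological_group L1 by exact: faithful_topological.
have K1c : compact [set: K1] by exact: faithful_compact.
have K1h : hausdorff_space K1 by exact: faithful_hausdorff.
pose H1 := toFa @` C.
have H1P k : H1 (toFa k) <-> C k.
  split=> [[c Cc /toF_coset /cosetP ck]|Ck]; last by exists k.
  by have := subgroupM sC Cc ck; rewrite gmulVK.
have qM x y : toFa (x * y) = gmul L1 (toFa x) (toFa y) by exact: toFM.
have qV x : toFa (inv x) = ginv L1 (toFa x).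
  rewrite -(gmul1r L1 (ginv L1 (toFa x))) -[gone L1](_ : toFa (gone L) = _) //.
  by rewrite -(gmulVr L x) qM gmulKV.
have sH1 : subgroup L1 H1.
  split; first by exists (gone L) => //; exact: sC.1.
  move=> _ _ [x Cx <-] [y Cy <-]; rewrite -qV -qM; apply/H1P.
  exact: sC.2.
have H1c k k' : H1 (gmul L1 (ginv L1 (toFa k)) (toFa k')) <-> cos k = cos k'.
  by rewrite -qV -qM; split=> [/H1P/cosetP|/cosetP/H1P].
pose L' := prod_law L1 LT.
pose sH := prod_subgroup sH1 sST.
pose H := groupClosed_of_subgroup sH.
have tL' : topological_group L' by exact: prod_topological.
have K'c : compact [set: (K1 * T)%type] by rewrite -setXTT; exact: compact_setX.
exists (K1 * T)%type, L', H; split=> //.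
  apply: separating_polish => //; apply: separating_prod => //.
  by apply: faithful_separating => //; exact: cosets_countable_base.
(* [sg c] depends only on the coset of [C] containing [s c]. Its inverse moves the fibre of [c] to
   [A], where [ta c] is the position of [c]. *)
pose sg (c : quot E) : K := repr (cos (s c)).
have sgP c : cos (sg c) = cos (s c) by exact: reprK.
pose ta (c : quot E) : quot E := kappa (inv (sg c) * s c).
have taA c : A (ta c).
  by exists (inv (sg c) * s c) => //; apply/cosetP.
have sgk k : cos (sg (kappa k)) = cos k.
  by rewrite sgP; apply: kappa_coset; rewrite sP.
have sgE c c' : cos (s c) = cos (s c') -> sg c = sg c' by rewrite /sg => ->.
have taE k x : sg (kappa k) = x -> ta (kappa k) = kappa (inv x * k).
  move=> <-; apply/kS; rewrite ginvM ginvK -gmulA gmulVK.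
  by apply/kS; rewrite sP.
pose cls (p : K1 * T) : quot (coset_equiv H) := class_of (coset_equiv H) p.
have clsP p p' : cls p = cls p' <->
    H1 (gmul L1 (ginv L1 p.1) p'.1) /\ ST (gmul LT (ginv LT p.2) p'.2).
  by split=> [/classP/coset_equivP|?]; [|apply/classP/coset_equivP].
pose h c := cls (toFa (sg c), beta (ta c)).
have hI : injective h.
  move=> c c' /clsP /= [/H1c E1 E2].
  have e : sg c = sg c' by apply: sgE; rewrite -!sgP.
  have /kS := bI _ _ (taA c) (taA c') E2.
  by rewrite e ginvM ginvK -gmulA gmulVK => /kS; rewrite !sP.
have hk k a t : cls (toFa k, t) = cls (toFa k, beta a) -> A a ->
    exists2 c, h c = cls (toFa k, t) & cos (s c) = cos k.
  move=> E1 [d Cd da].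
  pose x := sg (kappa k); have xk : cos x = cos k by exact: sgk.
  exists (kappa (x * d)); last first.
    rewrite -sgP sgk -xk; apply/cosetP.
    by rewrite ginvM -gmulA gmulVl gmul1r; exact: (subgroupV sC).
  have sx : sg (kappa (x * d)) = x.
    apply: sgE; rewrite -!sgP !sgk -xk; apply/cosetP.
    by rewrite ginvM -gmulA gmulVl gmul1r; exact: (subgroupV sC).
  rewrite E1 /h (taE _ _ sx) sx gmulKV da; apply/clsP => /=; split; first exact/H1c.
  by rewrite gmulVl; exact: sST.1.
have hS k t : exists2 c, h c = cls (toFa k, t) & cos (s c) = cos k.
  have [a Aa Sa] := bS t; apply: (hk k a t) => //; apply/esym/clsP => /=.
  by rewrite gmulVl; split=> //; exact: sH1.1.
have hS' p : exists c, h c = p.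
  have [[a t] <-] := class_surj p; have [k <-] := class_surj a.
  by have [c hc _] := hS k t; exists c.
have /choice [g gP] := hS'.
exists h, g; split.
- by move=> c; apply: hI; rewrite gP.
- by move=> p; exact: gP.
- apply/continuous_closedP => D /quot_closedP cD.
  pose D1 := class_of (coset_equiv H) @^-1` D.
  have inv1 x v : D1 x -> (H1 `*` ST) v -> D1 (gmul L' x v).
    move=> Dx [v1 v2]; have E1 : cls x = cls (gmul L' x v).
      by apply/clsP => /=; rewrite !gmulKV.
    by have : D (cls x) := Dx; rewrite E1.
  (* Since [ST] is dense, the closure of the product of [H1] and [ST] contains all [(gone L1, t)];
     so [D1] ignores the second coordinate. *)
  have invT a t t' : D1 (a, t) -> D1 (a, t').
    move=> Dat; have := closed_invariant tL' cD inv1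
      (v := (gone L1, gmul LT (ginv LT t) t')) Dat.
    have -> : gmul L' (a, t) (gone L1, gmul LT (ginv LT t) t') = (a, t').
      rewrite -[LHS]/(gmul L1 a (gone L1),
        gmul LT t (gmul LT (ginv LT t) t')).
      by rewrite gmul1r gmulVK.
    apply=> N [[P Q] /= [P1 Qt] PQ].
    have [y [Sy Qy]] := dST (gmul LT (ginv LT t) t') Q Qt.
    exists (gone L1, y); split; first by split=> //; exact: sH1.1.
    apply: PQ; split; last by [].
    by have := @nbhs_singleton _ (gone L1) P P1.
  apply: kq.
  have := closed_preim (f := fun k => (toFa k, gone LT)) _ cD.
  rewrite (_ : _ @^-1` _ = kappa @^-1` (h @^-1` D)).
    apply; apply: continuous_pair; last by ctn.
    exact: toF_continuous.
  have D1k k k' t : cos k = cos k' -> D1 (toFa k, t) -> D1 (toFa k', t).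
    move=> kk' Dk; have E1 : cls (toFa k, t) = cls (toFa k', t).
      apply/clsP => /=; split; first exact/H1c.
      by rewrite gmulVl; exact: sST.1.
    by have : D (cls (toFa k, t)) := Dk; rewrite E1.
  apply/seteqP; split=> k /= Dk.
    by apply: (invT _ (gone LT)); apply: D1k Dk; rewrite sgk.
  by apply: (D1k (sg (kappa k))); [exact: sgk|exact: invT Dk].
- apply/continuous_closedP => D cD.
  apply/quot_closedP.
  have cK : closed (kappa @^-1` D).
    by apply: closed_preim => //; exact: kappa_continuous pres.
  (* The preimage of [D] in [K] is closed and invariant under [S], hence under [C]. *)
  have invD x v : D (kappa x) -> C v -> D (kappa (x * v)).
    move=> Dx Cv; apply: (closed_invariant tL cK _ Dx Cv) => y w /= Dy Sw.
    have E1 : kappa y = kappa (y * w) by apply/kS; rewrite gmulKV.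
    by rewrite /= -E1.
  have Dk c k : cos (s c) = cos k -> D c <-> D (kappa k).
    move=> ck; split=> Dc.
      have -> : k = s c * (inv (s c) * k) by rewrite gmulVK.
      by apply: invD; [rewrite sP|apply/cosetP].
    rewrite -(sP c); have -> : s c = k * (inv k * s c) by rewrite gmulVK.
    by apply: invD => //; apply/cosetP.
  rewrite (_ : _ @^-1` _ = (toFa @` (kappa @^-1` D)) `*` [set: T]).
    have cF : closed (toFa @` (kappa @^-1` D)).
      apply: closed_img => //; exact: toF_continuous.
    rewrite (_ : _ `*` _ = fst @^-1` (toFa @` (kappa @^-1` D))).
      by apply: closed_preim => //; ctn.
    by apply/seteqP; split=> -[a t] //= [].
  have gk k t : D (g (cls (toFa k, t))) <-> D (kappa k).
    have [c hc ck] := hS k t; rewrite -hc (_ : g (h c) = c); last first.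
      by apply: hI; rewrite gP.
    exact: Dk.
  apply/seteqP; split=> -[a t] /=.
    have [k <-] := class_surj a => /gk Dkk.
    by split=> //; exists k.
  by move=> [[k Dkk <-] _]; apply/gk.
Qed.

End Homeomorphism.

Theorem theorem2 (R : realType) (G : groupType) (X : ambit G)
    (E : equiv_rel X)
    (X_polish : polish R X)
    (E_wupgl : weakly_uniformly_properly_group_like E) :
  (exists (K : topologicalType) (L : group_law K) (H : groupClosed (law_group L)),
     [/\ topological_group L, compact [set: K], polish R K
       & homeomorphic (quot E) (@quot K (coset_equiv H))])
  /\ exactly_one_of3
       (clopen (graph E) /\ finite_set [set: quot E])
       (closed (graph E) /\ has_continuum_classes E)
       [/\ ~ closed (graph E), ~ smooth E
         & analytic (graph E) -> has_continuum_classes E]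
  /\ (smooth E <-> closed (graph E)).
Proof.
have [K [L [S [kappa pres]]]] := dominated_presented E_wupgl.
have Xc : compact [set: X] by exact: ambit_compact.
have Xh : hausdorff_space X by exact: ambit_hausdorff.
have Xb := polish_countable_base X_polish.
split; first exact: presented_homeomorphic pres.
split; first exact: presented_trichotomy pres.
split; first exact: closed_of_smooth pres.
exact: smooth_of_closed pres.
Qed.
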